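(* Let $N\ge1$ and let $(\mathbb{R}^N,\mathbb{R},\mathcal{L})$ be a cut and project scheme with $\mathcal{L}=A(\mathbb{Z}^{N+1})$, $A=(a_{i,j})_{i,j=1}^{N+1}\in\mathrm{GL}(N+1,\mathbb{R})$, normalized so that $a_{N+1,j}\in(0,1)$ for $j=1,\ldots,N$ and $a_{N+1,N+1}=1$. For $v\in\mathbb{Z}^N$ let $(l_v,l_v^* )\in\mathcal{L}$, the numbering $(v(n))_{n\in\mathbb{N}}$ of $\mathbb{Z}^N$, the sequences $(n_k)_{k\in\mathbb{N}}$ and $(\varepsilon_k)_{k\in\mathbb{N}}$, the intervals $I_k=(l^*_{v(n_k)},l^*_{v(n_k)}+\varepsilon_k)$, the Cantor set $C_0=[0,1]\setminus\bigcup_{k}I_k$ and the open sets $A_k\subseteq[0,1]$ be as described in the context, and define the window $$W\ =\ C_0\cup\bigcup_{k\in\mathbb{N}}\bigl(I_k\cap\mathrm{cl}(A_k+\inf(I_k))\bigr).$$ Let $\beta_\vartheta:\Omega(\curlywedge(W+\vartheta))\to\mathbb{T}$ be the corresponding torus parametrization and let $S=\{l_{v(n_k)}\mid k\in\mathbb{N}\}$. Then the following holds. (a) For all $\vartheta\in\mathbb{R}$, the pair $(\Xi,S)$ with $\Xi=\beta_\vartheta^{-1}([0,-\vartheta]_{\mathcal{L}})$ is an embedded fullshift, with the grid $U=\bigcup_{\Gamma\in\Xi}\Gamma$ given by $U=\curlywedge(W)$. In particular, $(\Omega(\curlywedge(W+\vartheta)),\mathbb{R}^N)$ has positive topological entropy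 for all $\vartheta\in\mathbb{R}$. (b) For all $\vartheta\in\mathbb{R}$ the system $(\Omega(\curlywedge(W+\vartheta)),\mathbb{R}^N)$ is not uniquely ergodic.
   Context: Cut and project scheme here: $\mathcal{L}=A(\mathbb{Z}^{N+1})\subseteq\mathbb{R}^N\times\mathbb{R}$ is a lattice such that $\pi_1:\mathbb{R}^N\times\mathbb{R}\to\mathbb{R}^N$ is injective on $\mathcal{L}$ and $\pi_2:\mathbb{R}^N\times\mathbb{R}\to\mathbb{R}$ maps $\mathcal{L}$ to a dense set $L^*=\pi_2(\mathcal{L})$. For relatively compact $W\subseteq\mathbb{R}$, $\curlywedge(W)=\pi_1(\mathcal{L}\cap(\mathbb{R}^N\times W))$. $W$ is proper if $\mathrm{cl}(\mathrm{int}(W))=W$ (the window of the theorem is proper). Points $l_v,l_v^*$: for $v=(v_1,\ldots,v_N)\in\mathbb{Z}^N$ there is a unique $v_{N+1}\in\mathbb{Z}$ with $l_v^*:=\sum_{j=1}^{N+1}a_{N+1,j}v_j\in[0,1)$; thus $l_v^*\in L^*$, and $l_v$ is the unique point with $(l_v,l_v^* )\in\mathcal{L}$ given by $(l_v,l_v^* )=A(v,v_{N+1})^{T}$. Fix a numbering $(v(n))_{n\in\mathbb{N}}$ of $\mathbb{Z}^N$ such that $\|v(n)\|_\infty$ is non-decreasing in $n$. Sequences: $(n_k)_{k\in\mathbb{N}}\subseteq\mathbb{N}$ is increasing and $\varepsilon_k>0$ are such that the open intervals $I_k=(l^*_{v(n_k)},l^*_{v(n_k)}+\varepsilon_k)$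 satisfy (i) $I_j\cap I_k=\emptyset$ for $j\ne k$; (ii) $\mathrm{cl}(\bigcup_kI_k)=[0,1]$; (iii) $\lim_{k\to\infty}k/n_k>1/2$. Sets $A_k$: let $C$ be a Cantor set in $[0,1]$ with $\{0,1\}\subseteq C$; $(A_k)_{k\in\mathbb{N}}$ is a sequence of open subsets of $[0,1]$ such that each $A_k$ is a union of gaps of $C$ (bounded connected components of $\mathbb{R}\setminus C$), $\partial A_k=C$ for all $k$, and the family $(A_k)$ is locally topologically independent in $0$, i.e. for every finite $F\subseteq\mathbb{N}$ and $a\in\{0,1\}^F$, $0\in\mathrm{cl}\bigl(\mathrm{int}\bigl(\bigcap_{s\in F:a_s=1}A_s\setminus\bigcup_{s\in F:a_s=0}A_s\bigr)\bigr)$ (an empty intersection being $\mathbb{R}$). Hull: the space of closed subsets of $\mathbb{R}^N$ (including $\emptyset$) carries the compact metric $d(\Lambda_1,\Lambda_2)=d_H(j^{-1}(\Lambda_1\cup\{\infty\}),j^{-1}(\Lambda_2\cup\{\infty\}))$, where $j:\mathbb{S}^N\to\mathbb{R}^N\cup\{\infty\}$ is stereographic projection and $d_H$ the Hausdorff metric on compact subsets of $\mathbb{S}^N$. For uniformly discrete $\Lambda$ (distinct points at distance $\ge r$ for some $r>0$), $\Omega(\Lambda)=\mathrm{cl}\{\Lambda-s\mid s\in\mathbb{R}^N\}$ with action $\varphi_s(\Gamma)=\Gamma-s$. Uniquely ergodic: exactly one invariant Borel probability measure. Torus parametrization: $\mathbb{T}=(\mathbb{R}^N\times\mathbb{R})/\mathcal{L}$,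 $[s,h]_{\mathcal{L}}$ is the class of $(s,h)$, with $\mathbb{R}^N$-action $\omega_s(\xi)=\xi+[s,0]_{\mathcal{L}}$. A flow morphism is a continuous surjection intertwining the $\mathbb{R}^N$-actions. For proper $W$, $\beta_\vartheta:\Omega(\curlywedge(W+\vartheta))\to\mathbb{T}$ denotes the unique flow morphism with $\beta_\vartheta(\curlywedge(W+\vartheta))=0$; it satisfies $\beta_\vartheta(\Gamma)=[s,h]_{\mathcal{L}}$ iff $\curlywedge(\mathrm{int}(W)+\vartheta+h)-s\subseteq\Gamma\subseteq\curlywedge(W+\vartheta+h)-s$ (a known result recalled in the paper). Embedded fullshift: with $F_t=[-t,t]^N$ and Lebesgue measure $\lambda$, $\nu_S=\limsup_{t\to\infty}\sharp(S\cap F_t)/\lambda(F_t)$. An embedded fullshift in $\Omega(\Lambda)$ is a pair $(\Xi,S)$ with $\Xi\subseteq\Omega(\Lambda)$ closed and $S\subseteq\mathbb{R}^N$ such that $\nu_S>0$, the grid $U=\bigcup_{\Gamma\in\Xi}\Gamma$ is uniformly discrete, and for every $S'\subseteq S$ there is $\Gamma\in\Xi$ with $\Gamma\cap S=S'$. Topological entropy of an $\mathbb{R}^N$-action $\phi$ on a compact metric space $(X,d)$: $Y\subseteq X$ is $(\varepsilon,t)$-separated if $\max_{s\in F_t}d(\phi_s(x),\phi_s(x'))\ge\varepsilon$ for all distinct $x,x'\in Y$; $N(\phi,\varepsilon,t)$ is the maximal cardinality of such a set; $h_{\mathrm{top}}(\phi)=\sup_{\varepsilon>0}\limsup_{t\to\infty}\frac{1}{\lambda(F_t)}\log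 N(\phi,\varepsilon,t)$. *)

(* Defs.v *)
From HB Require Import structures.
From mathcomp Require Import all_boot all_order all_algebra generic_quotient.
From mathcomp Require Import all_classical all_reals all_analysis.
From mathcomp Require Import ring lra.
Set Implicit Arguments.
Unset Strict Implicit.
Unset Printing Implicit Defensive.
Import Order.TTheory GRing.Theory Num.Theory.
Import numFieldNormedType.Exports.
Local Open Scope classical_set_scope.
Local Open Scope ring_scope.

Section Euclidean.
Context {R : realType} {m : nat}.
Implicit Types x y z : 'cV[R]_m.

Definition edot x y : R := \sum_i x i 0 * y i 0.
Definition enorm x : R := Num.sqrt (edot x x).

Lemma edotC x y : edot x y = edot y x.
Proof. by apply: eq_bigr => i _; rewrite mulrC. Qed.

Lemma edotDl x y z : edot (x + y) z = edot x z + edot y z.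
Proof. by rewrite -big_split; apply: eq_bigr => i _; rewrite mxE mulrDl. Qed.

Lemma edotZl a x y : edot (a *: x) y = a * edot x y.
Proof. by rewrite mulr_sumr; apply: eq_bigr => i _; rewrite mxE mulrA. Qed.

Lemma edotNl x y : edot (- x) y = - edot x y.
Proof. by rewrite -scaleN1r edotZl mulN1r. Qed.

Lemma edotDr x y z : edot x (y + z) = edot x y + edot x z.
Proof. by rewrite edotC edotDl !(edotC x). Qed.

Lemma edotZr a x y : edot x (a *: y) = a * edot x y.
Proof. by rewrite edotC edotZl edotC. Qed.

Lemma edotNr x y : edot x (- y) = - edot x y.
Proof. by rewrite edotC edotNl edotC. Qed.

Lemma edot0r x : edot x 0 = 0.
Proof. by rewrite -(scale0r x) edotZr mul0r. Qed.

Lemma edot_ge0 x : 0 <= edot x x.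
Proof. by apply: sumr_ge0 => i _; rewrite -expr2 sqr_ge0. Qed.

Lemma edot_coord x i : x i 0 ^+ 2 <= edot x x.
Proof.
rewrite /edot (bigD1 i)//= -expr2 lerDl.
by apply: sumr_ge0 => j _; rewrite -expr2 sqr_ge0.
Qed.

Lemma edot_eq0 x : edot x x = 0 -> x = 0.
Proof.
move=> x0; apply/colP => i; rewrite mxE; apply/eqP.
by rewrite -sqrf_eq0 eq_le sqr_ge0 andbT -x0 edot_coord.
Qed.

Lemma cauchy_schwarz x y : edot x y ^+ 2 <= edot x x * edot y y.
Proof.
have [y0|y0] := eqVneq (edot y y) 0.
  by rewrite (edot_eq0 y0) !edot0r expr0n mulr0.
have yp : 0 < edot y y by rewrite lt_def y0 edot_ge0.
have := edot_ge0 (edot y y *: x - edot x y *: y).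
rewrite !(edotDl, edotDr, edotNl, edotNr, edotZl, edotZr) (edotC y x) => h.
rewrite -subr_ge0 -(pmulr_rge0 _ yp); apply: le_trans h _.
by rewrite le_eqVlt; apply/orP; left; apply/eqP; ring.
Qed.

Lemma enorm_ge0 x : 0 <= enorm x. Proof. exact: sqrtr_ge0. Qed.

Lemma enorm_sqr x : enorm x ^+ 2 = edot x x.
Proof. by rewrite sqr_sqrtr// edot_ge0. Qed.

Lemma enormN x : enorm (- x) = enorm x.
Proof. by rewrite /enorm edotNl edotNr opprK. Qed.

Lemma enormB x y : enorm (x - y) = enorm (y - x).
Proof. by rewrite -enormN opprB. Qed.

Lemma enorm0 : enorm (0 : 'cV[R]_m) = 0.
Proof. by rewrite /enorm edot0r sqrtr0. Qed.

Lemma enormD x y : enorm (x + y) <= enorm x + enorm y.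
Proof.
rewrite -(@ler_pXn2r _ 2)// ?nnegrE ?addr_ge0 ?enorm_ge0//.
rewrite sqrrD !enorm_sqr edotDl !edotDr (edotC y x).
have h : edot x y <= enorm x * enorm y.
  apply: le_trans (ler_norm _) _.
  rewrite -(@ler_pXn2r _ 2)// ?nnegrE ?mulr_ge0 ?enorm_ge0//.
  by rewrite exprMn !enorm_sqr real_normK ?num_real ?cauchy_schwarz.
rewrite mulr2n; lra.
Qed.

Lemma enorm_coord x i : `|x i 0| <= enorm x.
Proof.
rewrite -(@ler_pXn2r _ 2)// ?nnegrE ?enorm_ge0//.
by rewrite enorm_sqr real_normK ?num_real ?edot_coord.
Qed.

End Euclidean.

Section Hausdorff.
Context {R : realType} {m : nat}.
Implicit Types (A B C : set 'cV[R]_m) (p q : 'cV[R]_m).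

Definition dist_to B p : R := inf [set enorm (p - q) | q in B].

(* Intended for nonempty subsets of the unit sphere, where sup and inf are the
   genuine ones. *)
Definition hausdorff_dist A B : R :=
  Num.max (sup [set dist_to B p | p in A]) (sup [set dist_to A q | q in B]).

Definition sphere : set 'cV[R]_m := [set p | enorm p = 1].

Lemma dist_to_le B p q : B q -> dist_to B p <= enorm (p - q).
Proof.
move=> Bq; apply: ge_inf; last by exists q.
by exists 0 => _ [r _ <-]; exact: enorm_ge0.
Qed.

Lemma dist_to_lt B p c : B !=set0 -> dist_to B p < c ->
  exists2 q, B q & enorm (p - q) < c.
Proof.
move=> [q0 Bq0] /inf_lt[|_ [q Bq <-] lt_c]; last by exists q.
by exists (enorm (p - q0)), q0.
Qed.

Lemma dist_to_ub A B p : A `<=` sphere -> B `<=` sphere -> B !=set0 ->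
  A p -> dist_to B p <= 2.
Proof.
move=> sA sB [q Bq] Ap; apply: le_trans (dist_to_le _ Bq) _.
by apply: le_trans (enormD _ _) _; rewrite enormN (sA _ Ap) (sB _ Bq).
Qed.

Lemma dist_to_hausdorff A B p : A `<=` sphere -> B `<=` sphere ->
  B !=set0 -> A p -> dist_to B p <= hausdorff_dist A B.
Proof.
move=> sA sB B0 Ap; rewrite /hausdorff_dist le_max; apply/orP; left.
apply: ub_le_sup; last by exists p.
by exists 2 => _ [r Ar <-]; exact: (dist_to_ub sA).
Qed.

Lemma hausdorff_distC A B : hausdorff_dist A B = hausdorff_dist B A.
Proof. exact: maxC. Qed.

Lemma hausdorff_le A B c : A !=set0 -> B !=set0 ->
  (forall p, A p -> dist_to B p <= c) -> (forall q, B q -> dist_to A q <= c) ->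
  hausdorff_dist A B <= c.
Proof.
move=> [p Ap] [q Bq] hA hB; rewrite /hausdorff_dist ge_max; apply/andP; split.
  by apply: ge_sup => [|_ [r Ar <-]]; [exists (dist_to B p), p|exact: hA].
by apply: ge_sup => [|_ [r Br <-]]; [exists (dist_to A q), q|exact: hB].
Qed.

Lemma dist_to_id A p : A p -> dist_to A p = 0.
Proof.
move=> Ap; apply/eqP; rewrite eq_le; apply/andP; split.
  by apply: le_trans (dist_to_le _ Ap) _; rewrite subrr enorm0.
by apply: lb_le_inf => [|_ [q _ <-]]; [exists (enorm (p - p)), p|
  exact: enorm_ge0].
Qed.

Lemma hausdorff_ge0 A B : A `<=` sphere -> B `<=` sphere -> A !=set0 ->
  B !=set0 -> 0 <= hausdorff_dist A B.
Proof.
move=> sA sB [p Ap] B0; apply: le_trans (dist_to_hausdorff sA sB B0 Ap).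
have [q Bq] := B0.
apply: lb_le_inf => [|_ [r _ <-]]; [by exists (enorm (p - q)), q|].
exact: enorm_ge0.
Qed.

Lemma hausdorff_distxx A : A `<=` sphere -> A !=set0 -> hausdorff_dist A A = 0.
Proof.
move=> sA A0; apply/eqP; rewrite eq_le hausdorff_ge0// andbT.
by apply: hausdorff_le => // p Ap; rewrite dist_to_id.
Qed.

Lemma hausdorff_triangle A B C : A `<=` sphere -> B `<=` sphere ->
  C `<=` sphere -> A !=set0 -> B !=set0 -> C !=set0 ->
  hausdorff_dist A C <= hausdorff_dist A B + hausdorff_dist B C.
Proof.
have main A' B' C' : A' `<=` sphere -> B' `<=` sphere -> C' `<=` sphere ->
    B' !=set0 -> C' !=set0 -> forall p, A' p ->
    dist_to C' p <= hausdorff_dist A' B' + hausdorff_dist B' C'.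
  move=> sA sB sC B0 C0 p Ap; apply/ler_addgt0Pl => e e0.
  have e2 : 0 < e / 2 by rewrite divr_gt0.
  have [q Bq pq] : exists2 q, B' q &
      enorm (p - q) < hausdorff_dist A' B' + e / 2.
    apply: dist_to_lt => //; apply: le_lt_trans (dist_to_hausdorff sA sB B0 Ap) _.
    by rewrite ltrDl.
  have [r Cr qr] : exists2 r, C' r &
      enorm (q - r) < hausdorff_dist B' C' + e / 2.
    apply: dist_to_lt => //; apply: le_lt_trans (dist_to_hausdorff sB sC C0 Bq) _.
    by rewrite ltrDl.
  apply: le_trans (dist_to_le _ Cr) _.
  have -> : p - r = (p - q) + (q - r) by rewrite addrA subrK.
  apply: le_trans (enormD _ _) _; lra.
move=> sA sB sC A0 B0 C0; apply: hausdorff_le => // p pp; first exact: main.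
rewrite addrC (hausdorff_distC A) (hausdorff_distC B); exact: main.
Qed.

End Hausdorff.

Section ClosedSets.
Context {R : realType} {N : nat}.
Local Notation V := 'cV[R]_N.

Definition north : 'cV[R]_(N + 1) := col_mx 0 1%:M.

(* Stereographic projection from the north pole; None is the point at
   infinity.  Only its values on the unit sphere matter. *)
Definition stereo (p : 'cV[R]_(N + 1)) : option V :=
  if p == north then None
  else Some ((1 - dsubmx p 0 0)^-1 *: usubmx p).

Definition compactify (L : set V) : set 'cV[R]_(N + 1) :=
  sphere `&` stereo @^-1` (Some @` L `|` [set None]).

(* The inverse of the stereographic projection on R^N. *)
Definition unstereo (x : V) : 'cV[R]_(N + 1) :=
  let r := 1 + edot x x in
  col_mx ((2 / r) *: x) ((1 - 2 / r)%:M).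

Lemma edot_col_mx (x y : V) (a b : R) :
  edot (col_mx x a%:M) (col_mx y b%:M) = edot x y + a * b.
Proof.
rewrite /edot big_split_ord/= big_ord1; congr (_ + _).
  by apply: eq_bigr => i _; rewrite !col_mxEu.
by rewrite !col_mxEd !mxE !eqxx !mulr1n.
Qed.

Lemma r_gt0 (x : V) : 0 < 1 + edot x x.
Proof. by rewrite ltr_pwDl// edot_ge0. Qed.

Lemma enorm_north : enorm north = 1.
Proof.
by rewrite /enorm edot_col_mx mulr1 edot0r add0r sqrtr1.
Qed.

Lemma col_mxB (x y : V) (a b : R) :
  col_mx x a%:M - col_mx y b%:M = col_mx (x - y) (a - b)%:M.
Proof. by rewrite opp_col_mx add_col_mx; congr col_mx; rewrite raddfB. Qed.

Lemma enorm_unstereo x : enorm (unstereo x) = 1.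
Proof.
rewrite /unstereo /enorm edot_col_mx edotZl edotZr.
rewrite [X in Num.sqrt X](_ : _ = 1) ?sqrtr1//.
by have /lt0r_neq0 ? := r_gt0 x; field.
Qed.

Lemma unstereo_north x :
  edot (unstereo x - north) (unstereo x - north) = 4 / (1 + edot x x).
Proof.
rewrite /unstereo /north col_mxB edot_col_mx subr0 edotZl edotZr.
by have /lt0r_neq0 ? := r_gt0 x; field.
Qed.

Lemma unstereo_neq x : unstereo x != north.
Proof.
apply/negP => /eqP e; have := unstereo_north x.
rewrite e subrr edot0r.
move/esym/eqP; rewrite mulf_eq0 invr_eq0 (negbTE (lt0r_neq0 (r_gt0 x))) orbF.
by rewrite pnatr_eq0.
Qed.

Lemma unstereo_dist x y :
  edot (unstereo x - unstereo y) (unstereo x - unstereo y) =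
  4 * edot (x - y) (x - y) / ((1 + edot x x) * (1 + edot y y)).
Proof.
rewrite /unstereo col_mxB edot_col_mx.
rewrite !(edotDl, edotDr, edotNl, edotNr, edotZl, edotZr) (edotC y x).
have /lt0r_neq0 ? := r_gt0 x; have /lt0r_neq0 ? := r_gt0 y.
by field; apply/andP.
Qed.

Lemma stereoK x : stereo (unstereo x) = Some x.
Proof.
rewrite /stereo (negbTE (unstereo_neq x)) /unstereo col_mxKu col_mxKd mxE eqxx.
rewrite mulr1n scalerA (_ : _ * _ = 1) ?scale1r//.
have /lt0r_neq0 ? := r_gt0 x.
by field; apply/andP; split => //; rewrite opprB addrC subrK pnatr_eq0.
Qed.

Lemma sphere_unstereo p : sphere p -> p != north ->
  exists x, p = unstereo x.
Proof.
move=> sp pn; set a := dsubmx p 0 0; set u := usubmx p.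
have pE : p = col_mx u a%:M by rewrite -[LHS]vsubmxK -mx11_scalar.
have e1 : edot u u + a * a = 1.
  by rewrite -edot_col_mx -pE -enorm_sqr sp expr1n.
have a1 : 1 - a != 0.
  apply: contra pn; rewrite subr_eq0 => /eqP a1.
  rewrite pE -a1 /north; apply/eqP; congr col_mx; apply: edot_eq0.
  by move: e1; rewrite -a1; lra.
exists ((1 - a)^-1 *: u).
rewrite {1}pE /unstereo edotZl edotZr.
have -> : edot u u = 1 - a * a by rewrite -e1 addrK.
have r2 : 1 + (1 - a)^-1 * ((1 - a)^-1 * (1 - a * a)) = 2 / (1 - a) by field.
have a2 : (2 : R) != 0 by rewrite pnatr_eq0.
rewrite r2 scalerA; congr col_mx.
  by rewrite (_ : _ * _ = 1) ?scale1r//; field; rewrite a1.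
by congr (_%:M); field; rewrite a1.
Qed.

Lemma compactifyE L p : compactify L p <->
  p = north \/ exists2 x, L x & p = unstereo x.
Proof.
split=> [[sp]|].
  have [->|pn] := eqVneq p north; first by left.
  have [x ->] := sphere_unstereo sp pn.
  rewrite /= stereoK => -[[y Ly [yx]]|//]; right.
  by exists x => //; rewrite -yx.
move=> [->|[x Lx ->]]; split.
- exact: enorm_north.
- by right; rewrite /= /stereo eqxx.
- exact: enorm_unstereo.
- by left; rewrite /= stereoK; exists x.
Qed.

Lemma compactify_sphere L : compactify L `<=` sphere.
Proof. by move=> p []. Qed.

Lemma compactify_neq0 L : compactify L !=set0.
Proof. by exists north; apply/compactifyE; left. Qed.

End ClosedSets.

Definition closedSet (R : realType) (N : nat) : Type :=
  set_type [set S : set 'cV[R]_N | closed S].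

Section ClosedSetMetric.
Context {R : realType} {N : nat}.
Local Notation V := 'cV[R]_N.
Implicit Types (G H K : closedSet R N).

HB.instance Definition _ := Choice.on (closedSet R N).

Definition pts G : set V := set_val G.

Lemma pts_closed G : closed (pts G).
Proof. exact: (set_valP G). Qed.

Definition ClosedSet (S : set V) (cS : closed S) : closedSet R N :=
  exist _ S (mem_set cS).

Lemma closedSet_inj G H : pts G = pts H -> G = H.
Proof. exact: val_inj. Qed.

Definition closedSet_dist G H : R :=
  hausdorff_dist (compactify (pts G)) (compactify (pts H)).

Lemma closedSet_distxx G : closedSet_dist G G = 0.
Proof.
by apply: hausdorff_distxx; [exact: compactify_sphere|exact: compactify_neq0].
Qed.

Lemma closedSet_distC G H : closedSet_dist G H = closedSet_dist H G.
Proof. exact: hausdorff_distC. Qed.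

Lemma closedSet_triangle H G K :
  closedSet_dist G K <= closedSet_dist G H + closedSet_dist H K.
Proof.
by apply: hausdorff_triangle;
  (exact: compactify_sphere || exact: compactify_neq0).
Qed.

Lemma closedSet_dist_lt G H x c : pts G x -> closedSet_dist G H < c ->
  exists2 q, compactify (pts H) q & enorm (unstereo x - q) < c.
Proof.
move=> Gx GH; apply: dist_to_lt; first exact: compactify_neq0.
apply: le_lt_trans GH.
apply: dist_to_hausdorff; try exact: compactify_sphere.
  exact: compactify_neq0.
by apply/compactifyE; right; exists x.
Qed.

Lemma closedSet_dist_eq0 G H : closedSet_dist G H = 0 -> G = H.
Proof.
move=> GH; apply: closedSet_inj; move: G H GH.
suff main G H : closedSet_dist G H = 0 -> pts G `<=` pts H.
  by move=> G H GH; apply/seteqP; split; apply: main; rewrite // closedSet_distC.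
move=> GH x Gx.
apply: (@pts_closed H) => B /nbhs_ballP[e /= e0 eB].
have r0 := r_gt0 x; set r := 1 + edot x x in r0.
pose c := Num.min (Num.sqrt r^-1) (e / (2 * r)).
have c0 : 0 < c.
  by rewrite lt_min sqrtr_gt0 invr_gt0 r0 divr_gt0// mulr_gt0.
have [q Hq xq] : exists2 q, compactify (pts H) q & enorm (unstereo x - q) < c.
  by apply: (@closedSet_dist_lt G) => //; rewrite GH.
have xq2 : edot (unstereo x - q) (unstereo x - q) < c ^+ 2.
  by rewrite -enorm_sqr ltr_pXn2r ?nnegrE ?enorm_ge0 ?(ltW c0).
have c1 : c ^+ 2 <= r^-1.
  rewrite -[leRHS]sqr_sqrtr ?invr_ge0 ?(ltW r0)//.
  by rewrite ler_pXn2r ?nnegrE ?(ltW c0) ?sqrtr_ge0// ge_min lexx.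
have /compactifyE[qn|[y Hy qy]] := Hq.
  move: xq2; rewrite qn unstereo_north => /lt_le_trans/(_ c1).
  by rewrite -/r ltr_pdivrMr// mulVf ?lt0r_neq0// ltrn1.
exists y; split => //; apply: eB.
move: xq; rewrite qy => xq.
have s0 := r_gt0 y; set s := 1 + edot y y in s0.
(* |y| is bounded since y stays away from infinity *)
have hs : s <= 4 * r.
  have n1 : enorm (unstereo x - north) = 2 * Num.sqrt r^-1.
    rewrite /enorm unstereo_north sqrtrM//; congr (_ * _).
    by rewrite (_ : 4 = 2 ^+ 2) ?sqrtr_sqr ?normr_nat//; ring.
  have n2 : enorm (unstereo y - north) = 2 * Num.sqrt s^-1.
    rewrite /enorm unstereo_north sqrtrM//; congr (_ * _).
    by rewrite (_ : 4 = 2 ^+ 2) ?sqrtr_sqr ?normr_nat//; ring.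
  have := enormD (unstereo x - unstereo y) (unstereo y - north).
  rewrite addrA subrK n1 n2 => h.
  have h1 : enorm (unstereo x - unstereo y) < Num.sqrt r^-1.
    by apply: lt_le_trans xq _; rewrite ge_min lexx.
  have h2 : Num.sqrt r^-1 <= 2 * Num.sqrt s^-1 by lra.
  have : r^-1 <= 4 * s^-1.
    rewrite -[leLHS]sqr_sqrtr ?invr_ge0 ?(ltW r0)//.
    rewrite -[s^-1]sqr_sqrtr ?invr_ge0 ?(ltW s0)//.
    rewrite (_ : 4 = 2 ^+ 2); last by ring.
    by rewrite -exprMn ler_pXn2r ?nnegrE ?mulr_ge0 ?sqrtr_ge0.
  by rewrite ler_pdivlMr// mulrC ler_pdivrMr.
have xy : edot (x - y) (x - y) < e ^+ 2.
  have := xq2; rewrite qy unstereo_dist -/r -/s ltr_pdivrMr ?mulr_gt0// => h.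
  have c2 : c ^+ 2 <= (e / (2 * r)) ^+ 2.
    rewrite ler_pXn2r ?nnegrE ?(ltW c0) ?ge_min ?lexx ?orbT//.
    by rewrite divr_ge0 ?mulr_ge0 ?(ltW e0) ?(ltW r0).
  have h3 : c ^+ 2 * (r * s) <= (e / (2 * r)) ^+ 2 * (r * (4 * r)).
    rewrite ler_pM ?sqr_ge0 ?mulr_ge0 ?(ltW r0) ?(ltW s0)//.
    by rewrite ler_pM2l.
  have h4 : (e / (2 * r)) ^+ 2 * (r * (4 * r)) = e ^+ 2.
    by have /lt0r_neq0 ? := r0; field.
  have := edot_ge0 (x - y); lra.
split => // i j; rewrite ord1 /ball /=.
have h := enorm_coord (x - y) i; rewrite !mxE in h.
apply: le_lt_trans h _.
by rewrite -(@ltr_pXn2r _ 2)// ?nnegrE ?enorm_ge0 ?(ltW e0)// enorm_sqr.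
Qed.

HB.instance Definition _ := isMetric.Build R (closedSet R N)
  closedSet_distxx closedSet_dist_eq0 closedSet_distC closedSet_triangle.

Definition translate (s : V) (S : set V) : set V := [set x - s | x in S].

Lemma translateE s S : translate s S = (fun x => x + s) @^-1` S.
Proof.
apply/seteqP; split=> [_ [x Sx <-]|x Sx]; first by rewrite /= subrK.
by exists (x + s) => //; rewrite addrK.
Qed.

Lemma translate_closed s S : closed S -> closed (translate s S).
Proof.
rewrite translateE => cS; apply: closed_comp cS => x _.
have := @cvgD R V V (nbhs x) _ id (cst s) x s.
by move=> /(_ (nbhs_filter x) cvg_id (cvg_cst _)).
Qed.

Definition shift (s : V) G : closedSet R N :=
  ClosedSet (translate_closed (s := s) (@pts_closed G)).
Lemma pts_shift s G : pts (shift s G) = translate s (pts G).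
Proof. by []. Qed.

Lemma shiftD s t G : shift s (shift t G) = shift (s + t) G.
Proof.
apply: closedSet_inj; rewrite !pts_shift !translateE.
by apply/seteqP; split=> x /=; rewrite addrA.
Qed.

(* The Lipschitz constant on the sphere of the translation by s. *)
Definition shift_lip (s : V) : R := 2 * (1 + edot s s).

Lemma shift_lip_ge1 s : 1 <= shift_lip s.
Proof. by have := edot_ge0 s; rewrite /shift_lip; lra. Qed.

Lemma r_shift s x : 1 + edot x x <= shift_lip s * (1 + edot (x - s) (x - s)).
Proof.
have h1 := edot_ge0 (x - 2 *: s); have h2 := edot_ge0 s.
have h3 := mulr_ge0 h2 (edot_ge0 (x - s)).
rewrite /shift_lip; move: h1 h3.
rewrite !(edotDl, edotDr, edotNl, edotNr, edotZl, edotZr) (edotC s x).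
nra.
Qed.

Lemma unstereo_north_shift s x :
  enorm (unstereo (x - s) - north) <= shift_lip s * enorm (unstereo x - north).
Proof.
have K1 := shift_lip_ge1 s; have K0 : 0 <= shift_lip s by lra.
rewrite -(@ler_pXn2r _ 2)// ?nnegrE ?enorm_ge0 ?(mulr_ge0 K0) ?enorm_ge0//.
rewrite exprMn !enorm_sqr !unstereo_north.
have rx := r_gt0 x; have rs := r_gt0 (x - s).
rewrite ler_pdivrMr// mulrA [leRHS]mulrAC ler_pdivlMr//.
have := r_shift s x; move: rx rs; set a := 1 + _; set b := 1 + edot _ _.
set k := shift_lip s in K1 K0 *; move=> a0 b0 h.
have : k * b <= k ^+ 2 * b by rewrite ler_pM2r// expr2 ler_peMl.
lra.
Qed.

Lemma unstereo_shift s x y :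
  enorm (unstereo (x - s) - unstereo (y - s)) <=
  shift_lip s * enorm (unstereo x - unstereo y).
Proof.
have K1 := shift_lip_ge1 s; have K0 : 0 <= shift_lip s by lra.
rewrite -(@ler_pXn2r _ 2)// ?nnegrE ?enorm_ge0 ?(mulr_ge0 K0) ?enorm_ge0//.
rewrite exprMn !enorm_sqr !unstereo_dist.
have -> : x - s - (y - s) = x - y by rewrite opprB addrA subrK.
have [rx rs] := (r_gt0 x, r_gt0 (x - s)).
have [ry rt] := (r_gt0 y, r_gt0 (y - s)).
rewrite ler_pdivrMr ?mulr_gt0// (mulrA (shift_lip s ^+ 2)) [leRHS]mulrAC ler_pdivlMr ?mulr_gt0//.
rewrite [leRHS](_ : _ = 4 * edot (x - y) (x - y) *
  ((shift_lip s * (1 + edot (x - s) (x - s))) *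
   (shift_lip s * (1 + edot (y - s) (y - s))))); last by ring.
rewrite ler_wpM2l ?mulr_ge0 ?edot_ge0//.
by rewrite ler_pM ?r_shift ?(ltW rx) ?(ltW ry).
Qed.

Lemma shift_dist s G H :
  mdist (shift s G) (shift s H) <= shift_lip s * mdist G H.
Proof.
have K1 := shift_lip_ge1 s; have K0 : 0 < shift_lip s by lra.
have main G' H' p : compactify (pts (shift s G')) p ->
    dist_to (compactify (pts (shift s H'))) p <= shift_lip s * mdist G' H'.
  move=> /compactifyE[->|[_ [x Gx <-] ->]].
    rewrite dist_to_id; last by apply/compactifyE; left.
    by rewrite mulr_ge0 ?mdist_ge0 ?(ltW K0).
  apply/ler_addgt0Pl => e e0.
  have [q Hq xq] : exists2 q, compactify (pts H') q &
      enorm (unstereo x - q) < e / shift_lip s + mdist G' H'.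
    by apply: (closedSet_dist_lt Gx); rewrite ltrDr divr_gt0.
  have le_e c : enorm (unstereo x - q) = c ->
      shift_lip s * c <= e + shift_lip s * mdist G' H'.
    move=> <-; move: xq; rewrite -(ltr_pM2l K0) => /ltW/le_trans; apply.
    by rewrite mulrDr mulrCA divff ?lt0r_neq0// mulr1.
  have /compactifyE[qn|[y Hy qy]] := Hq.
    apply: le_trans (dist_to_le _ (q := north) _) _.
      by apply/compactifyE; left.
    by apply: le_trans (unstereo_north_shift _ _) _; apply: le_e; rewrite qn.
  apply: le_trans (dist_to_le _ (q := unstereo (y - s)) _) _.
    by apply/compactifyE; right; exists (y - s) => //; exists y.
  by apply: le_trans (unstereo_shift _ _ _) _; apply: le_e; rewrite qy.
apply: hausdorff_le; try exact: compactify_neq0; first exact: main.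
by move=> q; rewrite -[mdist G H]metric_sym; exact: main.
Qed.

End ClosedSetMetric.

Section Dynamics.
Context {R : realType} {N : nat}.
Local Notation V := 'cV[R]_N.

Definition flow_morphism (X Y : topologicalType) (phi : V -> X -> X)
    (psi : V -> Y -> Y) (f : X -> Y) : Prop :=
  [/\ continuous f, set_surj [set: X] [set: Y] f &
      forall s x, f (phi s x) = psi s (f x)].

(* The Borel space of X is g_sigma_algebraType (@open X). *)
Definition invariant_probability (X : ptopologicalType) (phi : V -> X -> X)
    (mu : probability (g_sigma_algebraType (@open X)) R) : Prop :=
  forall s (B : set (g_sigma_algebraType (@open X))), measurable B ->
    mu (phi s @^-1` B) = mu B.

Definition uniquely_ergodic (X : ptopologicalType) (phi : V -> X -> X) : Prop :=
  exists2 mu : probability (g_sigma_algebraType (@open X)) R,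
    invariant_probability phi mu &
    forall nu : probability (g_sigma_algebraType (@open X)) R,
      invariant_probability phi nu ->
      forall B, measurable B -> nu B = mu B.

Definition cube (t : R) : set V := [set s | forall i, `|s i 0| <= t].

(* Lebesgue measure of cube t = [-t, t]^N, for t >= 0. *)
Definition cube_vol (t : R) : R := (2 * t) ^+ N.

(* The supremum is a maximum for a continuous action and t >= 0. *)
Definition separated (X : metricType R) (phi : V -> X -> X) (eps t : R)
    (Y : set X) : Prop :=
  forall x y, Y x -> Y y -> x <> y ->
    eps <= sup [set mdist (phi s x) (phi s y) | s in cube t].

Definition sep_number (X : metricType R) (phi : V -> X -> X) (eps t : R) :
    \bar R :=
  ereal_sup [set counting Y | Y in separated phi eps t].

Definition topological_entropy (X : metricType R) (phi : V -> X -> X) : \bar R :=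
  ereal_sup [set limf_esup
      (fun t : R => lne (sep_number phi eps t) * (cube_vol t)^-1%:E)%E
      (pinfty_nbhs R) | eps in [set eps : R | 0 < eps]].

Definition upper_density (S : set V) : \bar R :=
  limf_esup (fun t : R => counting (S `&` cube t) * (cube_vol t)^-1%:E)%E
    (pinfty_nbhs R).

Definition uniformly_discrete (L : set V) : Prop :=
  exists2 r : R, 0 < r &
    forall x y, L x -> L y -> x <> y -> r <= enorm (x - y).

End Dynamics.

Section Hull.
Context {R : realType} {N : nat}.
Local Notation V := 'cV[R]_N.
Implicit Types L : set V.

(* A total way of viewing a set as a closed set; it leaves unchanged the
   uniformly discrete sets, which are closed. *)
Definition toClosed L : closedSet R N := ClosedSet (@closed_closure _ L).

Definition hull L : set (closedSet R N) :=
  closure [set shift s (toClosed L) | s in [set: V]].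

Definition hullSpace L : Type := set_type (hull L).

Lemma hull_toClosed L : hull L (toClosed L).
Proof.
apply: subset_closure; exists 0 => //; apply: closedSet_inj.
by rewrite pts_shift translateE; apply/seteqP; split=> x /=; rewrite addr0.
Qed.

Lemma hull_shift L s G : hull L G -> hull L (shift s G).
Proof.
move=> hG B /nbhs_ballP[e /= e0 eB].
have k0 : 0 < shift_lip s by have := shift_lip_ge1 s; lra.
have [|_ [[t _ <-] Gt]] := hG (ball G (e / shift_lip s)).
  by apply: nbhsx_ballx; rewrite divr_gt0.
exists (shift s (shift t (toClosed L))); split.
  by exists (s + t) => //; rewrite shiftD.
apply: eB; rewrite ballEmdist /=; apply: le_lt_trans (shift_dist _ _ _) _.
by move: Gt; rewrite ballEmdist /= ltr_pdivlMr// mulrC.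
Qed.

End Hull.

Section HullSpace.
Context {R : realType} {N : nat} (L : set 'cV[R]_N).
Implicit Types G H K : hullSpace L.

HB.instance Definition _ := Choice.on (hullSpace L).

Definition hull_val G : closedSet R N := set_val G.

Definition hull_mdist G H : R := mdist (hull_val G) (hull_val H).

Lemma hull_mdistxx G : hull_mdist G G = 0. Proof. exact: mdistxx. Qed.

Lemma hull_mdist_eq0 G H : hull_mdist G H = 0 -> G = H.
Proof. by move=> /mdist_positivity; exact: val_inj. Qed.

Lemma hull_mdistC G H : hull_mdist G H = hull_mdist H G.
Proof. exact: metric_sym. Qed.

Lemma hull_mdist_triangle H G K :
  hull_mdist G K <= hull_mdist G H + hull_mdist H K.
Proof. exact: metric_triangle. Qed.

HB.instance Definition _ := isMetric.Build R (hullSpace L)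
  hull_mdistxx hull_mdist_eq0 hull_mdistC hull_mdist_triangle.

Definition hull_base : hullSpace L :=
  exist (fun x => x \in hull L) _ (mem_set (@hull_toClosed R N L)).

HB.instance Definition _ := isPointed.Build (hullSpace L) hull_base.

Definition hull_pts G : set 'cV[R]_N := pts (hull_val G).

Definition hull_act (s : 'cV[R]_N) G : hullSpace L :=
  exist (fun x => x \in hull L) _ (mem_set (hull_shift (s := s) (set_valP G))).

Definition grid (Xi : set (hullSpace L)) : set 'cV[R]_N :=
  \bigcup_(G in Xi) hull_pts G.

Definition embedded_fullshift (Xi : set (hullSpace L)) (S : set 'cV[R]_N) :
    Prop :=
  [/\ closed Xi, (0 < upper_density S)%E, uniformly_discrete (grid Xi) &
      forall S', S' `<=` S -> exists2 G, Xi G & hull_pts G `&` S = S'].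

End HullSpace.

Section CutAndProject.
Context {R : realType} {N : nat} (A : 'M[R]_(N + 1)).
Local Notation V := 'cV[R]_N.

Definition lattice_pt (z : 'cV[int]_(N + 1)) : V * R :=
  let w := A *m map_mx intr z in (usubmx w, dsubmx w 0 0).

Definition lattice : set (V * R) := range lattice_pt.

Definition cut_and_project : Prop :=
  set_inj lattice fst /\ dense [set p.2 | p in lattice].

Definition curlywedge (W : set R) : set V :=
  [set p.1 | p in lattice `&` ([set: V] `*` W)].

Definition normalized : Prop :=
  (forall j : 'I_N, 0 < A (rshift N 0) (lshift 1 j) < 1) /\
  A (rshift N 0) (rshift N 0) = 1.

(* The coordinate v_{N+1} completing v; it is unique when A is normalized. *)
Definition last_coord (v : 'cV[int]_N) : int :=
  xget 0 [set k | 0 <= (lattice_pt (col_mx v k%:M)).2 < 1].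

Definition lift_pt (v : 'cV[int]_N) : V * R :=
  lattice_pt (col_mx v (last_coord v)%:M).

Definition lattice_pred : pred (V * R) := fun p => `[< lattice p >].

Lemma lattice_pred_closed : zmod_closed lattice_pred.
Proof.
split=> [|p q /asboolP[z _ <-] /asboolP[w _ <-]]; apply/asboolP.
  exists 0 => //; rewrite /lattice_pt map_mx0 mulmx0.
  by congr pair; rewrite ?mxE// linear0.
exists (z - w) => //; rewrite /lattice_pt map_mxB mulmxBr.
by congr pair; rewrite ?linearB//= !mxE.
Qed.

HB.instance Definition _ :=
  GRing.isZmodClosed.Build (V * R)%type lattice_pred lattice_pred_closed.

Definition lattice_zmod : zmodClosed (V * R)%type :=
  GRing.ZmodClosed.clone _ lattice_pred _.

Definition torus : Type := quotient_topology (Quotient.quot lattice_zmod).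

HB.instance Definition _ := Quotient.on torus.
HB.instance Definition _ := Topological.on torus.
HB.instance Definition _ := GRing.Zmodule.copy torus (Quotient.quot lattice_zmod).

End CutAndProject.

Section TorusParametrization.
Context {R : realType} {N : nat} (A : 'M[R]_(N + 1)).
Local Open Scope quotient_scope.

Definition torus_class (s : 'cV[R]_N) (h : R) : torus A := \pi_(torus A) (s, h).

Definition torus_act (s : 'cV[R]_N) (xi : torus A) : torus A :=
  xi + torus_class s 0.

Definition torus_parametrization (W : set R)
    (beta : hullSpace (curlywedge A W) -> torus A) : Prop :=
  flow_morphism (@hull_act R N (curlywedge A W)) torus_act beta /\
  beta (hull_base (curlywedge A W)) = 0.

End TorusParametrization.

Section CantorSets.
Context {R : realType}.
Implicit Types C : set R.

Definition cantor_set C : Prop :=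
  [/\ C !=set0, compact C, perfect_set C & totally_disconnected C].

Definition gap C : set (set R) :=
  [set G | (exists2 x, (~` C) x & G = connected_component (~` C) x) /\
           bounded_set G].

Definition union_of_gaps C (B : set R) : Prop :=
  exists2 F : set (set R), F `<=` gap C & B = \bigcup_(G in F) G.

Definition boundary (B : set R) : set R := closure B `\` interior B.

(* For the empty set of indices s with a s = true, \bigcap is all of R. *)
Definition locally_independent (B : nat -> set R) (x : R) : Prop :=
  forall (F : set nat) (a : nat -> bool), finite_set F ->
    closure (interior
      (\bigcap_(s in [set s | F s /\ a s]) B s `\`
       \bigcup_(s in [set s | F s /\ ~~ a s]) B s)) x.

Definition gap_family C (B : nat -> set R) : Prop :=
  [/\ forall k, open (B k) /\ B k `<=` `[0, 1],
      forall k, union_of_gaps C (B k),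
      forall k, boundary (B k) = C &
      locally_independent B 0].

Definition shiftR (x : R) (B : set R) : set R := [set y + x | y in B].

Definition residual (I : nat -> set R) : set R := `[0, 1] `\` \bigcup_k I k.

Definition window (I B : nat -> set R) : set R :=
  residual I `|` \bigcup_k (I k `&` closure (shiftR (inf (I k)) (B k))).

End CantorSets.

Section Construction.
Context {R : realType} {N : nat} (A : 'M[R]_(N + 1)).

Definition sup_norm (v : 'cV[int]_N) : nat := \max_(i < N) absz (v i 0%R).

Definition numbering (v : nat -> 'cV[int]_N) : Prop :=
  bijective v /\ {homo (sup_norm \o v) : m n / (m <= n)%N}.

Definition Iint (v : nat -> 'cV[int]_N) (n : nat -> nat) (eps : nat -> R)
    (k : nat) : set R :=
  let a := (lift_pt A (v (n k))).2 in `]a, a + eps k[.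

Definition admissible (v : nat -> 'cV[int]_N) (n : nat -> nat)
    (eps : nat -> R) : Prop :=
  [/\ {homo n : j k / (j < k)%N} /\ (forall k, 0 < eps k),
      trivIset [set: nat] (Iint v n eps),
      closure (\bigcup_k Iint v n eps k) = `[0, 1]%classic &
      exists2 l : R, (k%:R / (n k)%:R : R) @[k --> \oo] --> l & 2^-1 < l].

End Construction.

(* Main.v *)
(* Write W for the window. For h > 0 in L* - theta the set curlywedge (W - h) is
   a translate of curlywedge (W + theta), and it contains l_{v(n_k)} iff h lies
   in cl A_k (for h < eps_k). Local topological independence of the A_k at 0
   therefore prescribes any finite part of S while h tends to 0, and compactness
   of the hull yields, for each S' in S, a point Gamma of the fibre with
   Gamma cap S = S' and Gamma contained in curlywedge (W cap [0, 1)).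
   Distinct subsets of S cap F_t give separated points, whence the entropy bound.

   For (b), up to bounded error the points l_v are the image of Z^N under the
   linear map M (the Schur complement of a_{N+1,N+1} in A), and S occupies more
   than half of them. Averaging over the boxes M [-2^q, 2^q]^N along the orbits of
   a Gamma containing S and of a Gamma avoiding S gives two invariant measures
   whose intensities are respectively above and below |det M|^-1 / 2. *)

From HB Require Import structures.
Require Import Defs.
From mathcomp Require Import all_boot all_order all_algebra generic_quotient.
From mathcomp Require Import all_classical all_reals all_analysis.
From mathcomp Require Import ring lra zify.
Set Implicit Arguments.
Unset Strict Implicit.
Unset Printing Implicit Defensive.
Import Order.TTheory GRing.Theory Num.Theory.
Import numFieldNormedType.Exports.
Local Open Scope classical_set_scope.
Local Open Scope ring_scope.

(** * Compactness of the space of closed sets *)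

(** The fibre of [beta] is reached through continuity and equivariance: it consists of the limits of
    the translates by lattice points whose height tends to [theta]. Approaching [theta] from above
    matters twice: a small [h > 0] carries the left endpoint of [I_k] into [I_k], where the window
    is a copy of the closure of [A_k], and it keeps the height 1 out of the limit, so that every
    point of the limit is some [l_v]. The averages in (b) count points of a finite grid, hence make
    sense for every subset of the hull, measurable or not. The price is that their limit along an
    ultrafilter is only finitely additive and is invariant only under the dense set of grid vectors.
    Regularization repairs both defects and leaves one-sided bounds, from below on closed sets and
    from above on open ones. They suffice since the gap between a density [d > 1/2] and the
    complementary [1 - d] is strict: it pays for the rounding in the counts and for squeezing a
    closed set of patterns meeting a small box into an open set of patterns meeting a slightly
    larger one. *)

Section EuclideanTopology.
Context {R : realType} {m : nat}.
Local Notation V := 'cV[R]_m.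

Lemma enorm_le_coord (x : V) c : (forall i, `|x i 0| <= c) -> enorm x <= m%:R * c.
Proof.
move=> xc; case: (posnP m) => [m0|m0].
  rewrite /enorm /edot big1 ?sqrtr0 ?m0 ?mul0r// => i.
  by have := ltn_ord i; rewrite {2}m0.
have c0 : 0 <= c by apply: le_trans (xc (Ordinal m0)).
rewrite -(@ler_pXn2r _ 2)// ?nnegrE ?enorm_ge0 ?mulr_ge0// enorm_sqr.
apply: (@le_trans _ _ (\sum_(i < m) c ^+ 2)).
  by apply: ler_sum => i _; rewrite -expr2 -real_normK ?num_real// lerXn2r ?nnegrE.
rewrite sumr_const card_ord -[leLHS]mulr_natl exprMn ler_wpM2r ?sqr_ge0//.
by rewrite -natrX ler_nat expnS expn1 leq_pmulr.
Qed.

Lemma enorm_eq0 (x : V) : enorm x = 0 -> x = 0.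
Proof. by move=> x0; apply: edot_eq0; rewrite -enorm_sqr x0 expr0n. Qed.

Lemma nbhs_enorm (x : V) e : 0 < e -> nbhs x [set y | enorm (x - y) < e].
Proof.
move=> e0; have d0 : 0 < e / m.+1%:R by rewrite divr_gt0.
apply: filterS (nbhsx_ballx x _ d0) => y [_ xy] /=.
apply: (@le_lt_trans _ _ (m%:R * (e / m.+1%:R))).
  by apply: enorm_le_coord => i; rewrite !mxE; apply: ltW; exact: xy.
by rewrite mulrCA gtr_pMr// ltr_pdivrMr// mul1r ltr_nat.
Qed.

Lemma nbhs_enormP (x : V) (P : set V) :
  nbhs x P <-> exists2 e, 0 < e & forall y, enorm (x - y) < e -> P y.
Proof.
split=> [/nbhs_ballP[e /= e0 eP]|[e e0 eP]]; last by apply: filterS (nbhs_enorm x e0) => y /eP.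
exists e => // y xy; apply: eP; split => // i j; rewrite ord1 /ball /=.
by have := enorm_coord (x - y) i; rewrite !mxE => /le_lt_trans; apply.
Qed.

Lemma box_compact c : compact [set x : V | forall i, `|x i 0| <= c].
Proof.
have trC : continuous (fun u : 'rV[R]_m => u^T).
  move=> u P /nbhs_ballP[e /= e0 eP]; apply: filterS (nbhsx_ballx u _ e0).
  move=> w [_ uw]; apply: eP; split => // i j.
  by rewrite !mxE; exact: uw.
rewrite (_ : mkset _ = (fun u : 'rV[R]_m => u^T) @`
    [set u : 'rV[R]_m | forall i, `[- c, c]%classic (u 0 i)]).
  apply: continuous_compact; first exact: continuous_subspaceT.
  exact: (@rV_compact R m (fun=> `[- c, c]%classic) (fun=> @segment_compact R _ _)).
apply/seteqP; split=> [x xc|_ [u uc <-] i]; last first.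
  by have := uc i; rewrite /= in_itv /= mxE ler_norml.
exists x^T; last by rewrite trmxK.
by move=> i; rewrite /= in_itv /= mxE -ler_norml.
Qed.

End EuclideanTopology.

(** * Chordal distances and compactness *)

Section StereographicDistance.
Context {R : realType} {N : nat}.
Local Notation V := 'cV[R]_N.
Implicit Types (x y : V) (G H : closedSet R N).

(** The Japanese bracket. It turns chordal distances on the sphere into the formulas
    [2 |x - y| / (<x> <y>)] between finite points and [2 / <x>] to the point at infinity. *)
Definition bracket x : R := Num.sqrt (1 + edot x x).

Lemma bracket_ge1 x : 1 <= bracket x.
Proof. by rewrite -[leLHS]sqrtr1 ler_wsqrtr// lerDl edot_ge0. Qed.

Lemma bracket_gt0 x : 0 < bracket x.
Proof. exact: lt_le_trans ltr01 (bracket_ge1 x). Qed.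

Lemma bracket_sqr x : bracket x ^+ 2 = 1 + edot x x.
Proof. by rewrite sqr_sqrtr// ltW// r_gt0. Qed.

Lemma enorm_unstereoB x y :
  enorm (unstereo x - unstereo y) = 2 * enorm (x - y) / (bracket x * bracket y).
Proof.
have [x0 y0] := (bracket_gt0 x, bracket_gt0 y).
apply/eqP; rewrite -(@eqrXn2 _ 2)// ?enorm_ge0//; last first.
  by rewrite divr_ge0 ?mulr_ge0 ?enorm_ge0 ?ltW.
rewrite enorm_sqr unstereo_dist -!bracket_sqr -enorm_sqr; apply/eqP.
by field; rewrite !lt0r_neq0.
Qed.

Lemma enorm_unstereo_north x : enorm (unstereo x - north) = 2 / bracket x.
Proof.
have x0 := bracket_gt0 x.
apply/eqP; rewrite -(@eqrXn2 _ 2)// ?enorm_ge0//; last by rewrite divr_ge0// ltW.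
rewrite enorm_sqr unstereo_north -!bracket_sqr; apply/eqP.
by field; rewrite lt0r_neq0.
Qed.

Lemma unstereo_lipschitz x y :
  enorm (unstereo x - unstereo y) <= 2 * enorm (x - y).
Proof.
rewrite enorm_unstereoB ler_pdivrMr ?mulr_gt0 ?bracket_gt0//.
rewrite ler_peMr ?mulr_ge0 ?enorm_ge0//.
by rewrite -[leLHS]mulr1 ler_pM ?bracket_ge1.
Qed.

(** Closeness in the hull metric is read off here as closeness of points, with one threshold for all
    sets and all points of the ball of radius [T]. *)
Lemma closedSet_dist_near_pt (T e : R) : 0 <= T -> 0 < e ->
  exists2 c, 0 < c & forall G H x, enorm x <= T -> pts G x -> mdist G H < c ->
    exists2 y, pts H y & enorm (x - y) < e.
Proof.
move=> T0 e0; set a := Num.sqrt (1 + T ^+ 2).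
have a0 : 0 < a by rewrite sqrtr_gt0 ltr_pwDl// sqr_ge0.
(* A chord below [a^-1] keeps the partner of [x] off the north pole and forces
   [bracket y <= 2 * bracket x]; after that a chord below [e / a ^+ 2] means [enorm (x - y) < e]. *)
exists (Num.min a^-1 (e / a ^+ 2)); first by rewrite lt_min invr_gt0 a0 divr_gt0// exprn_gt0.
move=> G H x xT Gx /(closedSet_dist_lt Gx)[q Hq]; rewrite lt_min => /andP[xq1 xq2].
have xa : bracket x <= a.
  by rewrite ler_wsqrtr// lerD2l -enorm_sqr lerXn2r ?nnegrE ?enorm_ge0.
have x0 := bracket_gt0 x.
have ax : a^-1 <= (bracket x)^-1 by rewrite lef_pV2.
have x1 : 0 < (bracket x)^-1 by rewrite invr_gt0.
have /compactifyE[qn|[y Hy qy]] := Hq.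
  by move: xq1; rewrite qn enorm_unstereo_north; lra.
exists y => //; rewrite {}qy {Hq} in xq1 xq2.
have y0 := bracket_gt0 y.
have yx : bracket y <= 2 * bracket x.
  have := enormD (unstereo x - unstereo y) (unstereo y - north).
  rewrite addrA subrK !enorm_unstereo_north => h.
  have : (2 * bracket x)^-1 <= (bracket y)^-1 by rewrite invfM; lra.
  by rewrite lef_pV2 ?posrE ?mulr_gt0.
move: xq2; rewrite enorm_unstereoB ltr_pdivlMr ?exprn_gt0// mulrAC.
rewrite ltr_pdivrMr ?mulr_gt0// => h.
have h2 : e * (bracket x * bracket y) <= e * (a * (2 * a)).
  rewrite ler_pM2l// ler_pM ?(ltW x0) ?(ltW y0)//.
  by apply: le_trans yx _; rewrite ler_pM2l.
have a2 : 0 < a ^+ 2 by rewrite exprn_gt0.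
rewrite -(ltr_pM2l a2); have -> : a ^+ 2 * e = e * (a * (2 * a)) / 2 by field.
lra.
Qed.

(** Only points in the ball of radius [T] need partners: the others are within chordal distance
    [2 / T <= c] of the point at infinity, which lies in both compactifications. *)
Lemma closedSet_dist_le (T d c : R) G H : 0 < c -> 2 / c <= T -> 2 * d <= c ->
  (forall x, pts G x -> enorm x <= T -> exists2 y, pts H y & enorm (x - y) <= d) ->
  (forall x, pts H x -> enorm x <= T -> exists2 y, pts G y & enorm (x - y) <= d) ->
  mdist G H <= c.
Proof.
move=> c0 Tc dc.
have main G' H' : (forall x, pts G' x -> enorm x <= T ->
    exists2 y, pts H' y & enorm (x - y) <= d) ->
    forall p, compactify (pts G') p -> dist_to (compactify (pts H')) p <= c.
  move=> GH p /compactifyE[->|[x Gx ->]].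
    by rewrite dist_to_id ?ltW//; apply/compactifyE; left.
  have [xT|xT] := leP (enorm x) T.
    have [y Hy xy] := GH x Gx xT.
    apply: le_trans (dist_to_le _ (q := unstereo y) _) _.
      by apply/compactifyE; right; exists y.
    by apply: le_trans (unstereo_lipschitz _ _) _; lra.
  apply: le_trans (dist_to_le _ (q := north) _) _.
    by apply/compactifyE; left.
  rewrite enorm_unstereo_north ler_pdivrMr ?bracket_gt0// mulrC -ler_pdivrMr//.
  apply: le_trans Tc _; apply: le_trans (ltW xT) _.
  by rewrite ler_wsqrtr// lerDr.
by move=> GH HG; apply: hausdorff_le; try exact: compactify_neq0; exact: main.
Qed.

Lemma shift_dist_le (s t : V) G : mdist (Defs.shift s G) (Defs.shift t G) <= 2 * enorm (s - t).
Proof.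
have main s' t' p : compactify (pts (Defs.shift s' G)) p ->
    dist_to (compactify (pts (Defs.shift t' G))) p <= 2 * enorm (s' - t').
  move=> /compactifyE[->|[_ [x Gx <-] ->]].
    by rewrite dist_to_id ?mulr_ge0 ?enorm_ge0//; apply/compactifyE; left.
  apply: le_trans (dist_to_le _ (q := unstereo (x - t')) _) _.
    by apply/compactifyE; right; exists (x - t') => //; exists x.
  apply: le_trans (unstereo_lipschitz _ _) _.
  by rewrite opprB addrC addrA subrK enormB.
apply: hausdorff_le; try exact: compactify_neq0; first exact: main.
by move=> p; rewrite enormB; exact: main.
Qed.

(** Along an ultrafilter the lower limit [L] of the sets is also their upper limit, and it is the
    limit in the metric. The estimates hold locally around each point; compactness of a box makes
    them uniform there, and points outside the box are close to infinity. *)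
Lemma closedSet_compact : compact [set: closedSet R N].
Proof.
rewrite compact_ultra => F FU _.
have FF : ProperFilter F by exact: ultra_proper.
pose L : set V := [set x | forall e, 0 < e ->
  F [set G | exists2 y, pts G y & enorm (x - y) < e]].
have cL : closed L.
  move=> x Lx e e0; have e2 : 0 < e / 2 by rewrite divr_gt0.
  have [y [Ly xy]] := Lx _ (nbhs_enorm x e2).
  apply: filterS (Ly _ e2) => G [z Gz yz]; exists z => //.
  rewrite -(subrK y x) -addrA; apply: le_lt_trans (enormD _ _) _.
  by rewrite [e]splitr ltrD.
exists (ClosedSet cL); split => // B /nbhs_ballP[e /= e0 eB].
suff : F [set G | mdist (ClosedSet cL) G <= e / 2].
  apply: filterS => G hG; apply: eB; rewrite ballEmdist /=.
  by apply: le_lt_trans hG _; rewrite gtr_pMr ?invf_lt1 ?ltr1n.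
have e2 : 0 < e / 2 by rewrite divr_gt0.
have e4 : 0 < e / 2 / 2 by rewrite divr_gt0.
have e8 : 0 < e / 2 / 2 / 2 by rewrite divr_gt0.
set d := e / 2 / 2.
have boxP T : near_covering [set x : V | forall i, `|x i 0| <= T].
  by apply/compact_near_coveringP; exact: box_compact.
have boxT T x : enorm x <= T -> forall i, `|x i 0| <= T.
  by move=> xT i; apply: le_trans (enorm_coord _ _) xT.
have near1 := boxP (2 / (e / 2)) _ F
  (fun G x => L x -> exists2 y, pts G y & enorm (x - y) <= d) _.
have near2 := boxP (2 / (e / 2)) _ F
  (fun G x => pts G x -> exists2 y, L y & enorm (x - y) <= d) _.
have h1 : \forall G \near F, [set x : V | forall i, `|x i 0| <= 2 / (e / 2)] `<=`
    (fun x => L x -> exists2 y, pts G y & enorm (x - y) <= d).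
  apply: near1 => x _.
  have [Lx|nLx] := pselect (L x); last first.
    have : nbhs x (~` L) by apply: open_nbhs_nbhs; split => //; exact: closed_openC.
    by move=> nx; exists (~` L, setT) => /=; [split => //; exact: filterT|move=> [y G] []].
  exists ([set y | enorm (x - y) < d / 2],
    [set G | exists2 y, pts G y & enorm (x - y) < d / 2]) => /=.
    by split; [exact: nbhs_enorm|exact: Lx].
  move=> [y G] [/= xy [z Gz xz]] _; exists z => //.
  rewrite -(subrK x y) -addrA [d]splitr; apply: le_trans (enormD _ _) _.
  by rewrite enormB ltW// ltrD.
have h2 : \forall G \near F, [set x : V | forall i, `|x i 0| <= 2 / (e / 2)] `<=`
    (fun x => pts G x -> exists2 y, L y & enorm (x - y) <= d).
  apply: near2 => x _.
  have [Lx|nLx] := pselect (L x).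
    exists ([set y | enorm (x - y) < d], setT) => /=.
      by split; [exact: nbhs_enorm|exact: filterT].
    by move=> [y G] [/= xy _] _; exists x => //; rewrite enormB ltW.
  have /existsNP[c /not_implyP[c0 nF]] := nLx.
  (* The ultrafilter property enters here: since [x] is outside [L], almost every set misses some
     ball around [x]. *)
  have [//|nF'] := in_ultra_setVsetC [set G | exists2 y, pts G y & enorm (x - y) < c] FU.
  exists ([set y | enorm (x - y) < c],
    ~` [set G | exists2 y, pts G y & enorm (x - y) < c]) => /=.
    by split => //; exact: nbhs_enorm.
  by move=> [y G] [/= xy] /[swap] Gy []; exists y.
near=> G; apply: (@closedSet_dist_le (2 / (e / 2)) d) => //.
- by rewrite /d; lra.
- move=> x Lx xT; have : [set x : V | forall i, `|x i 0| <= 2 / (e / 2)] x by exact: boxT.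
  by move/(near h1 G); apply.
- move=> x Lx xT; have : [set x : V | forall i, `|x i 0| <= 2 / (e / 2)] x by exact: boxT.
  by move/(near h2 G); apply.
Unshelve. all: by end_near.
Qed.

End StereographicDistance.

(** * Regularization of finitely additive probabilities *)

Section Regularization.
Context {R : realType} {X : pseudoPMetricType R}.
Context (m : set X -> R).
Context (m_ge0 : forall E, 0 <= m E) (mT : m setT = 1).
Context (mU : forall E F, E `&` F = set0 -> m (E `|` F) = m E + m F).
Context (X_compact : compact [set: X]).

Let m0 : m set0 = 0.
Proof. by have := mU (set0I set0); rewrite set0U => /eqP; rewrite addrC -subr_eq subrr => /eqP. Qed.

Let m_mono E F : E `<=` F -> m E <= m F.
Proof.
move=> EF; rewrite -(setDUK EF) mU ?lerDl//.
by rewrite setIDA setIC -setIDA setDv setI0.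
Qed.

Let m_sub E F : m (E `|` F) <= m E + m F.
Proof.
rewrite (_ : E `|` F = E `|` (F `\` E)); last first.
  apply/seteqP; split=> [x [Ex|Fx]|x [Ex|[Fx _]]]; [by left| |by left|by right].
  by have [Ex|Ex] := pselect (E x); [left|right].
rewrite mU ?lerD2l ?m_mono//.
by rewrite setIDA setIC -setIDA setDv setI0.
Qed.

(** Meant for open [U]. Replacing [m U] by the supremum over closed, hence compact, subsets turns
    finite additivity into countable subadditivity. *)
Definition inner_content (U : set X) : \bar R :=
  ereal_sup [set (m K)%:E | K in [set K | closed K /\ K `<=` U]].

Definition outer_content (E : set X) : \bar R :=
  ereal_inf [set inner_content U | U in [set U | open U /\ E `<=` U]].

Lemma inner_content_ge K U : closed K -> K `<=` U -> ((m K)%:E <= inner_content U)%E.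
Proof. by move=> cK KU; apply: ereal_sup_ubound; exists K. Qed.

Lemma inner_content_le U : (inner_content U <= (m U)%:E)%E.
Proof. by apply: ge_ereal_sup => _ [K [_ KU] <-]; rewrite lee_fin m_mono. Qed.

Lemma inner_content_mono U V : U `<=` V -> (inner_content U <= inner_content V)%E.
Proof.
move=> UV; apply: ge_ereal_sup => _ [K [cK KU] <-].
by apply: inner_content_ge => //; exact: subset_trans UV.
Qed.

Lemma inner_content_ge0 U : (0 <= inner_content U)%E.
Proof. by have := inner_content_ge closed0 (@sub0set _ U); rewrite m0. Qed.

Lemma inner_content_fin U : inner_content U \is a fin_num.
Proof.
rewrite ge0_fin_numE ?inner_content_ge0//.
exact: le_lt_trans (inner_content_le U) (ltry _).
Qed.

Lemma inner_content_adherent U (e : R) : 0 < e ->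
  exists K, [/\ closed K, K `<=` U & (inner_content U <= (m K + e)%:E)%E].
Proof.
move=> e0; have [_ [K [cK KU] <-]] := ub_ereal_sup_adherent e0 (inner_content_fin U).
move=> h; exists K; split => //; rewrite EFinD -leeBlDr//; exact: ltW.
Qed.

Lemma outer_content_open U : open U -> outer_content U = inner_content U.
Proof.
move=> oU; apply/eqP; rewrite eq_le; apply/andP; split.
  by apply: ge_ereal_inf; exists (inner_content U) => //; exists U => //; split.
by apply: le_ereal_inf_tmp => _ [V [_ UV] <-]; exact: inner_content_mono.
Qed.

Lemma outer_content_ge0 E : (0 <= outer_content E)%E.
Proof. by apply: le_ereal_inf_tmp => _ [V _ <-]; exact: inner_content_ge0. Qed.

Lemma outer_content_mono E F : E `<=` F -> (outer_content E <= outer_content F)%E.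
Proof.
move=> EF; apply: le_ereal_inf_tmp => _ [V [oV FV] <-].
apply: ge_ereal_inf; exists (inner_content V) => //.
by exists V => //; split => //; exact: subset_trans FV.
Qed.

Lemma outer_content_fin E : outer_content E \is a fin_num.
Proof.
rewrite ge0_fin_numE ?outer_content_ge0//.
apply: le_lt_trans (outer_content_mono (@subsetT _ E)) _.
by rewrite outer_content_open ?(le_lt_trans (inner_content_le _)) ?ltry//; exact: openT.
Qed.

Lemma outer_content_adherent E (e : R) : 0 < e ->
  exists U, [/\ open U, E `<=` U & (inner_content U <= outer_content E + e%:E)%E].
Proof.
move=> e0; have [_ [U [oU EU] <-]] := lb_ereal_inf_adherent e0 (outer_content_fin E).
by move=> /ltW h; exists U.
Qed.

Lemma outer_content0 : outer_content set0 = 0%E.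
Proof.
rewrite outer_content_open; last exact: open0.
apply/eqP.
by rewrite eq_le inner_content_ge0 andbT (le_trans (inner_content_le _))// m0.
Qed.

(** Closed subsets that exhaust an open [U] as [d] decreases to 0. *)
Let core (d : R) (U : set X) : set X := closure [set x | ball x d `<=` U].

Let core_sub d U : 0 < d -> core d U `<=` U.
Proof.
move=> d0 y hy; have [x [/= hx yx]] := hy _ (nbhsx_ballx y d d0).
exact: hx (ball_sym yx).
Qed.

Let core_cover (U : nat -> set X) K : (forall i, open (U i)) -> closed K ->
  K `<=` \bigcup_i U i -> exists n : nat,
  K `<=` \big[setU/set0]_(i < n) core (n.+1%:R^-1) (U i).
Proof.
move=> oU cK KU.
have /compact_near_coveringP cpK : compact K.
  by apply: (subclosed_compact cK X_compact).
(* A single index serves both as the number of sets in the finite cover and as the fineness of their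
   cores. *)
have := cpK nat \oo (fun n x => exists2 i, (i < n)%N & core (n.+1%:R^-1) (U i) x).
case=> [x Kx|n _ hn].
  have [i _ Uix] := KU x Kx.
  have /nbhs_ballP[e /= e0 eU] : nbhs x (U i) by exact: open_nbhs_nbhs.
  have e2 : 0 < e / 2 by rewrite divr_gt0.
  have [k _ hk] := near_infty_natSinv_lt (PosNum e2).
  exists (ball x (e / 2), [set j | (maxn k i < j)%N]) => /=.
    split; first exact: nbhsx_ballx.
    by exists (maxn k i).+1.
  move=> [y j] [/= xy kj]; exists i; first by apply: leq_ltn_trans kj; rewrite leq_maxr.
  apply: subset_closure => z /= yz; apply: eU.
  rewrite [e]splitr; apply: ball_triangle xy _.
  apply: le_ball yz; apply/ltW/hk.
  by apply: ltnW; apply: leq_ltn_trans kj; rewrite leq_maxl.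
exists n => x Kx; have [i ni hi] := hn n (leqnn n) x Kx.
by rewrite -(bigcup_mkord n (fun i => core _ (U i))); exists i.
Qed.

(** A closed subset of the union is compact, so it splits into finitely many closed pieces, each
    inside a core of one [U i]; finite subadditivity of [m] does the rest. *)
Lemma inner_content_bigcup (U : nat -> set X) : (forall i, open (U i)) ->
  (inner_content (\bigcup_i U i) <= \sum_(i <oo) inner_content (U i))%E.
Proof.
move=> oU; apply: ge_ereal_sup => _ [K [cK KU] <-].
have [n Kn] := core_cover oU cK KU.
apply: le_trans (nneseries_lim_ge (m := 0%N) n _); last first.
  by move=> *; exact: inner_content_ge0.
apply: (@le_trans _ _ (\sum_(i < n) m (K `&` core n.+1%:R^-1 (U i)))%:E).
  rewrite lee_fin.
  rewrite {1}(_ : K = \big[setU/set0]_(i < n) (K `&` core n.+1%:R^-1 (U i))).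
    elim/big_ind2: _ => [|E a F b hE hF|//]; first by rewrite m0.
    by apply: le_trans (m_sub _ _) _; rewrite lerD.
  by rewrite -big_distrr/=; apply/esym/setIidPl.
rewrite big_mkord -sumEFin; apply: lee_sum => i _.
apply: inner_content_ge; first by apply: closedI => //; exact: closed_closure.
by move=> x [_]; apply: core_sub; rewrite invr_gt0.
Qed.

Lemma outer_content_sigma_subadditive : sigma_subadditive outer_content.
Proof.
move=> F; apply/lee_addgt0Pr => e e0.
apply: le_trans (epsilon_trick _ _ (ltW e0)); last first.
  by move=> n; exact: outer_content_ge0.
have e2 n : 0 < e / (2 ^ n.+1)%:R by rewrite divr_gt0// ltr0n expn_gt0.
have /choice[U hU] n := outer_content_adherent (F n) (e2 n).
apply: (@le_trans _ _ (inner_content (\bigcup_n U n))).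
  apply: ereal_inf_lbound; exists (\bigcup_n U n) => //; split.
    by apply: bigcup_open => n _; have [] := hU n.
  by move=> x [n _ Fx]; exists n => //; have [_ FU _] := hU n; exact: FU.
apply: le_trans (inner_content_bigcup _) _; first by move=> n; have [] := hU n.
apply: lee_nneseries => [n _ _|n _]; first exact: inner_content_ge0.
by have [] := hU n.
Qed.

HB.instance Definition _ := isOuterMeasure.Build R X outer_content
  outer_content0 outer_content_ge0 outer_content_mono outer_content_sigma_subadditive.

Let nu : {outer_measure set X -> \bar R} := outer_content.

(** The two nearly optimal closed sets are chosen one after the other: [K] in [V] cut by [U], then
    [L] in the open set [V] minus [K], which contains [V] minus [U]. They are disjoint and both lie
    in [V], so [m] adds on them. *)
Lemma open_caratheodory U : open U -> nu.-caratheodory U.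
Proof.
move=> oU; apply: le_caratheodory_measurable => E.
apply: le_ereal_inf_tmp => _ [V [oV EV] <-].
have oUV : open (V `&` U) by exact: openI.
apply/lee_addgt0Pr => e e0; have e2 : 0 < e / 2 by rewrite divr_gt0.
have [K [cK KU hK]] := inner_content_adherent (V `&` U) e2.
have oVK : open (V `\` K) by apply: openI => //; exact: closed_openC.
have [L [cL LV hL]] := inner_content_adherent (V `\` K) e2.
have KL : K `&` L = set0.
  by apply/seteqP; split=> // x [Kx /LV[]].
apply: (@le_trans _ _ ((m K + e / 2)%:E + (m L + e / 2)%:E)%E).
  apply: leeD.
    apply: le_trans hK; rewrite -outer_content_open//.
    by apply: outer_content_mono => x [/EV].
  apply: le_trans hL; rewrite -outer_content_open//.
  by apply: outer_content_mono => x [/EV Vx Ux]; split=> // /KU[].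
rewrite -EFinD addrACA -splitr EFinD leeD2r// -mU//.
apply: inner_content_ge; first exact: closedU.
by move=> x [/KU[]|/LV[]].
Qed.

Definition borel_content : set (g_sigma_algebraType (@open X)) -> \bar R := outer_content.

Let borel_caratheodory (E : set (g_sigma_algebraType (@open X))) : measurable E ->
  nu.-cara.-measurable (E : set (caratheodory_type nu)).
Proof.
(* A Borel set lies in every sigma-algebra containing the open sets; this is instantiated with the
   Caratheodory one. *)
apply; split; first split.
- exact: caratheodory_measurable_set0.
- by move=> A mA; rewrite setTD; exact: caratheodory_measurable_setC.
- by move=> A mA; exact: caratheodory_measurable_bigcup.
- exact: open_caratheodory.
Qed.

Let borel_content0 : borel_content set0 = 0%E. Proof. exact: outer_content0. Qed.

Let borel_content_ge0 E : (0 <= borel_content E)%E. Proof. exact: outer_content_ge0. Qed.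

Let borel_content_semi_sigma_additive : semi_sigma_additive borel_content.
Proof.
move=> F mF tF mUF.
apply: (@caratheodory_measure_sigma_additive _ _ nu) => // [i|];
  exact: borel_caratheodory.
Qed.

HB.instance Definition _ := isMeasure.Build _ _ _ borel_content
  borel_content0 borel_content_ge0 borel_content_semi_sigma_additive.

Let borel_contentT : borel_content setT = 1%E.
Proof.
rewrite /borel_content outer_content_open; last exact: openT.
apply/eqP; rewrite eq_le.
by rewrite -[1%E]/(1%:E) -mT inner_content_le inner_content_ge//; exact: closedT.
Qed.

HB.instance Definition _ := Measure_isProbability.Build _ _ _ borel_content borel_contentT.

(* This replaces the Riesz representation theorem: a finitely additive limit of
   empirical measures exists along any ultrafilter, and its regularization is
   smaller on open sets and larger on closed sets. *)
Lemma regularization :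
  exists mu : probability (g_sigma_algebraType (@open X)) R,
    forall E, mu E = outer_content E.
Proof. by exists borel_content. Qed.

End Regularization.

(** * Invariant measures from orbits *)

Section HullTopology.
Context {R : realType} {N : nat} (L : set 'cV[R]_N).
Local Notation V := 'cV[R]_N.
Local Notation X := (hullSpace L).

Lemma hull_compact : compact [set: X].
Proof.
have cl : closed (hull L) by exact: closed_closure.
have cK : compact (hull L).
  by apply: (subclosed_compact cl (@closedSet_compact R N)).
move=> F FF _; have FF' : ProperFilter (@hull_val R N L @ F) by exact: fmap_proper_filter.
have hF : (@hull_val R N L @ F) (hull L).
  by apply: (@filterS _ F _ setT) => [H _|]; [exact: (set_valP H)|exact: filterT].
have [G [hG clG]] := cK _ FF' hF.
exists (exist (fun x => x \in hull L) G (mem_set hG)); split => //.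
move=> A B FA /nbhs_ballP[e /= e0 eB].
have [||H [[G' AG' GH] He]] := clG (@hull_val R N L @` A) (ball G e).
- by apply: (@filterS _ F _ A) => // x Ax; exists x.
- exact: nbhsx_ballx.
exists G'; split => //; apply: eB; move: He; rewrite -GH.
by rewrite !ballEmdist.
Qed.

Lemma hull_act_dist s t (G : X) :
  mdist (hull_act s G) (hull_act t G) <= 2 * enorm (s - t).
Proof. exact: shift_dist_le. Qed.

Lemma hull_act_continuous s : continuous (@hull_act R N L s).
Proof.
move=> G B /nbhs_ballP[e /= e0 eB].
have k0 : 0 < shift_lip s by have := shift_lip_ge1 s; lra.
have d0 : 0 < e / shift_lip s by rewrite divr_gt0.
apply: filterS (nbhsx_ballx G _ d0) => H; rewrite ballEmdist /= => GH.
apply: eB; rewrite ballEmdist /=; apply: le_lt_trans (shift_dist _ _ _) _.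
by rewrite mulrC -ltr_pdivlMr.
Qed.

Lemma hull_actD s t (G : X) : hull_act s (hull_act t G) = hull_act (s + t) G.
Proof. by apply: val_inj; exact: shiftD. Qed.

Lemma hull_act0 (G : X) : hull_act 0 G = G.
Proof.
apply: val_inj; apply: closedSet_inj; rewrite pts_shift translateE.
by apply/seteqP; split=> x /=; rewrite addr0.
Qed.

End HullTopology.

Section UltraLimit.
Context {R : realType} (U : set_system nat) {FU : UltraFilter U}.

Let PU : ProperFilter U. Proof. exact: ultra_proper. Qed.

Definition ulim (u : nat -> R) : R := lim (u @ U).

Lemma ulim_cvg (u : nat -> R) : (forall n, 0 <= u n <= 1) -> u @ U --> ulim u.
Proof.
move=> u01; have FF : ProperFilter (u @ U) by exact: fmap_proper_filter.
have uI : (u @ U) `[0, 1]%classic.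
  by apply: nearW => n; rewrite /= in_itv /= u01.
have [p [_ clp]] := @segment_compact R 0 1 _ FF uI.
suff : u @ U --> p by move=> up; rewrite /ulim (cvg_lim _ up).
move=> B Bp; have [//|nB] := in_ultra_setVsetC (u @^-1` B) FU.
by have [x []] := clp (~` B) B nB Bp.
Qed.

End UltraLimit.

(** * Averages over finite Folner sets *)

Section OrbitMeasure.
Context {R : realType} {N : nat} (L : set 'cV[R]_N).
Local Notation V := 'cV[R]_N.
Local Notation X := (hullSpace L).
Context (T : nat -> finType) (t : forall q, T q -> V) (D : set V).
Context (T_gt0 : forall q, (0 < #|T q|)%N) (t_inj : forall q, injective (@t q)).
Context (D_dense : forall s e, 0 < e -> exists2 d, D d & enorm (s - d) < e).
Context (T_folner : forall d, D d ->
  #|[pred z : T q | ~~ [exists z' : T q, t z' == t z + d]]|%:R / #|T q|%:R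
    @[q --> \oo] --> (0 : R)).

(** Counting over a finite index set replaces integration along the orbit, so [E] may be an
    arbitrary set. *)
Definition frequency (G : X) (q : nat) (E : set X) : R :=
  #|[pred z : T q | `[< E (hull_act (t z) G) >]]|%:R / #|T q|%:R.

Context (G : X).

Let card_gt0 q : 0 < (#|T q|%:R : R).
Proof. by rewrite ltr0n. Qed.

Let frequency_itv E q : 0 <= frequency G q E <= 1.
Proof.
by rewrite divr_ge0//= ler_pdivrMr// mul1r ler_nat max_card.
Qed.

Lemma frequency_mono q (E F : set X) : E `<=` F -> frequency G q E <= frequency G q F.
Proof.
move=> EF; rewrite /frequency ler_pM2r ?invr_gt0// ler_nat.
apply: subset_leq_card; apply/fintype.subsetP => z; rewrite !inE => /asboolP/asboolP Ez.
by apply/asboolP/asboolP; exact: EF.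
Qed.

(** The Krylov-Bogoliubov construction. The limit [m] of the frequencies along an ultrafilter is
    finitely additive; its regularization is a Borel probability lying above [m] on closed sets and
    below [m] on open sets, which is why the bounds come in these two forms. *)
Theorem orbit_measure :
  exists mu : probability (g_sigma_algebraType (@open X)) R,
  [/\ invariant_probability (@hull_act R N L) mu,
      forall K c, closed K -> (\forall q \near \oo, c <= frequency G q K) ->
        (c%:E <= mu K)%E &
      forall W c, open W -> (\forall q \near \oo, frequency G q W <= c) ->
        (mu W <= c%:E)%E].
Proof.
have [U [FU ooU]] := ultraFilterLemma (@eventually_filter).
have PU : ProperFilter U by exact: ultra_proper.
pose m E := ulim U (frequency G ^~ E).
have mE E : frequency G ^~ E @ U --> m E by exact: ulim_cvg.
have m_ge c E : (\forall q \near \oo, c <= frequency G q E) -> c <= m E.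
  by move=> /ooU h; exact: (ler_cvg_to (cvg_cst c) (mE E) h).
have m_le c E : (\forall q \near \oo, frequency G q E <= c) -> m E <= c.
  by move=> /ooU h; exact: (ler_cvg_to (mE E) (cvg_cst c) h).
have m_ge0 E : 0 <= m E.
  by apply: m_ge; apply: nearW => q; have /andP[] := frequency_itv E q.
have mT : m setT = 1.
  have f1 q : frequency G q setT = 1.
    rewrite /frequency [X in X%:R / _](_ : _ = #|T q|) ?divff ?lt0r_neq0//.
    by apply: eq_card => z; rewrite !inE; apply/asboolP.
  by apply/eqP; rewrite eq_le; apply/andP; split; [apply: m_le|apply: m_ge];
    apply: nearW => q; rewrite f1.
have mU E F : E `&` F = set0 -> m (E `|` F) = m E + m F.
  move=> EF; have h : frequency G ^~ (E `|` F) @ U --> m E + m F.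
    rewrite (_ : frequency G ^~ (E `|` F) =
      frequency G ^~ E \+ frequency G ^~ F); first exact: cvgD.
    apply/funext => q /=; rewrite /frequency -mulrDl -natrD; congr (_%:R / _).
    rewrite -cardUI [X in (_ + X)%N](_ : _ = 0)%N ?addn0.
      by apply: eq_card => z; rewrite !inE; apply/asboolP/orP;
        move=> [/asboolP|/asboolP]; [left|right|left|right].
    apply: eq_card0 => z; rewrite !inE; apply/negP => /andP[/asboolP h1 /asboolP h2].
    by have : (E `&` F) (hull_act (t z) G) by []; rewrite EF.
  exact: cvg_unique (mE _) h.
have m_act d E : D d -> m (hull_act d @^-1` E) <= m E.
  move=> Dd; set bad := fun q =>
    #|[pred z : T q | ~~ [exists z' : T q, t z' == t z + d]]|%:R / #|T q|%:R : R.
  have badU : bad @ U --> (0 : R) by apply: cvg_trans (T_folner Dd); exact: cvg_app.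
  rewrite -[leRHS]addr0; apply: (ler_cvg_to (mE _) (cvgD (mE E) badU)).
  apply: nearW => q; rewrite /frequency /bad fctE -mulrDl -natrD.
  rewrite ler_pM2r ?invr_gt0// ler_nat addnC.
  set Q := [pred z : T q | ~~ _]; set P := [pred z | _]; set P' := [pred z | _].
  rewrite -(cardID Q P); apply: leq_add.
    by apply: subset_leq_card; apply/fintype.subsetP => z; rewrite !inE => /andP[].
  (* The index of the translated point. The default is taken only at the bad indices [Q], whose
     proportion tends to 0. *)
  pose f (z : T q) := odflt z [pick z' : T q | t z' == t z + d].
  have fE z : z \notin Q -> t (f z) = t z + d.
    rewrite !inE negbK => /existsP[z' z'E]; rewrite /f.
    by case: pickP => [w /eqP //|h]; have := h z'; rewrite /= z'E.
  rewrite -(@card_in_image _ _ f); last first.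
    move=> z w; rewrite !inE => /andP[zQ _] /andP[wQ _] fzw.
    by apply: (@t_inj q); apply: (addIr d); rewrite -!fE// fzw.
  apply: subset_leq_card; apply/fintype.subsetP => _ /fintype.imageP[z + ->].
  rewrite inE => /andP[zQ]; rewrite !inE fE//= => /asboolP /= zE.
  by apply/asboolP; rewrite addrC -hull_actD.
have [mu muE] := regularization m_ge0 mT mU (@hull_compact _ _ L).
exists mu; split.
(* One inequality for all vectors suffices: applied to [- s] it yields the reverse one. *)
- suff act_le s E : (outer_content m (hull_act s @^-1` E) <= outer_content m E)%E.
    move=> s B mB; rewrite !muE; apply/eqP; rewrite eq_le act_le/=.
    apply: le_trans (act_le (- s) _); apply: outer_content_mono => // x Bx /=.
    by rewrite hull_actD subrr hull_act0.
  apply: le_ereal_inf_tmp => _ [W [oW EW] <-].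
  have oW' : open (hull_act s @^-1` W).
    by apply: open_comp => // x _; exact: hull_act_continuous.
  apply: ge_ereal_inf; exists (inner_content m (hull_act s @^-1` W)).
    by exists (hull_act s @^-1` W) => //; split => // x /EW.
  apply: ge_ereal_sup => _ [K [cK KW] <-].
  (* By compactness the image of [K] under [s] keeps a uniform margin [e] inside [W], so [s] can be
     replaced by a nearby vector of the dense set [D], for which [m_act] is available. *)
  have [e e0 eW] : exists2 e, 0 < e & forall x, K x -> ball (hull_act s x) e `<=` W.
    have /compact_near_coveringP cpK : compact K.
      by apply: (subclosed_compact cK (@hull_compact _ _ L)).
    have [x Kx|n _ hn] := cpK nat \oo
        (fun n x => ball (hull_act s x) (n.+1%:R^-1) `<=` W).
      have /nbhs_ballP[e /= e0 eW] : nbhs (hull_act s x) W.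
        by exact: open_nbhs_nbhs (conj oW (KW x Kx)).
      have e2 : 0 < e / 2 by rewrite divr_gt0.
      have [k _ hk] := near_infty_natSinv_lt (PosNum e2).
      exists (hull_act s @^-1` (ball (hull_act s x) (e / 2)), [set j | (k <= j)%N]) => /=.
        split; last by exists k.
        by apply: hull_act_continuous; exact: nbhsx_ballx.
      move=> [y j] [/= xy kj] z yz; apply: eW; rewrite [e]splitr.
      by apply: ball_triangle xy _; apply: le_ball yz; apply/ltW/hk.
    by exists n.+1%:R^-1; [rewrite invr_gt0|move=> x /(hn n (leqnn n))].
  have [d Dd sd] := D_dense s (divr_gt0 e0 (ltr0Sn _ 1)).
  have DK : closed (hull_act (- d) @^-1` K).
    by apply: preimage_closed => // x _; exact: hull_act_continuous.
  have KE : K = hull_act d @^-1` (hull_act (- d) @^-1` K).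
    by apply/seteqP; split => x /=; rewrite hull_actD addNr hull_act0.
  apply: (@le_trans _ _ (m (hull_act (- d) @^-1` K))%:E).
    by rewrite lee_fin {1}KE m_act.
  apply: inner_content_ge => // x /= Kx; apply: (eW _ Kx).
  rewrite -[X in ball _ _ X]hull_act0 -(subrr d) -hull_actD ballEmdist /=.
  by apply: le_lt_trans (hull_act_dist _ _ _) _; rewrite mulrC -ltr_pdivlMr.
- move=> K c cK h.
  have oK : open (~` K) by exact: closed_openC.
  have mK : measurable (K : set (g_sigma_algebraType (@open X))).
    by rewrite -[K]setCK; apply: measurableC; exact: sub_sigma_algebra.
  (* On the open complement the measure is at most [m], so on [K] it is at least [m K]. *)
  have := probability_setC mu mK; rewrite [mu (~` K)]muE outer_content_open// => e.
  have := inner_content_le m_ge0 mU (~` K); rewrite e.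
  have mKC : m K + m (~` K) = 1 by rewrite -mU ?setUv// setICr.
  have /fineK <- := fin_num_measure mu K mK.
  rewrite -EFinB !lee_fin => h2; apply: le_trans (m_ge _ _ h) _; lra.
- move=> W c oW h; rewrite muE outer_content_open//.
  by apply: le_trans (inner_content_le m_ge0 mU W) _; rewrite lee_fin m_le.
Qed.

End OrbitMeasure.

(** * The lattice and the torus *)

Section Lattice.
Context {R : realType} {N : nat} (A : 'M[R]_(N + 1)).
Local Notation V := 'cV[R]_N.
Local Notation lattice := (lattice A).
Local Notation lattice_pt := (lattice_pt A).
Implicit Types p q l : V * R.

Lemma lattice_ptB z w : lattice_pt (z - w) = lattice_pt z - lattice_pt w.
Proof.
rewrite /lattice_pt map_mxB mulmxBr.
by congr pair; rewrite ?linearB//= !mxE.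
Qed.

Lemma lattice0 : lattice 0.
Proof. by exists (0 - 0) => //; rewrite lattice_ptB subrr. Qed.

Lemma latticeB p q : lattice p -> lattice q -> lattice (p - q).
Proof. by move=> [z _ <-] [w _ <-]; exists (z - w) => //; rewrite lattice_ptB. Qed.

Lemma latticeN p : lattice p -> lattice (- p).
Proof. by rewrite -[- p]add0r; apply: latticeB; exact: lattice0. Qed.

Lemma latticeD p q : lattice p -> lattice q -> lattice (p + q).
Proof. by move=> Lp Lq; rewrite -[q]opprK; apply: latticeB => //; exact: latticeN. Qed.

Definition prod_norm p : R := enorm p.1 + `|p.2|.

Lemma prod_normD p q : prod_norm (p + q) <= prod_norm p + prod_norm q.
Proof. by rewrite /prod_norm addrACA lerD ?enormD ?ler_normD. Qed.

Lemma prod_normN p : prod_norm (- p) = prod_norm p.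
Proof. by rewrite /prod_norm enormN normrN. Qed.

Lemma prod_norm_ge0 p : 0 <= prod_norm p.
Proof. by rewrite addr_ge0 ?enorm_ge0. Qed.

Lemma prod_norm_eq0 p : prod_norm p = 0 -> p = 0.
Proof.
move/eqP; rewrite paddr_eq0 ?enorm_ge0// => /andP[/eqP/enorm_eq0 p1].
rewrite normr_eq0 => /eqP p2.
by case: p p1 p2 => a b /= -> ->.
Qed.

Lemma nbhs_prod_norm p e : 0 < e -> nbhs p [set q | prod_norm (p - q) < e].
Proof.
move=> e0; have e2 : 0 < e / 2 by rewrite divr_gt0.
exists ([set x | enorm (p.1 - x) < e / 2], [set h | `|p.2 - h| < e / 2]) => /=.
  split; first exact: nbhs_enorm.
  by apply/nbhs_ballP; exists (e / 2) => //= h.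
by move=> [x h] [/= h1 h2]; rewrite /prod_norm /= [e]splitr ltrD.
Qed.

Context (A_GL : A \in unitmx).

(** The inverse of [A] recovers the integer coordinates, so the lattice inherits its discreteness
    from the integers. *)
Lemma lattice_coord_bound : exists2 c : R, 0 < c & forall (z : 'cV[int]_(N + 1)) i,
  `|(z i 0)%:~R| <= c * prod_norm (lattice_pt z).
Proof.
pose c := \sum_i \sum_j `|invmx A i j|.
exists (c + 1) => [|z i].
  by rewrite ltr_wpDl// sumr_ge0// => i _; rewrite sumr_ge0.
have : (z i 0)%:~R = (invmx A *m (A *m map_mx intr z)) i 0 :> R.
  by rewrite mulKmx// mxE.
rewrite mxE => ->; apply: le_trans (ler_norm_sum _ _ _) _.
apply: (@le_trans _ _ (c * prod_norm (lattice_pt z))); last first.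
  by rewrite ler_wpM2r ?prod_norm_ge0// lerDl.
have ci : \sum_j `|invmx A i j| <= c.
  by rewrite /c [leRHS](bigD1 i)//= lerDl sumr_ge0// => k _; rewrite sumr_ge0.
apply: le_trans (ler_wpM2r (prod_norm_ge0 _) ci); rewrite mulr_suml.
apply: ler_sum => j _; rewrite normrM ler_wpM2l//.
rewrite -[A *m _]vsubmxK; case: (split_ordP j) => k ->.
  rewrite col_mxEu; apply: le_trans (enorm_coord _ _) _.
  by rewrite /prod_norm lerDl.
rewrite col_mxEd (ord1 k) /prod_norm /=.
by rewrite lerDr enorm_ge0.
Qed.

Lemma lattice_discrete :
  exists2 d, 0 < d & forall p, lattice p -> p != 0 -> d <= prod_norm p.
Proof.
have [c c0 hc] := lattice_coord_bound.
exists c^-1; first by rewrite invr_gt0.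
move=> _ [z _ <-]; apply: contraR; rewrite -ltNge => zc.
suff -> : z = 0 by rewrite -(subrr (0 : 'cV[int]_(N + 1))) lattice_ptB subrr.
apply/colP => i; rewrite mxE; apply/eqP; rewrite -normr_le0 -ltzD1 add0r.
rewrite -(ltr_int R) intr_norm; apply: le_lt_trans (hc z i) _.
by rewrite -(mulfV (lt0r_neq0 c0)) ltr_pM2l.
Qed.

(** At most one lattice point comes closer to [p] than half the minimal norm [d], and it differs
    from [p]. *)
Lemma lattice_separated p : ~ lattice p ->
  exists2 d, 0 < d & forall l, lattice l -> d <= prod_norm (p - l).
Proof.
have [d d0 hd] := lattice_discrete => nLp.
have [[l [Ll pl]]|noL] := pselect (exists l, lattice l /\ prod_norm (p - l) < d / 2).
  have pl0 : 0 < prod_norm (p - l).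
    rewrite lt_def prod_norm_ge0 andbT; apply/negP => /eqP/prod_norm_eq0/eqP.
    by rewrite subr_eq0 => /eqP pE; apply: nLp; rewrite pE.
  exists (prod_norm (p - l)) => // l' Ll'; rewrite leNgt; apply/negP => h.
  have [ll'|ll'] := eqVneq l' l; first by move: h; rewrite ll' ltxx.
  have : d <= prod_norm (l' - l) by apply: hd; [exact: latticeB|rewrite subr_eq0].
  have -> : l' - l = (p - l) - (p - l') by rewrite opprB [RHS]addrC addrA subrK.
  by have := prod_normD (p - l) (- (p - l')); rewrite prod_normN; lra.
exists (d / 2); first by rewrite divr_gt0.
by move=> l Ll; rewrite leNgt; apply/negP => h; apply: noL; exists l.
Qed.

(** Only finitely many lattice points of the strip have physical norm at most 1, so [r] is a finite
    minimum; its start value 1 takes care of all the others. *)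
Lemma strip_discrete (c : R) : exists2 r, 0 < r &
  forall p, lattice p -> `|p.2| <= c -> p.1 != 0 -> r <= enorm p.1.
Proof.
have [k k0 hk] := lattice_coord_bound.
pose K := (Num.truncn (k * (1 + c))).+1.
pose f (g : {ffun 'I_(N + 1) -> 'I_(2 * K).+1}) : 'cV[int]_(N + 1) :=
  \col_i ((g i)%:Z - K%:Z).
pose r := \big[Order.min/(1 : R)]_(g | (lattice_pt (f g)).1 != 0)
  enorm (lattice_pt (f g)).1.
exists r.
  rewrite /r; apply: lt_bigmin => // g g0; rewrite lt_def enorm_ge0 andbT.
  by apply: contraNN g0 => /eqP/enorm_eq0/eqP.
move=> _ [z _ <-] zc z0.
have [z1|z1] := leP (enorm (lattice_pt z).1) 1; last first.
  by apply: le_trans (ltW z1); exact: bigmin_le_id.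
have zK i : (absz (z i 0%R) <= K)%N.
  rewrite -(ler_nat R) natr_absz intr_norm; apply: le_trans (hk z i) _.
  apply: (@le_trans _ _ (k * (1 + c))); first by rewrite ler_pM2l// lerD.
  by apply/ltW; exact: truncnS_gt.
have zE : z = f [ffun i => inord (absz (z i 0%R + K%:Z))].
  apply/colP => i; rewrite mxE ffunE inordK.
    by have := zK i; lia.
  by have := zK i; lia.
by rewrite zE; apply: bigmin_le_cond; rewrite -zE.
Qed.

End Lattice.

(** * The quotient topology of the torus *)

Section TorusTopology.
Context {R : realType} {N : nat} (A : 'M[R]_(N + 1)) (A_GL : A \in unitmx).
Local Notation V := 'cV[R]_N.
Implicit Types p q : V * R.
Local Notation pi p := (torus_class A p.1 p.2).
Local Open Scope quotient_scope.

Lemma torus_classE p q : pi p = pi q <-> lattice A (p - q).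
Proof.
case: p q => [x h] [y k] /=; rewrite /torus_class; split.
  by move=> /eqmodP; rewrite /= Quotient.equivE => /asboolP.
by move=> L; apply/eqmodP; rewrite /= Quotient.equivE; apply/asboolP.
Qed.

Lemma torus_class_surj (xi : torus A) : exists p, xi = pi p.
Proof. by exists (repr xi); rewrite /torus_class -surjective_pairing reprK. Qed.

(** The projection is open: a point near a representative of the class is moved by a lattice vector
    into the ball around [p]. *)
Lemma torus_class_nbhs p e : 0 < e ->
  nbhs (pi p) [set xi : torus A | exists2 q, xi = pi q & prod_norm (p - q) < e].
Proof.
move=> e0; apply: open_nbhs_nbhs; split; last first.
  by exists p => //; rewrite subrr /prod_norm /= enorm0 normr0 addr0.
rewrite /open /= /quotient_open openE => q [q' qq' pq'].
apply: filterS (nbhs_prod_norm q (e := e - prod_norm (p - q')) _); last by rewrite subr_gt0.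
move=> w /= qw; exists (w - (q - q')).
  have -> : \pi_(torus A) w = pi w by rewrite /torus_class -surjective_pairing.
  apply/torus_classE; rewrite opprB addrC subrK; apply/torus_classE.
  by rewrite -qq' /torus_class -surjective_pairing.
have -> : p - (w - (q - q')) = (p - q') + (q - w).
  by rewrite opprB addrACA !addrA.
by apply: le_lt_trans (prod_normD _ _) _; rewrite -ltrBrDl.
Qed.

Lemma torus_class_sep p q : pi p <> pi q -> exists2 e, 0 < e &
  forall p' q', prod_norm (p - p') < e -> prod_norm (q - q') < e -> pi p' <> pi q'.
Proof.
move=> pq; have [|d d0 hd] := lattice_separated A_GL (p := p - q).
  by move=> /torus_classE/pq.
exists (d / 2) => [|p' q' pp' qq' /torus_classE L]; first by rewrite divr_gt0.
have := hd _ L; have -> : p - q - (p' - q') = (p - p') - (q - q').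
  by rewrite !opprB addrACA [RHS]addrACA (addrC (- q)).
by have := prod_normD (p - p') (- (q - q')); rewrite prod_normN; lra.
Qed.

Lemma torus_closed1 (xi : torus A) : closed [set xi].
Proof.
have [p ->] := torus_class_surj xi => xi' clxi; apply: contrapT => nE.
have [q xi'E] := torus_class_surj xi'.
have [|e e0 he] := @torus_class_sep q p; first by rewrite -xi'E.
have := clxi _; rewrite xi'E => /(_ _ (torus_class_nbhs q e0)).
move=> [_ [-> [q' pq' qq']]]; apply: (he q' p) => //.
by rewrite subrr /prod_norm /= enorm0 normr0 addr0.
Qed.

End TorusTopology.

(** * The fibres of the torus parametrization *)

Section VerticalLimits.
Context {R : realType} {N : nat} (A : 'M[R]_(N + 1)) (E : set R).
Local Notation V := 'cV[R]_N.
Local Notation L := (curlywedge A E).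
Local Notation X := (hullSpace L).
Implicit Types (G : X).

Lemma hull_orbit_dense G e : 0 < e -> exists s, mdist G (hull_act s (hull_base L)) < e.
Proof.
move=> e0; have [_ [[s _ <-] h]] := set_valP G _ (nbhsx_ballx (hull_val G) _ e0).
by exists s; move: h; rewrite ballEmdist.
Qed.

(* A lattice point [(s, s')] satisfies [[s, 0] = [0, -s']] in the torus, so these
   limits make up the fibre over [[0, -theta]]. *)
Definition vertical_limit (theta : R) G : Prop := forall e, 0 < e ->
  exists p : V * R, [/\ lattice A p, `|p.2 - theta| < e &
    mdist G (hull_act p.1 (hull_base L)) < e].

(** If an orbit point at [s] is close to [G], continuity puts [[s, 0]] close to [[0, -theta]], so a
    lattice point lies near [(s, theta)]. Conversely a lattice point [p] sends the base point to the
    class [[0, - p.2]], and the torus is Hausdorff. *)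
Lemma torus_fibreE (A_GL : A \in unitmx) (beta : X -> torus A) theta G :
  torus_parametrization beta ->
  beta G = torus_class A 0 (- theta) <-> vertical_limit theta G.
Proof.
move=> [[bc _ bact] b0].
have bS s : beta (hull_act s (hull_base L)) = torus_class A s 0.
  by rewrite bact b0 /torus_act add0r.
split=> [bG e e0|vG].
  (* A quarter of [e], since the action is 2-Lipschitz in the vector and another [e / 2] goes into
     approximating [G] by its orbit. *)
  have e2 : 0 < e / 2 / 2 by rewrite !divr_gt0.
  have := @torus_class_nbhs _ _ A (0, - theta) _ e2; rewrite -bG.
  move=> /bc/nbhs_ballP[d /= d0 hd].
  have de : 0 < Num.min d (e / 2) by rewrite lt_min d0 divr_gt0.
  have [s] := hull_orbit_dense G de; rewrite lt_min => /andP[sd se].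
  have [|q bq hq] := hd (hull_act s (hull_base L)); first by rewrite ballEmdist.
  move: bq; rewrite bS => /(torus_classE A (s, 0) q) Lq.
  exists ((s, 0) - q); split => //=.
    have : `|- theta - q.2| < e / 2 / 2.
      by apply: le_lt_trans hq; rewrite /prod_norm /= lerDr enorm_ge0.
    by rewrite sub0r (addrC (- q.2)); lra.
  apply: le_lt_trans (metric_triangle _ (hull_act s (hull_base L)) _) _.
  have := hull_act_dist s (s - q.1) (hull_base L).
  have -> : s - (s - q.1) = q.1 by rewrite opprB addrC subrK.
  have : enorm q.1 < e / 2 / 2.
    apply: le_lt_trans hq; by rewrite /prod_norm /= sub0r enormN lerDl.
  lra.
have [p bp] := torus_class_surj (beta G).
apply: contrapT => nE.
have [|e e0 he] := @torus_class_sep _ _ A A_GL p (0, - theta); first by rewrite -bp.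
have := torus_class_nbhs A p e0; rewrite -bp => /bc/nbhs_ballP[d /= d0 hd].
have de : 0 < Num.min d e by rewrite lt_min d0.
have [q [Lq]] := vG _ de; rewrite !lt_min => /andP[_ qe] /andP[qd _].
have [|p' bp' hp'] := hd (hull_act q.1 (hull_base L)); first by rewrite ballEmdist.
apply: (he p' (0, - q.2)) => //.
  by rewrite /prod_norm /= subrr enorm0 add0r opprK addrC.
rewrite -bp' bS; apply/(torus_classE A (q.1, 0) (0, - q.2)).
by move: Lq; case: q {qe qd hd bp'} => a b /=; rewrite /GRing.add /= /add_pair /= subr0 opprK add0r.
Qed.

End VerticalLimits.

(** * Model sets *)

Section UniformlyDiscrete.
Context {R : realType} {N : nat}.
Implicit Types L : set 'cV[R]_N.

Lemma closed_enorm L x : closed L -> (forall e, 0 < e -> exists2 y, L y & enorm (x - y) < e) -> L x.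
Proof.
move=> cL h; apply: cL => P /nbhs_enormP[e e0 eP].
by have [y Ly xy] := h e e0; exists y; split => //; exact: eP.
Qed.

Lemma uniformly_discrete_closed L : uniformly_discrete L -> closed L.
Proof.
move=> [r r0 hr] x clx; apply: contrapT => nLx.
have r2 : 0 < r / 2 by rewrite divr_gt0.
have [y [Ly /= xy]] := clx _ (nbhs_enorm x r2).
have xy0 : 0 < enorm (x - y).
  rewrite lt_def enorm_ge0 andbT; apply/negP => /eqP/enorm_eq0/eqP.
  by rewrite subr_eq0 => /eqP xE; apply: nLx; rewrite xE.
have [z [Lz /= xz]] := clx _ (nbhs_enorm x xy0).
have yz : y <> z by move=> yz; rewrite yz ltxx in xz.
have := hr _ _ Ly Lz yz; have -> : y - z = (x - z) - (x - y).
  by rewrite opprB [RHS]addrC addrA subrK.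
have := enormD (x - z) (- (x - y)); rewrite enormN; lra.
Qed.

End UniformlyDiscrete.

Section ModelSets.
Context {R : realType} {N : nat} (A : 'M[R]_(N + 1)) (A_GL : A \in unitmx).
Context (cps : cut_and_project A).
Local Notation V := 'cV[R]_N.
Local Notation lattice := (lattice A).

Lemma curlywedgeP (W : set R) x :
  curlywedge A W x <-> exists l : V * R, [/\ lattice l, l.1 = x & W l.2].
Proof.
split=> [[l [Ll [_ Wl]] <-]|[l [Ll <- Wl]]]; by exists l.
Qed.

Lemma lattice_inj1 (p q : V * R) : lattice p -> lattice q -> p.1 = q.1 -> p = q.
Proof. by move=> Lp Lq; apply: cps.1; exact: mem_set. Qed.

Lemma strip_separated c : exists2 r, 0 < r &
  forall p q, lattice p -> lattice q -> `|p.2 - q.2| <= c ->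
    enorm (p.1 - q.1) < r -> p.1 = q.1.
Proof.
have [r r0 hr] := strip_discrete A_GL c; exists r => // p q Lp Lq pq.
apply: contraTeq => pq1; rewrite -leNgt; apply: (hr (p - q)) => //=.
  exact: latticeB.
by rewrite subr_eq0.
Qed.

Lemma curlywedge_uniformly_discrete (W : set R) :
  W `<=` `[0, 1] -> uniformly_discrete (curlywedge A W).
Proof.
move=> W01; have [r r0 hr] := strip_separated 1; exists r => // x y.
move=> /curlywedgeP[p [Lp <- /W01 pW]] /curlywedgeP[q [Lq <- /W01 qW]] pq.
rewrite leNgt; apply/negP => h; apply: pq; apply: hr h => //.
move: pW qW; rewrite /= !in_itv /= => /andP[? ?] /andP[? ?].
by rewrite ler_norml; apply/andP; split; lra.
Qed.

Lemma curlywedge_shiftR (W : set R) theta x : curlywedge A (shiftR theta W) x <->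
  exists l : V * R, [/\ lattice l, l.1 = x & W (l.2 - theta)].
Proof.
rewrite curlywedgeP; split=> -[l [Ll lx]].
  by move=> [h Wh hl]; exists l; split => //; rewrite -hl addrK.
by move=> Wl; exists l; split => //; exists (l.2 - theta) => //; rewrite subrK.
Qed.

Context (W : set R) (W_itv : W `<=` `[0, 1]) (theta : R).
Local Notation L := (curlywedge A (shiftR theta W)).
Local Notation X := (hullSpace L).
Local Notation base := (hull_base L).
Implicit Types G : X.

Lemma curlywedge_shiftR_uniformly_discrete : uniformly_discrete L.
Proof.
have [r r0 hr] := strip_separated 1; exists r => // x y.
move=> /curlywedge_shiftR[p [Lp <- /W_itv pW]] /curlywedge_shiftR[q [Lq <- /W_itv qW]] pq.
rewrite leNgt; apply/negP => h; apply: pq; apply: hr h => //.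
move: pW qW; rewrite /= !in_itv /= => /andP[? ?] /andP[? ?].
by rewrite ler_norml; apply/andP; split; lra.
Qed.

Lemma hull_base_pts : hull_pts base = L.
Proof.
rewrite -[LHS]/(closure L).
have /closure_id <- // : closed L.
exact: (uniformly_discrete_closed curlywedge_shiftR_uniformly_discrete).
Qed.

(** A translation by a lattice point in physical space amounts to a shift of the window in internal
    space. *)
Lemma hull_act_base_pts p x : lattice p -> hull_pts (hull_act p.1 base) x <->
  exists l : V * R, [/\ lattice l, l.1 = x & W (l.2 + (p.2 - theta))].
Proof.
move=> Lp; rewrite (_ : hull_pts _ = translate p.1 L); last first.
  exact: (congr1 (translate p.1) hull_base_pts).
rewrite translateE /= curlywedge_shiftR; split=> -[l [Ll lx Wl]].
  exists (l - p); split => /=; [exact: latticeB|by rewrite lx addrK|].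
  by rewrite addrA subrK.
exists (l + p); split => /=; [exact: latticeD|by rewrite lx|].
by rewrite -addrA.
Qed.

(** The nearby translates have points close to [x] coming from lattice points in a bounded strip.
    Uniform discreteness makes all of them the same [l], so [x] is exactly [l.1], and [l] serves
    every close enough translate. *)
Lemma vertical_limit_pt G x : vertical_limit theta G -> hull_pts G x ->
  exists l : V * R, [/\ lattice l, l.1 = x & exists2 c, 0 < c &
    forall q, lattice q -> `|q.2 - theta| < 1 ->
      mdist G (hull_act q.1 base) < c -> W (l.2 + (q.2 - theta))].
Proof.
(* Both shifted heights lie in [[0, 1]] and both shifts are below 1, so the heights of two
   candidates differ by at most 3. *)
move=> vG Gx; have [r r0 hr] := strip_separated 3.
have r2 : 0 < r / 2 by rewrite divr_gt0.
have x0 := enorm_ge0 x.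
have near_pt e : 0 < e -> exists2 c, 0 < c & forall q, lattice q ->
    mdist G (hull_act q.1 base) < c -> exists l : V * R,
    [/\ lattice l, W (l.2 + (q.2 - theta)) & enorm (x - l.1) < e].
  move=> e0; have [c c0 hc] := @closedSet_dist_near_pt _ N _ e x0 e0.
  exists c => // q Lq Gq; have [y + xy] := hc _ _ x (lexx _) Gx Gq.
  move=> /(hull_act_base_pts y Lq)[l [Ll ly Wl]].
  by exists l; split => //; rewrite ly.
have [c c0 hc] := near_pt _ r2.
have same q q' (l l' : V * R) e : lattice q -> lattice q' -> lattice l -> lattice l' ->
    `|q.2 - theta| < 1 -> `|q'.2 - theta| < 1 ->
    W (l.2 + (q.2 - theta)) -> W (l'.2 + (q'.2 - theta)) ->
    e <= r / 2 -> enorm (x - l.1) < e -> enorm (x - l'.1) < e -> l.1 = l'.1.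
  move=> Lq Lq' Ll Ll' q1 q1' /W_itv + /W_itv + er xl xl'.
  rewrite /= !in_itv /= => /andP[? ?] /andP[? ?].
  move: q1 q1'; rewrite !ltr_norml => /andP[? ?] /andP[? ?].
  apply: hr => //; first by rewrite ler_norml; apply/andP; split; lra.
  have -> : l.1 - l'.1 = (x - l'.1) - (x - l.1).
    by rewrite opprB [RHS]addrC addrA subrK.
  by apply: le_lt_trans (enormD _ _) _; rewrite enormN; lra.
have c1 : 0 < Num.min 1 c by rewrite lt_min ltr01.
have [q [Lq]] := vG _ c1; rewrite !lt_min => /andP[q1 _] /andP[_ qc].
have [l [Ll Wl xl]] := hc q Lq qc.
have lx : l.1 = x.
  apply/esym/eqP; rewrite -subr_eq0; apply/eqP/enorm_eq0/eqP.
  rewrite eq_le enorm_ge0 andbT; apply/ler_addgt0Pl => e e0; rewrite addr0.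
  have er : 0 < Num.min e (r / 2) by rewrite lt_min e0.
  have [c' c'0 hc'] := near_pt _ er.
  have c2 : 0 < Num.min 1 c' by rewrite lt_min ltr01.
  have [q' [Lq']] := vG _ c2; rewrite !lt_min => /andP[q1' _] /andP[_ qc'].
  have [l' [Ll' Wl' xl']] := hc' q' Lq' qc'.
  move: xl'; rewrite lt_min => /andP[xl' xl2].
  by rewrite (same _ _ _ _ _ Lq Lq' Ll Ll' q1 q1' Wl Wl' (lexx _)) ?ltW.
exists l; split => //; exists c => // q' Lq' q1' qc'.
have [l' [Ll' Wl' xl']] := hc q' Lq' qc'.
suff -> : l = l' by [].
exact/lattice_inj1/(same _ _ _ _ _ Lq Lq' Ll Ll' q1 q1' Wl Wl' (lexx _)).
Qed.

(** The height of the lattice point over [x] is a limit of heights in [W]. *)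
Lemma vertical_limit_sub G : closed W -> vertical_limit theta G ->
  hull_pts G `<=` curlywedge A W.
Proof.
move=> cW vG x Gx; have [l [Ll lx [c c0 hc]]] := vertical_limit_pt vG Gx.
apply/curlywedgeP; exists l; split => //.
apply: cW => B /nbhs_ballP[e /= e0 eB].
have d0 : 0 < Num.min (Num.min 1 e) c by rewrite !lt_min ltr01 e0.
have [q [Lq]] := vG _ d0; rewrite !lt_min => /andP[/andP[q1 qe] _] /andP[_ qc].
exists (l.2 + (q.2 - theta)); split; first exact: hc.
by apply: eB; rewrite /ball /= opprD addrA subrr sub0r normrN.
Qed.

(** The pattern is a cluster point of the translates, not a limit: a condition valid eventually
    forces a point in, whereas a point of the pattern only guarantees its condition for arbitrarily
    large [j]. *)
Lemma vertical_limit_ex (p : nat -> V * R) : (forall j, lattice (p j)) ->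
  (p j).2 @[j --> \oo] --> theta ->
  exists G, [/\ vertical_limit theta G,
    forall l, lattice l -> (\forall j \near \oo, W (l.2 + ((p j).2 - theta))) ->
      hull_pts G l.1 &
    forall l, lattice l -> hull_pts G l.1 ->
      forall n, exists2 j, (n <= j)%N & W (l.2 + ((p j).2 - theta))].
Proof.
move=> Lp pt.
pose F : set_system X := (fun j => hull_act (p j).1 base) @ \oo.
have FF : ProperFilter F by exact: fmap_proper_filter.
have [G [_ clG]] := @hull_compact _ _ L F FF filterT.
have near_eq (P : set nat) e : (\forall j \near \oo, P j) -> 0 < e ->
    exists2 j, P j & mdist G (hull_act (p j).1 base) < e.
  move=> hP e0.
  have [|_ [[j Pj <-] Gj]] := clG [set hull_act (p j).1 base | j in P] _ _ (nbhsx_ballx G _ e0).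
    by apply: filterS hP => j Pj; exists j.
  by exists j => //; move: Gj; rewrite ballEmdist.
have near_theta e : 0 < e -> \forall j \near \oo, `|(p j).2 - theta| < e.
  by move=> e0; move/cvgrPdist_lt/(_ _ e0): pt; apply: filterS => j; rewrite distrC.
have vG : vertical_limit theta G.
  move=> e e0; have [j pj Gj] := near_eq _ e (near_theta _ e0) e0.
  by exists (p j).
exists G; split => // l Ll.
  move=> hl; apply: closed_enorm; first exact: pts_closed.
  move=> e e0; have [c c0 hc] := @closedSet_dist_near_pt _ N _ e (enorm_ge0 l.1) e0.
  have [j Wj Gj] := near_eq _ c hl c0.
  apply: (hc (hull_val (hull_act (p j).1 base)) (hull_val G) _ (lexx _)).
    by apply/(hull_act_base_pts _ (Lp j)); exists l.
  by rewrite metric_sym.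
move=> Gl n; have [l' [Ll' ll' [c c0 hc]]] := vertical_limit_pt vG Gl.
rewrite -(lattice_inj1 Ll' Ll ll').
have nn : \forall j \near \oo, (n <= j)%N /\ `|(p j).2 - theta| < 1.
  by near=> j; split; near: j; [exists n|exact: near_theta].
have [j [nj pj] Gj] := near_eq _ c nn c0.
by exists j => //; exact: hc.
Unshelve. all: by end_near.
Qed.

End ModelSets.

(** * The window *)

Section Window.
Context {R : realType}.

Lemma closure_realP (E : set R) x :
  closure E x <-> forall e, 0 < e -> exists2 y, E y & `|x - y| < e.
Proof.
split=> [clx e e0|h P /nbhs_ballP[e /= e0 eP]].
  by have [y [Ey xy]] := clx _ (nbhsx_ballx x _ e0); exists y.
by have [y Ey xy] := h e e0; exists y; split => //; exact: eP.
Qed.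

Lemma interior_realP (E : set R) x :
  interior E x <-> exists2 e, 0 < e & forall y, `|x - y| < e -> E y.
Proof.
split=> [/nbhs_ballP[e /= e0 eE]|[e e0 eE]].
  by exists e => // y xy; exact: eE.
by apply/nbhs_ballP; exists e => //= y xy; exact: eE.
Qed.

Lemma open_realP (E : set R) x : open E -> E x -> exists2 e, 0 < e &
  forall y, `|x - y| < e -> E y.
Proof. by move=> oE Ex; apply/interior_realP; exact: (open_nbhs_nbhs (conj oE Ex)). Qed.

Lemma closure_shiftR (E : set R) a x : closure (shiftR a E) x <-> closure E (x - a).
Proof.
split=> /closure_realP h; apply/closure_realP => e /h.
  by move=> [_ [y Ey <-] xy]; exists y => //; rewrite (_ : _ - _ = x - (y + a))//; ring.
move=> [y Ey xy]; exists (y + a); first by exists y.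
by rewrite (_ : _ - _ = x - a - y)//; ring.
Qed.

Context (a eps : nat -> R) (B : nat -> set R).
Let I k : set R := `]a k, a k + eps k[%classic.
Context (eps_gt0 : forall k, 0 < eps k) (I_disj : trivIset [set: nat] I).
Context (I_dense : closure (\bigcup_k I k) = `[0, 1]%classic).
Context (I_perfect : perfect_set (residual I)).
Context (B_open : forall k, open (B k) /\ B k `<=` `[0, 1]) (B_clos0 : forall k, closure (B k) 0).
Local Notation W := (window I B).

Lemma gap_set_gt0 k h : B k h -> 0 < h.
Proof.
move=> Bh; have [oB B01] := B_open k; have [e e0 he] := open_realP oB Bh.
have : B k (h - e / 2) by apply: he; rewrite opprB addrC subrK ger0_norm; lra.
by move/B01; rewrite /= in_itv /=; lra.
Qed.

Lemma interval_isopen k : open (I k).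
Proof. by apply: interval_open. Qed.

Lemma interval_inf k : inf (I k) = a k.
Proof. by rewrite inf_itv// bnd_simp ltrDl. Qed.

Lemma interval_sub k : I k `<=` `[0, 1].
Proof. by move=> x Ix; rewrite -I_dense; apply: subset_closure; exists k. Qed.

Lemma interval_eq j k x : I j x -> I k x -> j = k.
Proof.
move=> Ij Ik; apply: contrapT => /eqP jk.
by move/trivIsetP: I_disj => /(_ j k Logic.I Logic.I jk); apply/eqP/set0P; exists x.
Qed.

Lemma window_mem k x : I k x -> W x <-> closure (B k) (x - a k).
Proof.
move=> Ix; split=> [[[_ []]|[j _ [Ijx]]]|h]; first by exists k.
  by rewrite (interval_eq Ijx Ix) interval_inf => /closure_shiftR.
by right; exists k => //; split => //; rewrite interval_inf; apply/closure_shiftR.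
Qed.

Lemma window_memD k h : 0 < h < eps k -> W (a k + h) <-> closure (B k) h.
Proof.
move=> /andP[h0 hk]; rewrite (@window_mem k) ?(addrC (a k)) ?addrK//.
by rewrite /I /= in_itv /=; apply/andP; split; lra.
Qed.

Lemma window_sub : W `<=` `[0, 1].
Proof. by move=> x [[//]|[k _ [Ix _]]]; exact: interval_sub Ix. Qed.

(** Inside an open [I k] closedness is local and holds by construction; a limit point outside all
    the intervals belongs to the residual set. *)
Lemma window_closed : closed W.
Proof.
move=> x clx.
have x01 : `[0, 1]%classic x.
  have /closure_id -> : closed (`[0, 1]%classic : set R) by exact: interval_closed.
  by apply: closureS clx; exact: window_sub.
have [[k _ Ix]|nI] := pselect ((\bigcup_k I k) x); last by left.
apply/(window_mem Ix)/closure_realP => e e0.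
have [d d0 hd] := open_realP (@interval_isopen k) Ix.
have e2 : 0 < Num.min (e / 2) d by rewrite lt_min d0 divr_gt0.
have /closure_realP/(_ _ e2)[y Wy] := clx; rewrite lt_min => /andP[xe xd].
have /closure_realP h := (window_mem (hd y xd)).1 Wy.
have [|z Bz yz] := h (e / 2).
  by rewrite divr_gt0.
exists z => //; have -> : x - a k - z = (x - y) + (y - a k - z) by ring.
by rewrite [e]splitr; apply: le_lt_trans (ler_normD _ _) _; rewrite ltrD.
Qed.

(** The copy of the open set [B k] starting at [a k] comes arbitrarily close to [a k], because 0 is
    in its closure. *)
Lemma window_interior_right k e : 0 < e ->
  exists2 y, interior W y & a k < y < a k + e.
Proof.
move=> e0; have e2 : 0 < Num.min e (eps k) by rewrite lt_min e0 eps_gt0.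
have /closure_realP/(_ _ e2)[b Bb] := B_clos0 k.
have b0 := gap_set_gt0 Bb; rewrite sub0r normrN gtr0_norm// lt_min => /andP[be bk].
exists (a k + b); last by apply/andP; split; lra.
have [d d0 hd] := open_realP (B_open k).1 Bb.
apply/interior_realP; exists (Num.min d (Num.min b (eps k - b))) => [|y].
  by rewrite !lt_min d0 b0 subr_gt0.
rewrite !lt_min => /and3P[yd yb yk].
have -> : y = a k + (y - a k) by ring.
apply/window_memD.
  move: yb yk; rewrite !ltr_norml => /andP[? ?] /andP[? ?].
  by apply/andP; split; lra.
apply: subset_closure; apply: hd.
by rewrite (_ : b - _ = a k + b - y)//; ring.
Qed.

(** By density some interval meets [(x, x + 2d)]. It cannot contain [x], so its left endpoint is at
    least [x]. *)
Lemma residual_right x e : residual I x -> x < 1 -> 0 < e ->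
  exists k, x <= a k < x + e.
Proof.
move=> [x01 nI] x1 e0; set d := Num.min e (1 - x) / 2.
have d0 : 0 < d by rewrite divr_gt0// lt_min e0 subr_gt0.
have de : d * 2 <= e by rewrite divfK// ge_min lexx.
have d1 : d * 2 <= 1 - x by rewrite divfK// ge_min lexx orbT.
move: x01; rewrite /= in_itv /= => /andP[x0 _].
have /closure_realP/(_ d d0)[w [k _ Iw]] : closure (\bigcup_k I k) (x + d).
  by rewrite I_dense /= in_itv /=; apply/andP; split; lra.
rewrite ltr_norml => /andP[w1 w2]; exists k.
move: Iw; rewrite /I /= in_itv /= => /andP[aw wa].
apply/andP; split; last by lra.
rewrite leNgt; apply/negP => ax; apply: nI; exists k => //.
by rewrite /I /= in_itv /=; apply/andP; split; lra.
Qed.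

(** A residual point below 1 is approached from the right by left endpoints, hence by interior
    points of the window; inside [I k] the window is the closure of an open set. *)
Lemma window_proper : W `<=` closure (interior W).
Proof.
have res x : residual I x -> x < 1 -> closure (interior W) x.
  move=> rx x1; apply/closure_realP => e e0.
  have e2 : 0 < e / 2 by rewrite divr_gt0.
  have [k /andP[xa ax]] := residual_right rx x1 e2.
  have [y Wy /andP[ay ya]] := window_interior_right k e2.
  by exists y => //; rewrite ltr_norml; apply/andP; split; lra.
move=> x [rx|[k _ [Ix]]].
  have [x1|x1] := ltP x 1; first exact: res.
  (* The point 1 has no intervals to its right. Perfectness of the residual set supplies nearby
     residual points below 1. *)
  apply/closure_realP => e e0; have e2 : 0 < e / 2 by rewrite divr_gt0.
  have [_ lp] := I_perfect.
  have : limit_point (residual I) x by rewrite lp.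
  move=> /(_ _ (nbhsx_ballx x _ e2))[y [yx ry xy]].
  have y1 : y < 1.
    have [x01 _] := rx; have [y01 _] := ry.
    move: x01 y01; rewrite /= !in_itv /= => /andP[_ x1'] /andP[_ y1].
    by rewrite lt_neqAle y1 andbT; apply: contra yx => /eqP ->; apply/eqP; lra.
  have /closure_realP/(_ _ e2)[z Wz yz] := res y ry y1.
  exists z => //; have -> : x - z = (x - y) + (y - z) by ring.
  by rewrite [e]splitr; apply: le_lt_trans (ler_normD _ _) _; rewrite ltrD.
rewrite interval_inf => /closure_shiftR/closure_realP h; apply/closure_realP => e e0.
have [d d0 hd] := open_realP (@interval_isopen k) Ix.
have ed : 0 < Num.min e d by rewrite lt_min e0.
have [b Bb] := h _ ed; rewrite lt_min => /andP[be bd].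
exists (a k + b); last by rewrite (_ : x - _ = x - a k - b)//; ring.
have Ib : I k (a k + b) by apply: hd; rewrite (_ : x - _ = x - a k - b)//; ring.
have [d' d'0 hd'] := open_realP (@interval_isopen k) Ib.
have [d2 d20 hd2] := open_realP (B_open k).1 Bb.
apply/interior_realP; exists (Num.min d' d2) => [|y]; first by rewrite lt_min d'0.
rewrite lt_min => /andP[y1 y2]; apply/(window_mem (hd' y y1)).
apply: subset_closure; apply: hd2; rewrite (_ : _ - _ = a k + b - y)//; ring.
Qed.

End Window.

(** * The points l_v *)

Section Lift.
Context {R : realType} {N : nat} (A : 'M[R]_(N + 1)) (A_GL : A \in unitmx).
Context (cps : cut_and_project A) (A_normalized : normalized A).
Local Notation V := 'cV[R]_N.
Implicit Types (z : 'cV[int]_N) (k : int).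

(* The Schur complement of the normalized corner entry: it maps the first
   coordinates [z] of a lattice vector to its physical component, up to a
   correction proportional to the internal component. *)
Definition schur : 'M[R]_N := ulsubmx A - ursubmx A *m dlsubmx A.

Let drA : drsubmx A = 1%:M.
Proof.
apply/matrixP => i j; rewrite !ord1 !mxE eqxx mulr1n.
by rewrite -A_normalized.2; congr (A _ _); apply/val_inj; rewrite /= ?lshift0.
Qed.

(** Eliminating the last integer coordinate in favour of the height [p.2]: while the height stays
    bounded, the physical component stays at bounded distance from [schur *m z]. *)
Lemma lattice_pt_col z k : let p := lattice_pt A (col_mx z k%:M) in
  p.1 = schur *m map_mx intr z + p.2 *: ursubmx A /\
  p.2 = (dlsubmx A *m map_mx intr z) 0 0 + k%:~R.
Proof.
rewrite /lattice_pt map_col_mx -[A in A *m _]submxK mul_block_col drA mul1mx.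
rewrite col_mxKu col_mxKd [map_mx intr k%:M]mx11_scalar !mxE eqxx mulr1n.
set y := map_mx intr z; split; last by congr (_ + _); rewrite mxE.
rewrite /schur mulmxBl -mulmxA mul_mx_scalar scalerDl addrA; congr (_ + _).
by rewrite [dlsubmx A *m y]mx11_scalar mul_mx_scalar mxE addrNK.
Qed.

Lemma lift_pt_lattice z : lattice A (lift_pt A z).
Proof. by exists (col_mx z (last_coord A z)%:M). Qed.

Lemma last_coord_uniq z k : 0 <= (lattice_pt A (col_mx z k%:M)).2 < 1 ->
  lift_pt A z = lattice_pt A (col_mx z k%:M).
Proof.
move=> hk; rewrite /lift_pt; do 3 f_equal; rewrite /last_coord.
case: xgetP => [k' _ /= hk'|/(_ k)//].
have {}hk' : 0 <= (lattice_pt A (col_mx z k'%:M)).2 < 1 := hk'.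
move: hk hk'; rewrite !(lattice_pt_col z _).2.
set c : R := (dlsubmx A *m map_mx intr z) 0 0 => /andP[h1 h2] /andP[h3 h4].
have : `|(k' - k)%:~R| < 1 :> R by rewrite intrB ltr_norml; apply/andP; split; lra.
rewrite -intr_norm (ltr_int R _ 1); clear; lia.
Qed.

Lemma lift_pt_itv z : 0 <= (lift_pt A z).2 < 1.
Proof.
set c := (dlsubmx A *m map_mx intr z) 0 0.
have h : 0 <= (lattice_pt A (col_mx z (- Num.floor c)%:M)).2 < 1.
  rewrite (lattice_pt_col z _).2 -/c rmorphN /=.
  by have := floor_itv c; rewrite intrD1 => /andP[? ?]; apply/andP; split; lra.
by rewrite (last_coord_uniq h).
Qed.

Lemma lift_pt1 z : (lift_pt A z).1 =
  schur *m map_mx intr z + (lift_pt A z).2 *: ursubmx A.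
Proof. exact: (lattice_pt_col z _).1. Qed.

Lemma lattice_lift (l : V * R) : lattice A l -> 0 <= l.2 < 1 ->
  exists z, l = lift_pt A z.
Proof.
move=> [w _ <-]; rewrite -[w]vsubmxK [dsubmx w]mx11_scalar => h.
by exists (usubmx w); rewrite (last_coord_uniq h).
Qed.

Lemma lattice_pt_inj : injective (lattice_pt A).
Proof.
move=> w w' e; have e' : lattice_pt A (w - w') = 0 by rewrite lattice_ptB e subrr.
apply/colP => i; have [c c0 hc] := lattice_coord_bound A_GL.
have := hc (w - w') i; rewrite e' /prod_norm /= enorm0 normr0 addr0 mulr0 normr_le0.
by rewrite !mxE intr_eq0 subr_eq0 => /eqP.
Qed.

Lemma lift_pt1_inj : injective (fun z => (lift_pt A z).1).
Proof.
move=> z z' /(lattice_inj1 cps (lift_pt_lattice z) (lift_pt_lattice z')).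
by move=> /lattice_pt_inj/(congr1 usubmx); rewrite !col_mxKu.
Qed.

(** A kernel vector [y] of the Schur complement extends to the kernel vector [(y, - dlsubmx A *m y)]
    of [A]. *)
Lemma schur_unit : schur \in unitmx.
Proof.
rewrite -[schur]trmxK unitmx_tr -row_free_unit; apply/inj_row_free => u uM.
pose y := u^T; suff y0 : y = 0 by rewrite -[u]trmxK -/y y0 trmx0.
have My : schur *m y = 0 by apply: trmx_inj; rewrite trmx_mul trmxK trmx0.
have : A *m col_mx y (- (dlsubmx A *m y)) = 0.
  rewrite -[A in A *m col_mx _ _]submxK mul_block_col drA mul1mx subrr mulmxN.
  by rewrite mulmxA -mulmxBl -/schur My col_mx0.
move=> /(congr1 (mulmx (invmx A))); rewrite mulKmx// mulmx0.
by move=> /(congr1 usubmx); rewrite col_mxKu linear0.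
Qed.

End Lift.

(** * The embedded fullshift *)

Section FullShift.
Context {R : realType} {N : nat} (A : 'M[R]_(N + 1)).
Context (v : nat -> 'cV[int]_N) (n : nat -> nat) (eps : nat -> R).
Context (C : set R) (B : nat -> set R).
Context (A_GL : A \in unitmx) (cps : cut_and_project A) (A_normalized : normalized A).
Context (v_numbering : numbering v) (n_eps_admissible : admissible A v n eps).
Context (C0_cantor : cantor_set (residual (Iint A v n eps))).
Context (C_01 : C `<=` `[0, 1] /\ C 0 /\ C 1) (B_gaps : gap_family C B).
Local Notation W := (window (Iint A v n eps) B).
Local Notation pt k := (lift_pt A (v (n k))).
Context (theta : R).
Local Notation X := (hullSpace (curlywedge A (shiftR theta W))).

Let eps_gt0 k : 0 < eps k. Proof. by have [[]] := n_eps_admissible. Qed.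
Let I_disj : trivIset [set: nat] (fun k => `](pt k).2, (pt k).2 + eps k[%classic).
Proof. by have [] := n_eps_admissible. Qed.
Let I_dense : closure (\bigcup_k (`](pt k).2, (pt k).2 + eps k[%classic)) = `[0, 1]%classic.
Proof. by have [] := n_eps_admissible. Qed.
Let B_open k : open (B k) /\ B k `<=` `[0, 1]. Proof. by have [] := B_gaps. Qed.
Let B_clos0 k : closure (B k) 0.
Proof.
have [_ _ /(_ k) BC _] := B_gaps; have [_ [C0 _]] := C_01.
by move: C0; rewrite -BC => -[].
Qed.
Let I_perfect : perfect_set (residual (Iint A v n eps)).
Proof. by have [] := C0_cantor. Qed.

Lemma construction_window_sub : W `<=` `[0, 1]. Proof. exact: (window_sub I_dense). Qed.

Lemma construction_window_closed : closed W.
Proof. exact: (window_closed eps_gt0 I_disj I_dense). Qed.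

Lemma dense_internal (O : set R) : open O -> O !=set0 ->
  exists2 p : 'cV[R]_N * R, lattice A p & O (p.2 - theta).
Proof.
move=> oO [x Ox].
have oO' : open ((fun y => y - theta) @^-1` O).
  apply: open_comp oO => y _.
  by apply: cvgB; [exact: cvg_id|exact: cvg_cst].
have O'0 : (fun y => y - theta) @^-1` O !=set0.
  by exists (x + theta); rewrite /= addrK.
have [h [/= Oh [p Lp ph]]] := cps.2 _ O'0 oO'.
by exists p => //; rewrite ph.
Qed.

(* Prescribing the extra index [m] to be in the pattern forces
   [p.2 - theta] to be positive: [B m] is an open subset of [[0, 1]]. *)
Lemma pattern_ex (Q : set nat) m e : 0 < e -> exists p : 'cV[R]_N * R,
  [/\ lattice A p, 0 < p.2 - theta < e &
    forall k, (k < m)%N -> (Q k -> B k (p.2 - theta)) /\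
      (~ Q k -> ~ closure (B k) (p.2 - theta))].
Proof.
move=> e0; have [_ _ _ /(_ `I_m.+1 (fun k => `[< Q k >] || (k == m)))] := B_gaps.
move=> /(_ (finite_II _)) /closure_realP/(_ e e0).
set J := interior _ => -[y Jy ye].
have oO : open (J `&` ball 0 e).
  by apply: openI; [exact: open_interior|exact: ball_open].
have [|p Lp [Jp pe]] := dense_internal oO; first by exists y.
have Bm : B m (p.2 - theta).
  have /interior_subset[+ _] := Jp.
  by apply; rewrite /= ltnSn eqxx orbT.
have p0 := gap_set_gt0 B_open Bm.
exists p; split => //.
  by rewrite p0 /=; move: pe; rewrite /ball /= sub0r normrN gtr0_norm.
move=> k km; split=> [Qk|nQk clB].
  have /interior_subset[+ _] := Jp; apply => /=.
  by rewrite ltnW//; split => //; apply/orP; left; apply/asboolP.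
(* The chosen height lies in an open set disjoint from [B k], so it avoids the closure of [B k] as
   well. *)
have [z [Bz Jz]] := clB _ (open_nbhs_nbhs (conj (@open_interior _ _) Jp)).
have /interior_subset[_ +] := Jz; apply; exists k => //=.
rewrite ltnW//; split => //; rewrite negb_or; apply/andP; split.
  by apply/negP => /asboolP.
by rewrite neq_ltn km.
Qed.

(** The [j]-th lattice point realizes the pattern [Q] on the indices below [j] with a height in
    [(theta, theta + 1 / (j + 1))]; a cluster point of the translates realizes all of [Q]. *)
Lemma fullshift_ex (Q : set nat) : exists G : X,
  [/\ vertical_limit theta G, forall k, hull_pts G (pt k).1 <-> Q k &
    forall l, lattice A l -> hull_pts G l.1 -> W l.2 /\ l.2 < 1].
Proof.
have e0 j : 0 < j.+1%:R^-1 :> R by rewrite invr_gt0.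
have /choice[p hp] j := pattern_ex Q j (e0 j).
have Lp j : lattice A (p j) by have [] := hp j.
have p_lt e : 0 < e -> \forall j \near \oo, 0 < (p j).2 - theta < e.
  move=> e1; have := near_infty_natSinv_lt (PosNum e1); apply: filterS => j je.
  have [_ /andP[p1 p2] _] := hp j; rewrite p1 /=; exact: lt_trans je.
have p_cvg : (p j).2 @[j --> \oo] --> theta.
  apply/cvgrPdist_lt => e e1; have := p_lt e e1; apply: filterS => j /andP[h1 h2].
  by rewrite distrC gtr0_norm.
have [G [vG Gi Gf]] := vertical_limit_ex A_GL cps construction_window_sub Lp p_cvg.
exists G; split => // [k|l Ll Gl].
  (* From [j0] on the shifted endpoint stays inside the [k]-th interval, where membership in the
     window is decided by [B k]. *)
  have [j0 _ hj0] := p_lt _ (eps_gt0 k).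
  have Wk j : (j0 <= j)%N -> W ((pt k).2 + ((p j).2 - theta)) <->
      closure (B k) ((p j).2 - theta).
    by move=> jj; apply: (@window_memD _ (fun k => (pt k).2) eps B eps_gt0 I_disj); exact: hj0.
  split=> [Gk|Qk].
    have [j] := Gf _ (lift_pt_lattice A _) Gk (maxn j0 k.+1).
    rewrite geq_max => /andP[jj kj] /(Wk j jj).
    have [_ _ /(_ k kj)[_ nQ]] := hp j.
    by move=> clB; apply: contrapT => /nQ.
  apply: Gi; first exact: lift_pt_lattice.
  exists (maxn j0 k.+1) => // j /=; rewrite geq_max => /andP[jj kj].
  apply/(Wk j jj)/subset_closure.
  by have [_ _ /(_ k kj)[+ _]] := hp j; apply.
have [l' [Ll' ll' Wl']] : exists l' : 'cV[R]_N * R, [/\ lattice A l', l'.1 = l.1 & W l'.2].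
  apply/curlywedgeP.
  exact: (vertical_limit_sub A_GL cps construction_window_sub construction_window_closed vG).
rewrite -(lattice_inj1 cps Ll' Ll ll'); split => //.
(* A strictly positive shift of [l.2] still lies in [[0, 1]], so [l.2] is below 1. *)
have [j _ Wj] := Gf _ Ll Gl 0%N; rewrite (lattice_inj1 cps Ll' Ll ll').
have [_ /andP[p1 _] _] := hp j.
by have := construction_window_sub Wj; rewrite /= in_itv /=; lra.
Qed.

(** Needed for the full grid. Properness yields interior points of the window near [l.2], and
    density of the heights reaches them by shifts tending to 0, of either sign. *)
Lemma vertical_limit_through l : lattice A l -> W l.2 ->
  exists2 G : X, vertical_limit theta G & hull_pts G l.1.
Proof.
move=> Ll Wl.
have e0 j : 0 < j.+1%:R^-1 :> R by rewrite invr_gt0.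
have hex j : exists p : 'cV[R]_N * R, [/\ lattice A p, W (l.2 + (p.2 - theta)) &
    `|p.2 - theta| < j.+1%:R^-1].
  have Wc := window_proper eps_gt0 I_disj I_dense I_perfect B_open B_clos0 Wl.
  have /closure_realP/(_ _ (e0 j))[y Wy ly] := Wc.
  have oO : open ([set h | interior W (l.2 + h)] `&` ball 0 j.+1%:R^-1).
    apply: openI; last exact: ball_open.
    apply: open_comp (@open_interior _ W) => h _.
    by apply: cvgD; [exact: cvg_cst|exact: cvg_id].
  have [|p Lp [Wp pj]] := dense_internal oO.
    exists (y - l.2); split => /=; first by rewrite addrC subrK.
    by rewrite /ball /= sub0r opprB.
  exists p; split => //; first exact: interior_subset.
  by move: pj; rewrite /ball /= sub0r normrN.
have /choice[p hp] := hex.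
have Lp j : lattice A (p j) by have [] := hp j.
have p_cvg : (p j).2 @[j --> \oo] --> theta.
  apply/cvgrPdist_lt => e e1; have := near_infty_natSinv_lt (PosNum e1).
  by apply: filterS => j; rewrite distrC; apply: lt_trans; have [] := hp j.
have [G [vG Gi Gf]] := vertical_limit_ex A_GL cps construction_window_sub Lp p_cvg.
by exists G => //; apply: Gi => //; apply: nearW => j; have [] := hp j.
Qed.

End FullShift.

(** * Density of S *)

Section IntegerBoxes.
Context {N : nat}.
Local Notation box m := {ffun 'I_N -> 'I_(2 * m).+1}.
Implicit Types z : 'cV[int]_N.

Lemma sup_normP z m : (sup_norm z <= m)%N <-> forall i, (absz (z i 0%R) <= m)%N.
Proof.
split=> [h i|h]; last by apply/bigmax_leqP => i _; exact: h.
by apply: leq_trans h; exact: (leq_bigmax i).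
Qed.

Definition box_vec m (f : box m) : 'cV[int]_N := \col_i ((f i)%:Z - m%:Z).

(** The value is meaningful only for [sup_norm z <= m], where the shifted coordinates lie between 0
    and [2 * m]. *)
Definition vec_box m z : box m := [ffun i => inord (absz (z i 0%R + m%:Z))].

Lemma box_vec_norm m (f : box m) : (sup_norm (box_vec f) <= m)%N.
Proof. by apply/sup_normP => i; rewrite mxE; have := ltn_ord (f i); lia. Qed.

Lemma vec_boxK m z : (sup_norm z <= m)%N -> box_vec (vec_box m z) = z.
Proof.
move=> /sup_normP zm; apply/colP => i; rewrite mxE ffunE.
by have h := zm i; rewrite inordK; move: h; lia.
Qed.

Lemma box_vec_inj m : injective (@box_vec m).
Proof.
move=> f g fg; apply/ffunP => i; apply/val_inj => /=.
by have := congr1 (fun z : 'cV[int]_N => z i 0) fg; rewrite !mxE; lia.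
Qed.

Lemma card_box m : #|{: box m}| = ((2 * m).+1 ^ N)%N.
Proof. by rewrite card_ffun !card_ord. Qed.

(** If [v i] were outside the box, monotonicity would number all [(2m + 1)^N] vectors of the box
    before [i]. *)
Lemma numbering_lt (v : nat -> 'cV[int]_N) m i : numbering v ->
  (i < (2 * m).+1 ^ N)%N -> (sup_norm (v i) <= m)%N.
Proof.
move=> [[w vK wK] v_mono] iQ; rewrite leqNgt; apply/negP => mi.
have wi (f : box m) : (w (box_vec f) < i)%N.
  rewrite ltnNge; apply/negP => /v_mono /=; rewrite wK leqNgt.
  by rewrite (leq_ltn_trans (box_vec_norm f)).
pose g (f : box m) : 'I_i := Ordinal (wi f).
have g_inj : injective g.
  move=> f f' /(congr1 (@nat_of_ord i)) /= /(can_inj wK).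
  exact: box_vec_inj.
by have := leq_card g g_inj; rewrite card_box card_ord leqNgt iQ.
Qed.

(** Take [K] least with [n K >= Q], the size of the box: all earlier indices land in the box, and
    [K > d * n K >= d * Q] once the ratio [K / n K] exceeds [d], the midpoint of [l] and 1/2. *)
Lemma index_count {R : realType} (v : nat -> 'cV[int]_N) (n : nat -> nat) (l : R) :
  (0 < N)%N -> numbering v -> {homo n : j k / (j < k)%N} ->
  (k%:R / (n k)%:R : R) @[k --> \oo] --> l -> 2^-1 < l ->
  exists2 d : R, 2^-1 < d & \forall m \near \oo, exists2 K : nat,
    (forall k, (k < K)%N -> (sup_norm (v (n k)) <= m)%N) &
    d * ((2 * m).+1 ^ N)%:R <= K%:R.
Proof.
move=> N0 vnum n_mono nl l2.
have n_ge k : (k <= n k)%N by elim: k => // k ih; exact: leq_ltn_trans ih (n_mono _ _ (ltnSn k)).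
exists ((l + 2^-1) / 2); first by lra.
have dl : (l + 2^-1) / 2 < l by lra.
have [k0 _ hk0] := cvgr_gt _ nl _ dl.
exists (n k0) => // m /= nm; set Q := (_ ^ N)%N.
have [K KQ Kmin] : exists2 K, (Q <= n K)%N & forall k, (Q <= n k)%N -> (K <= k)%N.
  have ex : exists k, (Q <= n k)%N by exists Q.
  by exists (ex_minn ex); case: ex_minnP.
exists K => [k kK|].
  by apply: numbering_lt => //; rewrite ltnNge; apply/negP => /Kmin; rewrite leqNgt kK.
(* The ratio bound holds only from [k0] on. Otherwise [n K < n k0 < 2 * m + 1 <= Q], where the last
   inequality uses [0 < N]. *)
have k0K : (k0 <= K)%N.
  rewrite leqNgt; apply/negP => Kk0.
  have : (n K < n k0)%N by exact: n_mono.
  have : ((2 * m).+1 <= Q)%N by rewrite -[leqLHS]expn1 leq_pexp2l.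
  by lia.
have Q0 : (0 < Q)%N by rewrite expn_gt0.
have nK0 : 0 < (n K)%:R :> R by rewrite ltr0n; exact: leq_trans KQ.
have := hk0 K k0K; rewrite /= ltr_pdivlMr// => /ltW; apply: le_trans.
by rewrite ler_pM2l ?ler_nat//; lra.
Qed.

End IntegerBoxes.

Section Counting.
Context {R : realType}.

Lemma counting_ge (T : choiceType) (I : finType) (g : I -> T) (Y : set T) :
  injective g -> (forall i, Y (g i)) -> (#|I|%:R%:E <= counting Y :> \bar R)%E.
Proof.
move=> g_inj Yg; rewrite /counting; case: asboolP => fY; last exact: leey.
rewrite lee_fin ler_nat cardE -(size_map g); apply: uniq_leq_size.
  by rewrite map_inj_uniq ?enum_uniq.
by move=> _ /mapP[i _ ->]; rewrite in_fset_set// inE; exact: Yg.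
Qed.

Lemma limf_esup_ge (f : R -> \bar R) (c : \bar R) :
  (\forall t \near +oo, (c <= f t)%E) -> (c <= limf_esup f (pinfty_nbhs R))%E.
Proof.
move=> cf; apply: le_ereal_inf_tmp => _ [V /= VF <-].
have [t [ct Vt]] : exists t, (c <= f t)%E /\ V t.
  exact: (@filter_ex _ (pinfty_nbhs R) _ _ (filterI cf VF)).
by apply: le_trans ct _; apply: ereal_sup_ubound; exists t.
Qed.

End Counting.

Section Growth.
Context {R : realType} {N : nat} (A : 'M[R]_(N + 1)).
Context (A_normalized : normalized A).

Lemma lift_pt_bound : exists2 c : R, 0 < c & forall (z : 'cV[int]_N) i,
  `|(lift_pt A z).1 i 0| <= c * (sup_norm z).+1%:R.
Proof.
pose c := \sum_i \sum_j `|schur A i j|; pose b := \sum_i `|ursubmx A i 0|.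
have c0 : 0 <= c by rewrite sumr_ge0// => i _; rewrite sumr_ge0.
have b0 : 0 <= b by rewrite sumr_ge0.
exists (c + b + 1) => [|z i]; first by lra.
rewrite (lift_pt1 A_normalized) mxE [(_ *: ursubmx A) i 0]mxE.
have /andP[h0 h1] := lift_pt_itv A_normalized z.
have bi : `|ursubmx A i 0| <= b by rewrite /b (bigD1 i)//= lerDl sumr_ge0.
have h2 : `|(lift_pt A z).2 * ursubmx A i 0| <= b.
  by rewrite normrM (ger0_norm h0); apply: le_trans bi; rewrite ler_piMl// ltW.
have h3 : `|(schur A *m map_mx intr z) i 0| <= c * (sup_norm z)%:R.
  apply: (@le_trans _ _ ((\sum_j `|schur A i j|) * (sup_norm z)%:R)).
    rewrite mxE mulr_suml; apply: le_trans (ler_norm_sum _ _ _) _.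
    apply: ler_sum => j _; rewrite normrM ler_wpM2l// mxE -intr_norm -natr_absz ler_nat.
    exact: (iffLR (sup_normP z _) (leqnn _)).
  rewrite ler_wpM2r// /c [leRHS](bigD1 i)//= lerDl.
  by rewrite sumr_ge0// => k _; rewrite sumr_ge0.
apply: le_trans (ler_normD _ _) _; rewrite -natr1.
have s0 : 0 <= (sup_norm z)%:R :> R by [].
by have := mulr_ge0 b0 s0; lra.
Qed.

Context (N_gt0 : (0 < N)%N) (v : nat -> 'cV[int]_N) (n : nat -> nat) (eps : nat -> R).
Context (v_numbering : numbering v) (n_eps_admissible : admissible A v n eps).

Lemma index_density : exists2 d : R, 2^-1 < d & \forall m \near \oo, exists2 K : nat,
  (forall k, (k < K)%N -> (sup_norm (v (n k)) <= m)%N) &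
  d * ((2 * m).+1 ^ N)%:R <= K%:R.
Proof.
have [[n_mono _] _ _ [l nl l2]] := n_eps_admissible.
exact: index_count nl l2.
Qed.

Lemma cube_points : exists2 c : R, 0 < c & \forall t \near +oo, exists2 K : nat,
  (forall k, (k < K)%N -> cube t (lift_pt A (v (n k))).1) &
  c * cube_vol (N := N) t <= K%:R.
Proof.
have [c c0 hc] := lift_pt_bound.
have [d d2 [m0 _ hd]] := index_density.
have d0 : 0 < d by apply: lt_trans d2; rewrite invr_gt0.
(* A box of radius [m] with [m + 1] about [t / c] fits into the cube, and [2 * m + 1 >= t / (2 * c)]
   once [t >= 2 * c]; relative to the side [2 * t] this is the factor [1 / (4 * c)]. *)
exists (d * (4 * c)^-1 ^+ N); first by rewrite mulr_gt0// exprn_gt0// invr_gt0 mulr_gt0.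
near=> t; pose m := (Num.truncn (t / c)).-1.
have t0 : 0 <= t by near: t; apply: nbhs_pinfty_ge; exact: num_real.
have tm0 : m0.+1%:R * c <= t by near: t; apply: nbhs_pinfty_ge; exact: num_real.
have t2 : 2 * c <= t by near: t; apply: nbhs_pinfty_ge; exact: num_real.
have m_ge : (m0 < Num.truncn (t / c))%N.
  by rewrite truncn_ge_nat ?ler_pdivlMr ?divr_ge0// ltW.
have mE : m.+1 = Num.truncn (t / c) by rewrite prednK//; exact: leq_ltn_trans m_ge.
have m_le : m.+1%:R * c <= t by rewrite mE -ler_pdivlMr// truncn_le divr_ge0// ltW.
have m_gt : t / c < m.+2%:R by rewrite mE; exact: truncnS_gt.
have [K Km KQ] : exists2 K : nat,
  (forall k, (k < K)%N -> (sup_norm (v (n k)) <= m)%N) &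
  d * ((2 * m).+1 ^ N)%:R <= K%:R by apply: hd; rewrite /= -ltnS mE.
exists K => [k /Km vm i|].
  apply: le_trans (hc _ _) _; apply: le_trans m_le.
  by rewrite mulrC ler_pM2r// ler_nat.
apply: le_trans KQ; rewrite -mulrA ler_pM2l// natrX /cube_vol -exprMn.
rewrite lerXn2r ?nnegrE//.
  by rewrite mulr_ge0 ?invr_ge0 ?mulr_ge0// ltW.
have -> : (4 * c)^-1 * (2 * t) = (t / c) / 2 by field; rewrite lt0r_neq0.
have tc2 : 2 <= t / c by rewrite ler_pdivlMr.
have mm : m.+2%:R = m%:R + 2 :> R by rewrite -addn2 natrD.
have m2 : (2 * m).+1%:R = 2 * m%:R + 1 :> R by rewrite -addn1 natrD natrM.
have m_ge0 : 0 <= m%:R :> R by [].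
by rewrite m2; move: m_gt; rewrite mm; lra.
Unshelve. all: by end_near.
Qed.

Context (A_GL : A \in unitmx) (cps : cut_and_project A).

Lemma lift_index_inj : injective (fun k => (lift_pt A (v (n k))).1).
Proof.
move=> j k /(lift_pt1_inj A_GL cps) /(bij_inj v_numbering.1) njk.
have [[n_mono _] _ _ _] := n_eps_admissible.
by have [/n_mono|/n_mono|//] := ltngtP j k; rewrite njk ltnn.
Qed.

Lemma upper_density_gt0 :
  (0 < upper_density [set (lift_pt A (v (n k))).1 | k in [set: nat]])%E.
Proof.
have [c c0 hc] := cube_points.
apply: (@lt_le_trans _ _ c%:E); first by rewrite lte_fin.
apply: limf_esup_ge; near=> t.
have t0 : 0 < t by near: t; apply: nbhs_pinfty_gt; exact: num_real.
have V0 : 0 < cube_vol (N := N) t by rewrite /cube_vol exprn_gt0// mulr_gt0.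
have [K Kt KV] : exists2 K : nat,
  (forall k, (k < K)%N -> cube t (lift_pt A (v (n k))).1) &
  c * cube_vol (N := N) t <= K%:R by near: t.
rewrite lee_pdivlMr// -EFinM; apply: (@le_trans _ _ K%:R%:E); first by rewrite lee_fin.
have g_inj : injective (fun k : 'I_K => (lift_pt A (v (n k))).1).
  by move=> j k /lift_index_inj; exact: val_inj.
rewrite -[K in K%:R]card_ord; apply: (counting_ge g_inj) => k.
by split; [exists (val k)|exact: Kt].
Unshelve. all: by end_near.
Qed.

End Growth.

(** * Entropy *)

Section Entropy.
Context {R : realType} {N : nat}.

Lemma closedSet_dist_le2 (G H : closedSet R N) : mdist G H <= 2.
Proof.
apply: hausdorff_le => [||p Gp|p Hp]; try exact: compactify_neq0;
  apply: dist_to_ub (compactify_sphere (L := _)) (compactify_sphere (L := _)) (compactify_neq0 _) _;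
  eassumption.
Qed.

(** The [2 ^ K] patterns indexed by subsets are [e]-separated and [K] grows at least like [c] times
    the volume, so the entropy is at least [c * ln 2]. *)
Lemma entropy_ge (L : set 'cV[R]_N) (e c : R) : 0 < e -> 0 < c ->
  (\forall t \near +oo, exists2 K : nat, c * cube_vol (N := N) t <= K%:R &
    exists g : {set 'I_K} -> hullSpace L,
      forall Q Q', Q != Q' -> exists2 s, cube t s &
        e <= mdist (hull_act s (g Q)) (hull_act s (g Q'))) ->
  (0 < topological_entropy (@hull_act R N L))%E.
Proof.
move=> e0 c0 ht.
have l2 : 0 < ln 2 :> R by rewrite ln_gt0// ltr1n.
apply: (@lt_le_trans _ _ (c * ln 2)%:E); first by rewrite lte_fin mulr_gt0.
apply: le_ereal_sup_tmp; eexists; first by exists e.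
apply: limf_esup_ge; near=> t.
have t0 : 0 < t by near: t; apply: nbhs_pinfty_gt; exact: num_real.
have V0 : 0 < cube_vol (N := N) t by rewrite /cube_vol exprn_gt0// mulr_gt0.
have [K KV [g gsep]] : exists2 K : nat, c * cube_vol (N := N) t <= K%:R &
    exists g : {set 'I_K} -> hullSpace L,
      forall Q Q', Q != Q' -> exists2 s, cube t s &
        e <= mdist (hull_act s (g Q)) (hull_act s (g Q')) by near: t.
have g_inj : injective g.
  move=> Q Q' gQ; apply/eqP; apply: contraT => /gsep[s _].
  by rewrite gQ mdistxx leNgt e0.
have sepY : Defs.separated (@hull_act R N L) e t (range g).
  move=> _ _ [Q _ <-] [Q' _ <-] QQ'.
  have [|s st hs] := gsep Q Q'; first by apply/eqP => h; apply: QQ'; rewrite h.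
  apply: le_trans hs _; apply: ub_le_sup; last by exists s.
  by exists 2 => _ [s' _ <-]; exact: closedSet_dist_le2.
have sepK : ((2 ^ K)%:R%:E <= sep_number (@hull_act R N L) e t)%E.
  apply: (@le_trans _ _ (counting (range g))); last first.
    by apply: ereal_sup_ubound; exists (range g).
  have -> : (2 ^ K = #|{set 'I_K}|)%N by rewrite -cardsT -powersetT card_powerset cardsT card_ord.
  by apply: (counting_ge g_inj) => Q; exists Q.
rewrite lee_pdivlMr// -EFinM; apply: (@le_trans _ _ (K%:R * ln 2)%:E).
  by rewrite lee_fin mulrAC ler_pM2r.
have K2 : 0 < (2 ^ K)%:R :> R by rewrite ltr0n expn_gt0.
have -> : (K%:R * ln 2)%:E = lne (2 ^ K)%:R%:E :> \bar R.
  by rewrite lne_EFin// natrX lnXn// mulr_natl.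
have K0 : (0 <= (2 ^ K)%:R%:E :> \bar R)%E by rewrite lee_fin ltW.
by rewrite lee_lne// in_itv /= leey andbT// (le_trans K0).
Unshelve. all: by end_near.
Qed.

Context (A : 'M[R]_(N + 1)).
Context (v : nat -> 'cV[int]_N) (n : nat -> nat) (eps : nat -> R).
Context (C : set R) (B : nat -> set R) (N_gt0 : (0 < N)%N).
Context (A_GL : A \in unitmx) (cps : cut_and_project A) (A_normalized : normalized A).
Context (v_numbering : numbering v) (n_eps_admissible : admissible A v n eps).
Context (B_gaps : gap_family C B).
Local Notation W := (window (Iint A v n eps) B).
Local Notation pt k := (lift_pt A (v (n k))).
Context (theta : R).
Local Notation L := (curlywedge A (shiftR theta W)).

(** If two patterns differ at [pt i], translate that point to 0. Were the translates closer than
    [e], the second pattern would have a point within [r] of [pt i]; both patterns lie in the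
    [r]-discrete set [curlywedge A W], so that point would be [pt i]. *)
Lemma window_entropy_gt0 : (0 < topological_entropy (@hull_act R N L))%E.
Proof.
have W01 : W `<=` `[0, 1] := construction_window_sub n_eps_admissible.
have cW : closed W := construction_window_closed n_eps_admissible.
have [r r0 hr] := curlywedge_uniformly_discrete A_GL W01.
have [e e0 he] := @closedSet_dist_near_pt R N 0 r (lexx _) r0.
have [c c0 hc] := cube_points A_normalized N_gt0 v_numbering n_eps_admissible.
apply: (entropy_ge e0 c0); apply: filterS hc => t [K Kt KV]; exists K => //.
pose idx (Q : {set 'I_K}) : set nat := [set k : nat | exists2 i : 'I_K, i \in Q & k = i :> nat].
have /choice[g hg] Q := fullshift_ex A_GL cps n_eps_admissible B_gaps theta (idx Q).
exists g => Q Q' QQ'.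
have gW Q1 : hull_pts (g Q1) `<=` curlywedge A W.
  by have [vg _ _] := hg Q1; exact: (vertical_limit_sub A_GL cps W01 cW).
have gP (Q1 : {set 'I_K}) (i : 'I_K) : hull_pts (g Q1) (pt i).1 <-> i \in Q1.
  have [_ /(_ i) -> _] := hg Q1; split=> [[j jQ /val_inj ->]//|iQ]; by exists i.
have main (Q1 Q2 : {set 'I_K}) (i : 'I_K) : i \in Q1 -> i \notin Q2 ->
    e <= mdist (hull_act (pt i).1 (g Q1)) (hull_act (pt i).1 (g Q2)).
  move=> /gP g1 /negP nQ2; rewrite leNgt; apply/negP => lt_e.
  have n0 : enorm (0 : 'cV[R]_N) <= 0 by rewrite enorm0.
  have h0 : pts (hull_val (hull_act (pt i).1 (g Q1))) 0.
    by exists (pt i).1; [exact: g1|exact: subrr].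
  have [w [y g2 yw]] := he _ _ 0 n0 h0 lt_e.
  rewrite -yw sub0r enormN => yr.
  have := hr y (pt i).1 (gW _ _ g2) (gW _ _ g1).
  rewrite leNgt yr => hy; have // : false.
  by apply: hy => yE; apply: nQ2; apply/gP; rewrite -yE.
have [i iQ] : exists i, (i \in Q) != (i \in Q').
  apply/existsP; apply: contraNT QQ' => /existsPn h.
  by apply/eqP/setP => i; have := h i; rewrite negbK => /eqP.
exists (pt i).1; first exact: Kt.
have [iQ1|iQ1] := boolP (i \in Q).
  by apply: main => //; move: iQ; rewrite iQ1; case: (i \in Q').
rewrite metric_sym; apply: main => //.
by move: iQ; rewrite (negbTE iQ1); case: (i \in Q').
Qed.

End Entropy.

(** * Failure of unique ergodicity *)

Lemma bernoulli_le {R : realFieldType} (x : R) k : 0 <= x <= 1 -> 1 - k%:R * x <= (1 - x) ^+ k.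
Proof.
move=> /andP[x0 x1]; elim: k => [|k ih]; first by rewrite mul0r subr0 expr0.
have kx : 0 <= k%:R * x by rewrite mulr_ge0.
rewrite exprS -natr1; apply: le_trans (ler_wpM2l _ ih); last by rewrite subr_ge0.
by have := mulr_ge0 x0 kx; lra.
Qed.

Lemma mulmx_enorm_le {R : realType} {N : nat} (M : 'M[R]_N) : exists2 c : R, 0 < c &
  forall (y : 'cV[R]_N) b, 0 <= b -> (forall j, `|y j 0| <= b) -> enorm (M *m y) <= c * b.
Proof.
pose s := \sum_i \sum_j `|M i j|.
have s0 : 0 <= s by rewrite sumr_ge0// => i _; rewrite sumr_ge0.
exists (N%:R * s + 1) => [|y b b0 yb]; first by rewrite ltr_wpDl// mulr_ge0.
apply: (@le_trans _ _ (N%:R * (s * b))); last by rewrite mulrDl mulrA lerDl mul1r.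
apply: enorm_le_coord => i; apply: (@le_trans _ _ ((\sum_j `|M i j|) * b)).
  rewrite mxE mulr_suml; apply: le_trans (ler_norm_sum _ _ _) _.
  by apply: ler_sum => j _; rewrite normrM ler_wpM2l.
rewrite ler_wpM2r// /s [leRHS](bigD1 i)//= lerDl.
by rewrite sumr_ge0// => k _; rewrite sumr_ge0.
Qed.

(** * Dyadic grids that refine and grow at once *)

Section DyadicBoxes.
Context {R : realType} {N : nat} (M : 'M[R]_N) (M_unit : M \in unitmx).
Local Notation V := 'cV[R]_N.

(** Mesh [2^-q] on a box of half side [2^q], so the integer coordinates run up to [2^q * 2^q].
    Nested meshes give a dense set of translations, growing boxes the Folner property. *)
Definition dyadic_box (q : nat) : finType := {ffun 'I_N -> 'I_(2 * (2 ^ q * 2 ^ q)).+1}.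

Definition dyadic (q : nat) (z : 'cV[int]_N) : V := M *m ((2 ^+ q)^-1 *: map_mx intr z).

Definition dyadic_pt (q : nat) (f : dyadic_box q) : V := dyadic q (box_vec f).

Lemma card_dyadic_box q : #|dyadic_box q| = ((2 * (2 ^ q * 2 ^ q)).+1 ^ N)%N.
Proof. exact: card_box. Qed.

Lemma enorm_le_chart : exists2 c : R, 0 < c & forall (x y : V) b, 0 <= b ->
  (forall i, `|(invmx M *m x) i 0 - (invmx M *m y) i 0| <= b) -> enorm (x - y) <= c * b.
Proof.
have [c c0 hc] := mulmx_enorm_le M; exists c => // x y b b0 h.
rewrite -[x - y](mulKVmx M_unit); apply: hc => // i.
by have := h i; rewrite mulmxBr !mxE.
Qed.

Lemma pow2_gt0 q : 0 < 2 ^+ q :> R. Proof. by rewrite exprn_gt0. Qed.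

Lemma dyadicD q z w : dyadic q (z + w) = dyadic q z + dyadic q w.
Proof. by rewrite /dyadic map_mxD scalerDr mulmxDr. Qed.

Lemma dyadic_inj q : injective (dyadic q).
Proof.
move=> z w /(congr1 (mulmx (invmx M))); rewrite !mulKmx// => /colP zw.
apply/colP => i; have := zw i; rewrite !mxE => h.
by move: h => /mulfI; rewrite invr_eq0 expf_neq0// => /(_ isT) /intr_inj.
Qed.

Lemma dyadic_pt_inj q : injective (@dyadic_pt q).
Proof. by move=> f g /dyadic_inj/box_vec_inj. Qed.

Lemma dyadicS q k z : dyadic q z = dyadic (k + q) (z *+ 2 ^ k).
Proof.
rewrite /dyadic; congr (_ *m _); apply/colP => i; rewrite !mxE exprD invfM.
by rewrite mulmxnE rmorphMn/= -[_ *+ (2 ^ k)]mulr_natl natrX mulrACA mulVf ?mul1r//.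
Qed.

Lemma dyadic_dense s e : 0 < e -> exists2 d, (exists q z, d = dyadic q z) & enorm (s - d) < e.
Proof.
move=> e0; have [c c0 hc] := mulmx_enorm_le M.
have ec : 0 < e / c by rewrite divr_gt0.
have [q _ hq] := near_infty_natSinv_lt (PosNum ec).
pose y := invmx M *m s; pose z := \col_i Num.floor (2 ^+ q * y i 0) : 'cV[int]_N.
exists (dyadic q z); first by exists q, z.
have -> : s - dyadic q z = M *m (y - (2 ^+ q)^-1 *: map_mx intr z).
  by rewrite mulmxBr mulKVmx.
have q0 := pow2_gt0 q; have b0 : 0 <= (2 ^+ q)^-1 :> R by rewrite invr_ge0 ltW.
apply: le_lt_trans (hc _ _ b0 _) _ => [i|].
  have -> : (y - (2 ^+ q)^-1 *: map_mx intr z) i 0 =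
    y i 0 - (2 ^+ q)^-1 * (Num.floor (2 ^+ q * y i 0))%:~R by rewrite !mxE.
  have := floor_itv (2 ^+ q * y i 0); rewrite intrD1.
  set w := (Num.floor _)%:~R => /andP[w1 w2].
  have -> : y i 0 - (2 ^+ q)^-1 * w = (2 ^+ q)^-1 * (2 ^+ q * y i 0 - w).
    by field; rewrite lt0r_neq0.
  rewrite normrM ger0_norm// ler_piMr//.
  by rewrite ler_norml; apply/andP; split; lra.
rewrite mulrC -ltr_pdivlMr//; apply: le_lt_trans (hq q (leqnn q)).
by rewrite lef_pV2 ?posrE// -natrX ler_nat ltn_expl.
Qed.

(** In the grid of level [q] the vector [d] has integer norm at most [2^q * s0], against a radius of
    [4^q]. With [x = s0 / 2^q], at least the fraction [(1 - x)^N] of the box stays inside, so at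
    most [N * x] leaves it. *)
Lemma dyadic_folner d : (exists q z, d = dyadic q z) ->
  #|[pred f : dyadic_box q | ~~ [exists g : dyadic_box q, dyadic_pt g == dyadic_pt f + d]]|%:R /
    #|dyadic_box q|%:R @[q --> \oo] --> (0 : R).
Proof.
move=> [q0 [z0 ->]]; set s0 := sup_norm z0.
have lim0 : N%:R * s0%:R * (2^-1 : R) ^+ q @[q --> \oo] --> (0 : R).
  rewrite -(mulr0 (N%:R * s0%:R)); apply: cvgMr; apply: cvg_expr.
  by rewrite ger0_norm ?invr_ge0// invf_lt1 ?ltr1n.
apply: (squeeze_cvgr _ (cvg_cst 0) lim0); near=> q.
rewrite divr_ge0//=.
have qq0 : (q0 <= q)%N by near: q; exists q0.
have s0q : (s0 <= 2 ^ q)%N.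
  by apply: leq_trans (ltnW (ltn_expl q (ltnSn 1))); near: q; exists s0.
set p := (2 ^ q)%N in s0q *; have p0 : (0 < p)%N by rewrite expn_gt0.
pose z1 := z0 *+ 2 ^ (q - q0).
have dE : dyadic q0 z0 = dyadic q z1 by rewrite (dyadicS q0 (q - q0)) subnK.
have z1s : (sup_norm z1 <= p * s0)%N.
  apply/sup_normP => i; rewrite mulmxnE.
  have := iffLR (sup_normP z0 _) (leqnn _) i; rewrite -/s0 => h.
  rewrite -mulr_natr abszM natz /= mulnC leq_mul//.
  by rewrite leq_exp2l// leq_subr.
have sp : (p * s0 <= p * p)%N by rewrite leq_mul2l s0q orbT.
pose g (h : {ffun 'I_N -> 'I_(2 * (p * p - p * s0)).+1}) : dyadic_box q :=
  vec_box (p * p) (box_vec h).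
have gK h : box_vec (g h) = box_vec h.
  by apply: vec_boxK; apply: leq_trans (box_vec_norm h) _; exact: leq_subr.
have g_inj : injective g by move=> h h' /(congr1 (@box_vec _ _)); rewrite !gK => /box_vec_inj.
set Q := [pred f : dyadic_box q | _].
have gQ h : g h \in [predC Q].
  rewrite !inE negbK; apply/existsP; exists (vec_box (p * p) (box_vec h + z1)).
  rewrite /dyadic_pt dE vec_boxK; first by rewrite gK dyadicD.
  apply/sup_normP => i; rewrite mxE.
  have h1 := iffLR (sup_normP _ _) (box_vec_norm h) i.
  have h2 := iffLR (sup_normP _ _) z1s i.
  by move: h1 h2 sp; move: (p * p)%N (p * s0)%N (box_vec h i 0) (z1 i 0); clear; lia.
have card_good : ((2 * (p * p - p * s0)).+1 ^ N <= #|[predC Q]|)%N.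
  rewrite -(card_box (N := N) (p * p - p * s0)) -(card_codom g_inj).
  by apply: subset_leq_card; apply/fintype.subsetP => _ /codomP[h ->].
have T0 : 0 < #|dyadic_box q|%:R :> R by rewrite card_dyadic_box ltr0n expn_gt0.
rewrite ler_pdivrMr//.
have cQ : (#|Q| + #|[predC Q]|)%N = #|dyadic_box q| by rewrite cardC.
have : #|Q|%:R + #|[predC Q]|%:R = #|dyadic_box q|%:R :> R by rewrite -natrD cQ.
move: card_good; rewrite -(ler_nat R) natrX.
rewrite card_dyadic_box -/p natrX; set D := (2 * (p * p)).+1%:R : R.
have D0 : 0 < D by rewrite ltr0n.
set x := s0%:R * (2^-1) ^+ q : R => hC hE.
have x0 : 0 <= x by rewrite mulr_ge0// exprn_ge0// invr_ge0.
have pR : p%:R = 2 ^+ q :> R by rewrite natrX.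
have p0R : 0 < p%:R :> R by rewrite ltr0n.
have xE : x = s0%:R / p%:R by rewrite /x exprVn pR.
have x1 : x <= 1 by rewrite xE ler_pdivrMr// mul1r ler_nat.
have Dx : (1 - x) * D <= (2 * (p * p - p * s0)).+1%:R.
  rewrite /D -!natr1 !natrM natrB// !natrM xE.
  have -> : (1 - s0%:R / p%:R) * (2 * (p%:R * p%:R) + 1) =
    2 * (p%:R * p%:R - p%:R * s0%:R) + 1 - s0%:R / p%:R :> R by field; rewrite lt0r_neq0.
  by rewrite gerBl -xE.
have Dx' : (1 - x) ^+ N * D ^+ N <= #|[predC Q]|%:R.
  apply: le_trans hC; rewrite -exprMn lerXn2r// nnegrE ?mulr_ge0 ?subr_ge0// ltW//.
have x01 : 0 <= x <= 1 by rewrite x0.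
have := bernoulli_le N x01; rewrite -(ler_pM2r (exprn_gt0 N D0)).
by rewrite mulrBl mul1r -mulrA -/x; lra.
Unshelve. all: by end_near.
Qed.

End DyadicBoxes.

(** * Patterns that meet a small box, and how often an orbit visits them *)

Section HitSets.
Context {R : realType} {N : nat} (M : 'M[R]_N) (M_unit : M \in unitmx) (L : set 'cV[R]_N).
Local Notation V := 'cV[R]_N.
Local Notation X := (hullSpace L).
Implicit Types G : X.

Definition hit (a : R) : set X :=
  [set G | exists2 y, hull_pts G y & forall i, `|(invmx M *m y) i 0| <= a].

Definition hit_interior (a : R) : set X :=
  [set G | exists2 y, hull_pts G y & forall i, `|(invmx M *m y) i 0| < a].

Lemma hit_interior_sub a : hit_interior a `<=` hit a.
Proof. by move=> G [y Gy ya]; exists y => // i; apply: ltW. Qed.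

Let chart_lipschitz : exists2 c : R, 0 < c & forall (y w : V) i,
  `|(invmx M *m y) i 0| <= `|(invmx M *m w) i 0| + c * enorm (w - y).
Proof.
have [c c0 hc] := mulmx_enorm_le (invmx M); exists c => // y w i.
have -> : invmx M *m y = invmx M *m w - invmx M *m (w - y).
  by rewrite mulmxBr opprB [RHS]addrC subrK.
rewrite mxE; apply: le_trans (ler_normD _ _) _; rewrite [X in _ + `|X|]mxE normrN lerD2l.
apply: le_trans (enorm_coord _ _) _; apply: hc; first exact: enorm_ge0.
by move=> j; exact: enorm_coord.
Qed.

Lemma hit_near a a' G : a < a' -> exists2 e, 0 < e &
  forall H, hit a H -> mdist H G < e -> hit_interior a' G.
Proof.
move=> aa'; have [c c0 hc] := chart_lipschitz.
have [k k0 hk] := mulmx_enorm_le M.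
have T0 : 0 <= k * `|a| by rewrite mulr_ge0// ltW.
have d0 : 0 < (a' - a) / c by rewrite divr_gt0// subr_gt0.
have [e e0 he] := @closedSet_dist_near_pt R N _ _ T0 d0; exists e => // H [y Hy ya] HG.
have yT : enorm y <= k * `|a|.
  rewrite -[y](mulKVmx M_unit); apply: hk => // i.
  by apply: le_trans (ya i) (ler_norm _).
have [w Gw yw] := he _ _ y yT Hy HG; exists w => // i.
apply: le_lt_trans (hc w y i) _; move: yw; rewrite ltr_pdivlMr// mulrC => yw.
by have := ya i; lra.
Qed.

(** This places a closed set and an open set between [hit a] and [hit a'], as the one-sided bounds
    of [orbit_measure] require. *)
Lemma closure_hit a a' : a < a' -> closure (hit a) `<=` hit_interior a'.
Proof.
move=> aa' G clG; have [e e0 he] := hit_near G aa'.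
have [H [aH GH]] := clG _ (nbhsx_ballx G _ e0).
by apply: he aH _; rewrite metric_sym; move: GH; rewrite ballEmdist.
Qed.

Lemma hit_interior_open a : open (hit_interior a).
Proof.
rewrite openE => G [y Gy ya].
have [b yb ba] : exists2 b, forall i, `|(invmx M *m y) i 0| <= b & b < a.
  (* The start value [a - 1] keeps the maximum strictly below [a]. *)
  exists (\big[Order.max/(a - 1)]_i `|(invmx M *m y) i 0|).
    by move=> i; exact: le_bigmax.
  by apply/bigmax_ltP; rewrite ltrBlDr ltrDl ltr01; split.
have [c c0 hc] := chart_lipschitz.
have d0 : 0 < (a - b) / c by rewrite divr_gt0// subr_gt0.
have [e e0 he] := @closedSet_dist_near_pt R N _ _ (enorm_ge0 y) d0.
apply/nbhs_ballP; exists e => //= H; rewrite ballEmdist => GH.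
have [w Hw yw] := he _ (hull_val H) y (lexx _) Gy GH; exists w => // i.
apply: le_lt_trans (hc w y i) _; move: yw; rewrite ltr_pdivlMr// mulrC => yw.
by have := yb i; lra.
Qed.

Lemma hit_dyadic a q z G : hit a (hull_act (dyadic M q z) G) <->
  exists2 y, hull_pts G y &
    forall i, `|2 ^+ q * (invmx M *m y) i 0 - (z i 0)%:~R| <= a * 2 ^+ q.
Proof.
have q0 := pow2_gt0 (R := R) q.
have E (y : V) i : `|(invmx M *m (y - dyadic M q z)) i 0| <= a <->
    `|2 ^+ q * (invmx M *m y) i 0 - (z i 0)%:~R| <= a * 2 ^+ q.
  rewrite mulmxBr mulKmx//.
  have -> : (invmx M *m y - (2 ^+ q)^-1 *: map_mx intr z) i 0 =
    (2 ^+ q)^-1 * (2 ^+ q * (invmx M *m y) i 0 - (z i 0)%:~R).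
    by rewrite mulrBr mulKf ?lt0r_neq0// !mxE.
  by rewrite normrM gtr0_norm ?invr_gt0// ler_pdivrMl// (mulrC a).
split=> [[_ [y Gy <-] ya]|[y Gy ya]].
  by exists y => // i; exact: (iffLR (E y i) (ya i)).
by exists (y - dyadic M q z); [exists y|move=> i; exact: (iffRL (E y i) (ya i))].
Qed.

(** Each point [g k] is seen by at least [n0 ^ N] grid vectors, [n0] consecutive integers in every
    coordinate; the separation by more than [2 * a] keeps the families of different [k] disjoint. *)
Lemma hit_count_ge a q G K n0 (g : 'I_K -> V) :
  (forall k, hull_pts G (g k)) ->
  (forall k i, `|(invmx M *m g k) i 0| + a <= 2 ^+ q) ->
  (forall k k', (forall i, `|(invmx M *m g k) i 0 - (invmx M *m g k') i 0| <= 2 * a) -> k = k') ->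
  n0%:R <= 2 * a * 2 ^+ q ->
  (K * n0 ^ N <= #|[pred f : dyadic_box (N := N) q | `[< hit a (hull_act (dyadic_pt M f) G) >]]|)%N.
Proof.
move=> Gg gq g_sep n0a; have q0 := pow2_gt0 (R := R) q.
pose u k i : R := (invmx M *m g k) i 0.
pose z k (w : {ffun 'I_N -> 'I_n0}) : 'cV[int]_N :=
  \col_i (Num.ceil (2 ^+ q * (u k i - a)) + (w i)%:Z).
have z_near k w i : `|2 ^+ q * u k i - (z k w i 0)%:~R| <= a * 2 ^+ q.
  have -> : (z k w i 0)%:~R = (Num.ceil (2 ^+ q * (u k i - a)))%:~R + (w i)%:R :> R.
    by rewrite mxE intrD.
  have := ceil_itv (2 ^+ q * (u k i - a)); rewrite intrB.
  have : (w i).+1%:R <= n0%:R :> R by rewrite ler_nat.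
  rewrite -natr1; have : 0 <= (w i)%:R :> R by [].
  set c := (Num.ceil _)%:~R => w0 wn /andP[c1 c2].
  by rewrite ler_norml; apply/andP; split; lra.
have z_norm k w : (sup_norm (z k w) <= 2 ^ q * 2 ^ q)%N.
  apply/sup_normP => i; rewrite -(ler_nat R) natr_absz intr_norm natrM natrX.
  have -> : (z k w i 0)%:~R = 2 ^+ q * u k i - (2 ^+ q * u k i - (z k w i 0)%:~R).
    by rewrite opprB addrC subrK.
  apply: le_trans (ler_normB _ _) _; rewrite normrM gtr0_norm//.
  apply: le_trans (lerD (lexx _) (z_near k w i)) _.
  by rewrite (mulrC a) -mulrDr ler_pM2l//; exact: gq.
pose F (kw : 'I_K * {ffun 'I_N -> 'I_n0}) : dyadic_box q :=
  vec_box (2 ^ q * 2 ^ q) (z kw.1 kw.2).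
have FK kw : box_vec (F kw) = z kw.1 kw.2 by exact: vec_boxK.
have F_inj : injective F.
  move=> [k w] [k' w'] /(congr1 (@box_vec _ _)); rewrite !FK /= => zz.
  have kk' : k = k'.
    apply: g_sep => i; have := z_near k w i; have := z_near k' w' i.
    rewrite zz -/(u k i) -/(u k' i) => h h'.
    rewrite -(ler_pM2l q0) -[X in X * `|_|]gtr0_norm// -normrM.
    have -> : 2 ^+ q * (u k i - u k' i) = (2 ^+ q * u k i - (z k' w' i 0)%:~R) -
      (2 ^+ q * u k' i - (z k' w' i 0)%:~R) by ring.
    by apply: le_trans (ler_normB _ _) _; lra.
  subst k'; congr pair; apply/ffunP => i; apply/val_inj => /=.
  by have /colP/(_ i) := zz; rewrite !mxE => /addrI [].
have -> : (K * n0 ^ N = #|{: 'I_K * {ffun 'I_N -> 'I_n0}}|)%N.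
  by rewrite card_prod card_ffun !card_ord.
rewrite -(card_codom F_inj); apply: subset_leq_card.
apply/fintype.subsetP => _ /codomP[kw ->]; rewrite inE.
apply/asboolP/asboolP; apply: (iffRL (@hit_dyadic a q (box_vec (F kw)) G)).
by exists (g kw.1) => // i; rewrite FK; exact: z_near.
Qed.

(** A grid vector is determined by a point that it sees and by its offset from the corner of the box
    around that point; each coordinate of the offset takes at most [n1 + 1] values. *)
Lemma hit_count_le a q G n1 (J : finType) (h : J -> V) :
  (forall y, hull_pts G y -> (forall i, `|(invmx M *m y) i 0| <= 2 ^+ q + a) ->
    exists j, h j = y) ->
  2 * a * 2 ^+ q < n1.+1%:R ->
  (#|[pred f : dyadic_box (N := N) q | `[< hit a (hull_act (dyadic_pt M f) G) >]]|
    <= #|J| * n1.+1 ^ N)%N.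
Proof.
move=> hG an1; have q0 := pow2_gt0 (R := R) q.
set Q := [pred f | _].
pose u j i : R := (invmx M *m h j) i 0.
have near_j (f : dyadic_box (N := N) q) : f \in Q -> exists j, forall i,
    `|2 ^+ q * u j i - (box_vec f i 0)%:~R| <= a * 2 ^+ q.
  rewrite inE => /asboolP/asboolP hf; have [y Gy yf] := iffLR (@hit_dyadic a q (box_vec f) G) hf.
  have [i|j hj] := hG y Gy; last by exists j => i; rewrite /u hj.
  rewrite -(ler_pM2l q0) -[X in X * `|_|]gtr0_norm// -normrM.
  have -> : 2 ^+ q * (invmx M *m y) i 0 = (box_vec f i 0)%:~R +
    (2 ^+ q * (invmx M *m y) i 0 - (box_vec f i 0)%:~R) by rewrite addrC subrK.
  apply: le_trans (ler_normD _ _) _; rewrite mulrDr (mulrC _ a); apply: lerD => //.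
  rewrite -intr_norm -natr_absz -natrX -natrM ler_nat.
  exact: (iffLR (sup_normP _ _) (box_vec_norm f)).
have [f0|/pred0Pn[f fQ]] := eqVneq #|Q| 0%N; first by rewrite f0.
have [j0 _] := near_j f fQ.
pose nearb (f : dyadic_box (N := N) q) j :=
  [forall i, `|2 ^+ q * u j i - (box_vec f i 0)%:~R| <= a * 2 ^+ q].
pose jj (f : dyadic_box (N := N) q) : J := odflt j0 [pick j | nearb f j].
have jjP f' : f' \in Q -> nearb f' (jj f').
  move=> /near_j[j hj]; rewrite /jj; case: pickP => //= /(_ j) /negP[].
  exact/forallP.
pose z (f : dyadic_box (N := N) q) i : int :=
  box_vec f i 0 - Num.ceil (2 ^+ q * (u (jj f) i - a)).
have z_itv f' i : f' \in Q -> 0 <= z f' i < n1.+1.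
  move=> /jjP/forallP/(_ i); rewrite ler_norml => /andP[h1 h2].
  have := ceil_itv (2 ^+ q * (u (jj f') i - a)); rewrite intrB => /andP[c1 c2].
  have : (-1)%:~R < (z f' i)%:~R :> R by rewrite /z intrB; lra.
  have : (z f' i)%:~R < (n1.+1%:Z)%:~R :> R.
    by rewrite /z intrB -[(n1.+1%:Z)%:~R]/(n1.+1%:R); lra.
  by rewrite !ltr_int; lia.
pose F (f : dyadic_box (N := N) q) : J * {ffun 'I_N -> 'I_n1.+1} :=
  (jj f, [ffun i => inord (absz (z f i))]).
rewrite -(@card_in_image _ _ F Q) => [|f1 f2 f1Q f2Q [jf /ffunP zf]]; last first.
  apply/box_vec_inj/colP => i; have := zf i; rewrite !ffunE => /(congr1 val).
  have /andP[h1 h2] := z_itv f1 i f1Q; have /andP[h3 h4] := z_itv f2 i f2Q.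
  rewrite /= !inordK; try lia.
  move=> zz; have : z f1 i = z f2 i by lia.
  by rewrite /z jf => /addIr.
apply: leq_trans (max_card _) _.
by rewrite card_prod card_ffun !card_ord.
Qed.

End HitSets.

(** * Two orbits with different visit frequencies *)

Section NotUniquelyErgodic.
Context {R : realType} {N : nat} (A : 'M[R]_(N + 1)).
Context (v : nat -> 'cV[int]_N) (n : nat -> nat) (eps : nat -> R).
Context (C : set R) (B : nat -> set R) (N_gt0 : (0 < N)%N).
Context (A_GL : A \in unitmx) (cps : cut_and_project A) (A_normalized : normalized A).
Context (v_numbering : numbering v) (n_eps_admissible : admissible A v n eps).
Context (B_gaps : gap_family C B).
Local Notation W := (window (Iint A v n eps) B).
Local Notation pt k := (lift_pt A (v (n k))).
Context (theta : R).
Local Notation L := (curlywedge A (shiftR theta W)).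
Local Notation X := (hullSpace L).
Local Notation M := (schur A).
Implicit Types G : X.

Let M_unit : M \in unitmx. Proof. exact: schur_unit. Qed.

(** In the chart [invmx M] the point [l_z] differs from [z] by its height, which is below 1, times a
    fixed vector. *)
Lemma lift_chart : exists b : nat, forall z i,
  `|(invmx M *m (lift_pt A z).1) i 0 - (z i 0)%:~R| <= b%:R.
Proof.
pose c := \sum_i `|(invmx M *m ursubmx A) i 0|.
exists (Num.truncn c).+1 => z i.
rewrite (lift_pt1 A_normalized) mulmxDr mulKmx// -scalemxAr.
set w := invmx M *m ursubmx A in c *.
rewrite [(_ + _ *: w) i 0]mxE [(_ *: w) i 0]mxE [(map_mx _ _) i 0]mxE.
rewrite addrAC subrr add0r normrM.
have /andP[h0 h1] := lift_pt_itv A_normalized z.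
apply: (@le_trans _ _ c); last by apply/ltW/truncnS_gt.
apply: (@le_trans _ _ `|w i 0|).
  by rewrite ger0_norm// ler_piMl// ltW.
by rewrite /c (bigD1 i)//= lerDl sumr_ge0.
Qed.

Local Notation freq := (frequency (@dyadic_pt R N M)).

(** In the chart the points of [S] have density at least [d] and each is seen from a box of side
    [2 * a]. Taking [rho] below [2 * a] absorbs the rounding and the boundary. *)
Lemma hit_frequency_ge G : (forall k, hull_pts G (pt k).1) ->
    hull_pts G `<=` curlywedge A W ->
  exists2 d, 2^-1 < d & exists2 e, 0 < e & forall a rho, 0 < a < e -> 0 <= rho < 2 * a ->
    \forall q \near \oo, d * rho ^+ N <= freq G q (hit M a).
Proof.
move=> Gpt GW.
have W01 : W `<=` `[0, 1] := construction_window_sub n_eps_admissible.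
have [r r0 hr] := curlywedge_uniformly_discrete A_GL W01.
have [c c0 hc] := enorm_le_chart M_unit.
have [b hb] := lift_chart.
have [d d2 [m0 _ hd]] := index_density N_gt0 v_numbering n_eps_admissible.
exists d => //; have d0 : 0 < d by apply: lt_trans d2; rewrite invr_gt0.
(* Below [r / (2 * c)], points of the pattern within [2 * a] in the chart coincide; below 1, [a]
   fits into the margin [b + 1] by which [m] is smaller than [p]. *)
exists (Num.min 1 (r / (2 * c))); first by rewrite lt_min ltr01 divr_gt0// mulr_gt0.
move=> a rho; rewrite lt_min => /and3P[a0 a1 ar] /andP[rho0 rhoa].
have car : c * (2 * a) < r.
  by move: ar; rewrite ltr_pdivlMr ?mulr_gt0// mulrCA mulrA mulrC.
(* The bound [cst <= 2 p (2 a - rho)] with [p >= 1] gives [rho (2 p^2 + 1) <= (2 p - 2 b - 1) (2 a p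
   - 1)], where [2 p - 2 b - 1 = 2 m + 1] and [2 a p - 1 < n0]. *)
pose cst := 2 + 2 * a * (2 * b%:R + 1) + rho.
near=> q; set p := (2 ^ q)%N; have pR : p%:R = 2 ^+ q :> R by rewrite natrX.
have qp : (q < p)%N by rewrite ltn_expl.
have pm0 : (m0 + b.+1 <= p)%N.
  by apply: leq_trans (ltnW qp); near: q; exists (m0 + b.+1)%N.
have pc : cst / (2 * (2 * a - rho)) <= p%:R.
  apply: (@le_trans _ _ q%:R); last by rewrite ler_nat ltnW.
  near: q; exists (Num.truncn (cst / (2 * (2 * a - rho)))).+1 => // j /= hj.
  apply: (@le_trans _ _ (Num.truncn (cst / (2 * (2 * a - rho)))).+1%:R).
    by apply/ltW/truncnS_gt.
  by rewrite ler_nat.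
have {}pc : cst <= p%:R * (2 * (2 * a - rho)) by rewrite -ler_pdivrMr// mulr_gt0// subr_gt0.
have p1 : 1 <= p%:R :> R by rewrite (ler_nat R 1) expn_gt0.
pose m := (p - b.+1)%N; pose n0 := Num.truncn (2 * a * p%:R).
have ap0 : 0 <= 2 * a * p%:R by rewrite !mulr_ge0// ltW.
have n0_le : n0%:R <= 2 * a * p%:R by rewrite truncn_le.
have n0_gt : 2 * a * p%:R < n0%:R + 1 by rewrite natr1; exact: truncnS_gt.
have mb : (m + b.+1 = p)%N by rewrite subnK//; exact: leq_trans (leq_addl _ _) pm0.
have mR : m%:R + b%:R + 1 = p%:R :> R by rewrite -mb natrD -natr1 addrA.
have [K Km KQ] : exists2 K : nat,
  (forall k, (k < K)%N -> (sup_norm (v (n k)) <= m)%N) &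
  d * ((2 * m).+1 ^ N)%:R <= K%:R.
  by apply: hd; rewrite /= leq_subRL ?(leq_trans (leq_addl _ _) pm0)// addnC.
rewrite /frequency card_dyadic_box -/p ler_pdivlMr ?ltr0n ?expn_gt0//.
clearbody p m n0; have a_ge0 := ltW a0.
apply: le_trans (_ : _ <= (K * n0 ^ N)%:R) _; last first.
rewrite ler_nat.
apply: (@hit_count_ge R N M M_unit L a q G K n0 (fun k : 'I_K => (pt k).1)) =>
  [//|k i|k k' kk'|].
- have := hb (v (n k)) i; have := Km k (ltn_ord k).
  move=> /sup_normP/(_ i); rewrite -(ler_nat R) natr_absz intr_norm => h1 h2.
  have := ler_normD ((v (n k) i 0)%:~R)
    ((invmx M *m (pt k).1) i 0 - (v (n k) i 0)%:~R); rewrite addrC subrK -pR; lra.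
- apply/val_inj/(lift_index_inj v_numbering n_eps_admissible A_GL cps).
  apply: contrapT => ne; have := hr _ _ (GW _ (Gpt k)) (GW _ (Gpt k')) ne.
  rewrite leNgt => /negP; apply.
  exact: le_lt_trans (hc _ _ _ (mulr_ge0 (ler0n _ 2) a_ge0) kk') car.
- by rewrite -pR.
apply: (@le_trans _ _ (d * ((2 * m).+1 ^ N)%:R * (n0 ^ N)%:R)).
  apply: (@le_trans _ _ (d * (rho ^+ N * ((2 * (p * p)).+1 ^ N)%:R))).
    by rewrite mulrA.
  rewrite -!mulrA ler_pM2l// !natrX -!exprMn lerXn2r ?nnegrE ?mulr_ge0//.
  have -> : (2 * (p * p)).+1%:R = 2 * (p%:R * p%:R) + 1 :> R by rewrite -natr1 !natrM.
  have -> : (2 * m).+1%:R = 2 * p%:R - 2 * b%:R - 1 :> R by rewrite -natr1 natrM -mR; ring.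
  have m_ge0 : 0 <= m%:R :> R by [].
  have b_ge0 : 0 <= b%:R :> R by [].
  have s0 : 0 <= 2 * p%:R - 2 * b%:R - 1 :> R by rewrite -mR; lra.
  apply: (@le_trans _ _ ((2 * p%:R - 2 * b%:R - 1) * (2 * a * p%:R - 1))); last first.
    by apply: ler_wpM2l => //; lra.
  have p0 : 0 <= p%:R :> R by [].
  have := ler_wpM2l p0 pc; rewrite /cst => h.
  have h2 : 0 <= rho * (p%:R - 1) by rewrite mulr_ge0// subr_ge0.
  have b0 : 0 <= b%:R :> R by [].
  by rewrite -subr_ge0; move: h h2 b0; set P := p%:R; set bb := b%:R; lra.
rewrite natrM; apply: ler_wpM2r KQ; exact: ler0n.
Unshelve. all: by end_near.
Qed.

(** All points of the pattern are of the form [l_z] and none is in [S], so at most the fraction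
    [1 - d] of the vectors of a box contributes. The bound [d <= 1], obtained from the same count,
    keeps [1 - d] nonnegative. *)
Lemma hit_frequency_le G : (forall k, ~ hull_pts G (pt k).1) ->
    (forall y, hull_pts G y -> exists2 z, (lift_pt A z).1 = y & True) ->
  exists2 d, 2^-1 < d <= 1 & forall a rho, 0 < a <= 1 -> 2 * a < rho ->
    \forall q \near \oo, freq G q (hit M a) <= (1 - d) * rho ^+ N.
Proof.
move=> Gpt Glift; have [b hb] := lift_chart.
have [d d2 [m0 _ hd]] := index_density N_gt0 v_numbering n_eps_admissible.
have d0 : 0 < d by apply: lt_trans d2; rewrite invr_gt0.
have card_rest m K : (forall k, (k < K)%N -> (sup_norm (v (n k)) <= m)%N) ->
    (#|{: {f : {ffun 'I_N -> 'I_(2 * m).+1} | `[< hull_pts G (lift_pt A (box_vec f)).1 >]}}| + K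
      <= (2 * m).+1 ^ N)%N.
  move=> Km; rewrite card_sig -(card_box (N := N) m).
  set P : pred {ffun 'I_N -> 'I_(2 * m).+1} := fun f => _.
  rewrite -(cardC P) leq_add2l.
  pose g (k : 'I_K) : {ffun 'I_N -> 'I_(2 * m).+1} := vec_box m (v (n k)).
  have gK k : box_vec (g k) = v (n k) by apply: vec_boxK; exact: Km.
  have g_inj : injective g.
    move=> j k /(congr1 (@box_vec _ _)); rewrite !gK => vjk; apply: val_inj.
    by apply: (lift_index_inj v_numbering n_eps_admissible A_GL cps); rewrite vjk.
  rewrite -[K in (K <= _)%N]card_ord -(card_codom g_inj); apply: subset_leq_card.
  apply/fintype.subsetP => _ /codomP[k ->]; rewrite inE /=.
  have nP : ~~ P (g k) by rewrite /P gK; apply/negP => /asboolP; exact: Gpt.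
  by move: nP.
have d1 : d <= 1.
  have [K Km KQ] := hd m0 (leqnn m0).
  have := leq_trans (leq_addl _ _) (card_rest m0 K Km); rewrite -(ler_nat R) => KQ'.
  by have := le_trans KQ KQ'; rewrite -[leRHS]mul1r ler_pM2r// ltr0n expn_gt0.
exists d; first by rewrite d2.
move=> a rho /andP[a0 a1] rhoa; pose beta : R := 2 * b%:R + 3.
(* Chosen to yield [(2 p + beta) (2 a p + 1) <= rho (2 p^2 + 1)], where [2 p + beta = 2 m + 1] for
   the enlarged radius [m]. *)
pose cst := 2 + 2 * a * beta + beta.
have s0 : 0 < 2 * (rho - 2 * a) by rewrite mulr_gt0// subr_gt0.
near=> q; have [p pE] : exists p, p = (2 ^ q)%N by exists (2 ^ q)%N.
have pR : p%:R = 2 ^+ q :> R by rewrite pE natrX.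
have qp : (q < p)%N by rewrite pE ltn_expl.
have pm0 : (m0 <= p)%N.
  by apply: leq_trans (ltnW qp); near: q; exists m0.
have pc : cst / (2 * (rho - 2 * a)) <= p%:R.
  apply: (@le_trans _ _ q%:R); last by rewrite ler_nat ltnW.
  near: q; exists (Num.truncn (cst / (2 * (rho - 2 * a)))).+1 => // j /= hj.
  apply: (@le_trans _ _ (Num.truncn (cst / (2 * (rho - 2 * a)))).+1%:R).
    by apply/ltW/truncnS_gt.
  by rewrite ler_nat.
have {}pc : cst <= p%:R * (2 * (rho - 2 * a)) by rewrite -ler_pdivrMr.
have p1 : 1 <= p%:R :> R by rewrite (ler_nat R 1) pE expn_gt0.
have a_ge0 := ltW a0.
have [m mE] : exists m, m = (p + b.+1)%N by exists (p + b.+1)%N.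
have [n1 n1E] : exists n1, n1 = Num.truncn (2 * a * p%:R) by exists (Num.truncn (2 * a * p%:R)).
have ap0 : 0 <= 2 * a * p%:R by rewrite !mulr_ge0.
have n1_le : n1.+1%:R <= 2 * a * p%:R + 1 by rewrite -natr1 lerD2r n1E truncn_le.
have n1_gt : 2 * a * p%:R < n1.+1%:R by rewrite n1E truncnS_gt.
have [K Km KQ] : exists2 K : nat,
  (forall k, (k < K)%N -> (sup_norm (v (n k)) <= m)%N) &
  d * ((2 * m).+1 ^ N)%:R <= K%:R.
  by apply: hd; rewrite /= mE (leq_trans pm0)// leq_addr.
have mR : m%:R = p%:R + b%:R + 1 :> R by rewrite mE natrD -natr1 addrA.
pose J := {f : {ffun 'I_N -> 'I_(2 * m).+1} | `[< hull_pts G (lift_pt A (box_vec f)).1 >]}.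
have hcount : (#|[pred f : dyadic_box (N := N) q | `[< hit M a (hull_act (dyadic_pt M f) G) >]]|
    <= #|{: J}| * n1.+1 ^ N)%N.
  apply: (@hit_count_le R N M M_unit L a q G n1 J (fun j => (lift_pt A (box_vec (val j))).1)).
    move=> y Gy ya; have [z zy _] := Glift y Gy.
    have zm : (sup_norm z <= m)%N.
      apply/sup_normP => i; rewrite -(ler_nat R) natr_absz intr_norm mR.
      have := hb z i; rewrite zy => h1; have h2 := ya i.
      have := ler_normB ((invmx M *m y) i 0) ((invmx M *m y) i 0 - (z i 0)%:~R).
      by rewrite subKr; rewrite -pR in h2; lra.
    have Gz : `[< hull_pts G (lift_pt A (box_vec (vec_box m z))).1 >].
      by apply/asboolP; rewrite vec_boxK// zy.
    exists (exist (fun f : {ffun 'I_N -> 'I_(2 * m).+1} =>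
      `[< hull_pts G (lift_pt A (box_vec f)).1 >]) _ Gz).
    by rewrite /= vec_boxK.
  by rewrite -pR.
rewrite /frequency card_dyadic_box -pE ler_pdivrMr ?ltr0n ?expn_gt0//.
apply: (@le_trans _ _ (#|{: J}| * n1.+1 ^ N)%:R); first by rewrite ler_nat.
have JQ : #|{: J}|%:R <= (1 - d) * ((2 * m).+1 ^ N)%:R.
  have := card_rest m K Km; rewrite -/J -(ler_nat R) natrD; lra.
rewrite natrM; apply: le_trans (ler_wpM2r (ler0n _ _) JQ) _.
rewrite -!mulrA; apply: ler_wpM2l; first by rewrite subr_ge0.
rewrite !natrX -!exprMn lerXn2r ?nnegrE ?mulr_ge0//.
  by apply: le_trans (ltW rhoa); exact: mulr_ge0.
have -> : (2 * (p * p)).+1%:R = 2 * (p%:R * p%:R) + 1 :> R by rewrite -natr1 !natrM.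
have -> : (2 * m).+1%:R = 2 * p%:R + beta :> R by rewrite -natr1 natrM mR /beta; ring.
have b0 : 0 <= b%:R :> R by [].
have beta0 : 0 <= beta by rewrite /beta; lra.
have p0 : 0 <= p%:R :> R by [].
have pb0 : 0 <= 2 * p%:R + beta by lra.
apply: le_trans (ler_wpM2l pb0 n1_le) _.
have := ler_wpM2l p0 pc; rewrite /cst => h.
have h2 : 0 <= beta * (p%:R - 1) by rewrite mulr_ge0// subr_ge0.
have rho0 : 0 <= rho by apply: le_trans (ltW rhoa); exact: mulr_ge0.
rewrite -subr_ge0; move: h h2 rho0; set P := p%:R; set bb := beta; clear.
move=> h h2 rho0.
have -> : rho * (2 * (P * P) + 1) - (2 * P + bb) * (2 * a * P + 1) =
  (P * (P * (2 * (rho - 2 * a))) - P * (2 + 2 * a * bb + bb)) + rho + bb * (P - 1) by ring.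
by rewrite addr_ge0// addr_ge0// subr_ge0.
Unshelve. all: by end_near.
Qed.

Theorem window_not_uniquely_ergodic : ~ uniquely_ergodic (@hull_act R N L).
Proof.
move=> [mu _ mu_uniq].
have W01 : W `<=` `[0, 1] := construction_window_sub n_eps_admissible.
have cW : closed W := construction_window_closed n_eps_admissible.
have [G1 [v1 p1 l1]] := fullshift_ex A_GL cps n_eps_admissible B_gaps theta setT.
have [G0 [v0 p0 l0]] := fullshift_ex A_GL cps n_eps_admissible B_gaps theta set0.
have GW G : vertical_limit theta G -> hull_pts G `<=` curlywedge A W.
  exact: (vertical_limit_sub A_GL cps W01 cW).
have [|d dh [e e0 h1]] := hit_frequency_ge _ (GW _ v1); first by move=> k; apply/p1.
have [k|y Gy|d' /andP[d'h d'1] h0] := @hit_frequency_le G0; first by move=> /p0.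
  have [l [Ll ly _]] := iffLR (curlywedgeP _ _ _) (GW _ v0 _ Gy).
  have [Wl ll1] : W l.2 /\ l.2 < 1 by apply: l0 => //; rewrite ly.
  have [|z lz] := lattice_lift A_normalized Ll.
    by rewrite ll1 andbT; have := W01 _ Wl; rewrite /= in_itv /= => /andP[].
  by exists z => //; rewrite -lz.
have T_gt0 q : (0 < #|dyadic_box (N := N) q|)%N by rewrite card_dyadic_box expn_gt0.
have orbit G := @orbit_measure R N L _ _ _ T_gt0 (@dyadic_pt_inj R N M M_unit)
  (@dyadic_dense R N M M_unit) (@dyadic_folner R N M) G.
have [nu1 [inv1 ge1 _]] := orbit G1; have [nu0 [inv0 _ le0]] := orbit G0.
have nu10 E : measurable E -> nu1 E = nu0 E.
  by move=> mE; rewrite (mu_uniq nu1)// (mu_uniq nu0).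
(* [x] is small enough for Bernoulli's inequality to give
   [1 - d' < d * (1 - x) ^+ (3 * N)]. *)
pose x := (d + d' - 1) / (d * (3 * N).+1%:R).
have N3 : 0 < (3 * N).+1%:R :> R by rewrite ltr0n.
have d0 : 0 < d by apply: lt_trans dh; rewrite invr_gt0.
have dd : 0 < d + d' - 1 by lra.
have x0 : 0 < x by rewrite divr_gt0// mulr_gt0.
have x1 : x <= 2^-1.
  rewrite ler_pdivrMr ?mulr_gt0//.
  have : 2 <= (3 * N).+1%:R :> R.
    by rewrite (ler_nat R 2) ltnS (leq_trans N_gt0)// leq_pmull.
  by rewrite -(ler_pM2l d0); lra.
pose k := 1 - x; have k0 : 0 < k by rewrite /k; lra.
have k1 : k < 1 by rewrite /k; lra.
have dk : 1 - d' < d * k ^+ (3 * N).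
  have := @bernoulli_le R x (3 * N); rewrite -/k (ltW x0) => /(_ _)/wrap[|h]; first by lra.
  apply: lt_le_trans (ler_wpM2l (ltW d0) h).
  have -> : d * (1 - (3 * N)%:R * x) = 1 - d' + (d + d' - 1) / (3 * N).+1%:R.
    rewrite /x -natr1; have : 0 <= (3 * N)%:R :> R by [].
    move: (3 * N)%:R => t t0; have t1 : t + 1 != 0 by lra.
    by field; rewrite t1 lt0r_neq0.
  by rewrite ltrDl divr_gt0.
pose a' : R := Num.min e 1 / 2; pose a := a' * k.
have e1 : 0 < Num.min e 1 by rewrite lt_min e0 ltr01.
have a'0 : 0 < a' by rewrite divr_gt0.
have min_e : Num.min e 1 <= e by rewrite ge_min lexx.
have min_1 : Num.min e 1 <= 1 by rewrite ge_min lexx orbT.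
have a'e : a' < e by rewrite /a'; lra.
have a'1 : a' <= 1 by rewrite /a'; lra.
have a0 : 0 < a by rewrite mulr_gt0.
have aa' : a < a' by rewrite gtr_pMr.
have ae : a < e by exact: lt_trans aa' a'e.
have cl : closed (closure (hit M a) : set X) by exact: closed_closure.
have mcl : measurable (closure (hit M a) : set (g_sigma_algebraType (@open X))).
  rewrite -[closure _]setCK; apply: measurableC; apply: sub_sigma_algebra.
  exact: closed_openC.
have mint : measurable (hit_interior M a' : set (g_sigma_algebraType (@open X))).
  by apply: sub_sigma_algebra; exact: hit_interior_open.
have ineq1 : ((d * (2 * a * k) ^+ N)%:E <= nu1 (closure (hit M a)))%E.
  have aei : 0 < a < e by rewrite a0.
  have rhoi : 0 <= 2 * a * k < 2 * a.
    by rewrite ltW ?mulr_gt0//= gtr_pMr// mulr_gt0.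
  apply: ge1 => //; have := h1 _ _ aei rhoi; apply: filterS => q /le_trans; apply.
  by apply: (frequency_mono _ T_gt0); exact: subset_closure.
have ineq0 : (nu0 (hit_interior M a') <= ((1 - d') * (2 * a' / k) ^+ N)%:E)%E.
  have a'i : 0 < a' <= 1 by rewrite a'0.
  have rhoi : 2 * a' < 2 * a' / k by rewrite ltr_pdivlMr// gtr_pMr// mulr_gt0.
  apply: le0; first exact: hit_interior_open.
  have := h0 _ _ a'i rhoi; apply: filterS => q; apply: le_trans.
  by apply: (frequency_mono _ T_gt0); exact: hit_interior_sub.
have : (nu1 (closure (hit M a)) <= nu0 (hit_interior M a'))%E.
  by rewrite nu10// le_measure ?inE//; exact: closure_hit.
move=> /(le_trans ineq1)/le_trans/(_ ineq0); rewrite lee_fin.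
(* Three factors [k] are lost: in the lower count, in passing from [a] to [a'], and in the upper
   count. Hence the exponent [3 * N] in the choice of [x]. *)
have -> : 2 * a * k = 2 * a' / k * k ^+ 3.
  by rewrite /a; field; rewrite lt0r_neq0.
rewrite exprMn mulrCA [leRHS]mulrC.
have Y0 : 0 < (2 * a' / k) ^+ N by rewrite exprn_gt0// divr_gt0// mulr_gt0.
by rewrite ler_pM2l// -exprM; lra.
Qed.

End NotUniquelyErgodic.

Theorem theorem6p3 (R : realType) (N : nat) (A : 'M[R]_(N + 1))
    (v : nat -> 'cV[int]_N) (n : nat -> nat) (eps : nat -> R)
    (C : set R) (B : nat -> set R)
    (N_gt0 : (0 < N)%N)
    (A_GL : A \in unitmx)
    (cps : cut_and_project A)
    (A_normalized : normalized A)
    (v_numbering : numbering v)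
    (n_eps_admissible : admissible A v n eps)
    (C0_cantor : cantor_set (residual (Iint A v n eps)))
    (C_cantor : cantor_set C)
    (C_01 : C `<=` `[0, 1] /\ C 0 /\ C 1)
    (B_gaps : gap_family C B) :
  let W := window (Iint A v n eps) B in
  let S := [set (lift_pt A (v (n k))).1 | k in [set: nat]] in
  let Lam := fun theta : R => curlywedge A (shiftR theta W) in
  (* (a) *)
  (forall theta : R,
    (forall beta : hullSpace (Lam theta) -> torus A,
      torus_parametrization beta ->
      let Xi := beta @^-1` [set torus_class A 0 (- theta)] in
      embedded_fullshift Xi S /\ grid Xi = curlywedge A W) /\
    (0 < topological_entropy (@hull_act R N (Lam theta)))%E) /\
  (* (b) *)
  (forall theta : R, ~ uniquely_ergodic (@hull_act R N (Lam theta))).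
Proof.
move=> W S Lam; split=> theta; last first.
  exact: (window_not_uniquely_ergodic N_gt0 A_GL cps A_normalized v_numbering
    n_eps_admissible B_gaps).
split; last first.
  exact: (window_entropy_gt0 N_gt0 A_GL cps A_normalized v_numbering
    n_eps_admissible B_gaps).
move=> beta beta_torus Xi.
have W01 : W `<=` `[0, 1] := construction_window_sub n_eps_admissible.
have XiE G : Xi G <-> vertical_limit theta G.
  exact: (torus_fibreE A_GL theta G beta_torus).
have gridE : grid Xi = curlywedge A W.
  apply/seteqP; split=> [x [G /XiE vG Gx]|x /curlywedgeP[l [Ll <- Wl]]].
    exact: (vertical_limit_sub A_GL cps W01 (construction_window_closed n_eps_admissible) vG).
  have [G vG Gl] := vertical_limit_through A_GL cps n_eps_admissible C0_cantor
    C_01 B_gaps theta Ll Wl.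
  by exists G => //; apply/XiE.
split => //; split.
- have [[beta_cont _ _] _] := beta_torus.
  by apply: preimage_closed => [G _|]; [exact: beta_cont|exact: torus_closed1].
- exact: (upper_density_gt0 A_normalized N_gt0 v_numbering n_eps_admissible A_GL cps).
- by rewrite gridE; exact: curlywedge_uniformly_discrete.
- move=> S' S'S.
  have [G [vG Gk _]] := fullshift_ex A_GL cps n_eps_admissible B_gaps theta
    [set k | S' (lift_pt A (v (n k))).1].
  exists G; first exact/XiE.
  apply/seteqP; split=> [x [Gx [k _ kx]]|x S'x].
    by rewrite -kx; apply/Gk; rewrite kx.
  split; last exact: S'S.
  by have [k _ kx] := S'S _ S'x; rewrite -kx in S'x *; apply/Gk.
Qed.
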